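(* Let $\mathcal X$ be a locally compact Polish space, $\bar\mu\in\mathcal P(\mathcal X)$ and $\tau\colon\mathcal X\to[0,+\infty]$ measurable, such that $\bar\mu(\{\tau=0\})=\bar\mu(\{\tau=+\infty\})=0$ and $\bar\mu(\{\xi<+\infty\})=0$. Define $I'\colon\mathcal M_1(\mathcal X)\to[0,+\infty]$ by $$I'(\nu)=\begin{cases}\nu_a(1/\tau)\,\mathbf H(\bar\nu_a|\bar\mu)+\nu_s(\xi)+(1-\nu(\mathcal X))\,\xi^\infty & \text{if }\nu_a(1/\tau)<+\infty,\\ +\infty&\text{otherwise.}\end{cases}$$ Then $I'$ is a good and convex functional on $\mathcal M_1(\mathcal X)$.
   Context: Fix a complete metric on $\mathcal X$ inducing its topology; $B_\delta(x)$ is the ball of radius $\delta$ centered at $x$. $\mathcal P(\mathcal X)$ is the set of Borel probability measures on $\mathcal X$. $\mathcal M_1(\mathcal X)$ is the set of positive Radon measures on $\mathcal X$ with total mass at most $1$, with the vague topology, i.e. the weakest topology making $\mu\mapsto\mu(f)$ continuous for all compactly supported continuous $f$; $\mu(f):=\int f\,d\mu$. With this topology $\mathcal M_1(\mathcal X)$ is a compact Polish space. Define $\xi\colon\mathcal X\to[0,+\infty]$ and $\xi^\infty\in[0,+\infty]$ by $$\xi(x)=\sup_{\delta>0}\sup\{c\ge0:\ \bar\mu(e^{c\tau}\mathbf 1_{B_\delta(x)})<+\infty\},\qquad \xi^\infty=\sup_{K\subset\mathcal X,\ K\text{ compact}}\sup\{c\ge0:\ \bar\mu(e^{c\tau}\mathbf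 1_{K^c})<+\infty\}.$$ For $\nu\in\mathcal M_1(\mathcal X)$, $\nu_a$ and $\nu_s$ are the absolutely continuous and singular parts of $\nu$ with respect to $\bar\mu$. If $\nu_a(1/\tau)\in\,]0,+\infty[$, $\bar\nu_a\in\mathcal P(\mathcal X)$ is the probability measure $\bar\nu_a(dx)=\frac{\frac1{\tau(x)}\nu_a(dx)}{\nu_a(1/\tau)}$. Conventions: $\nu_a(1/\tau)\,\mathbf H(\bar\nu_a|\bar\mu):=0$ whenever $\nu_a(1/\tau)=0$, and $0\cdot(+\infty)=0$. $\mathbf H(\nu|\mu)$ is the relative entropy: $\int h(\frac{d\nu}{d\mu})\,d\mu$ with $h(\varrho)=\varrho(\log\varrho-1)+1$ if $\nu\ll\mu$, and $+\infty$ otherwise. A functional $I\colon\mathcal Y\to[0,+\infty]$ on a Polish space $\mathcal Y$ is good if $\{y: I(y)\le M\}$ is compact for all $M>0$ and $I\not\equiv+\infty$. *)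

(* Defs.v *)
From HB Require Import structures.
From mathcomp Require Import all_boot all_order all_algebra.
From mathcomp Require Import interval_inference.
From mathcomp Require Import all_classical all_reals all_analysis measurable_realfun.

Set Implicit Arguments.
Unset Strict Implicit.
Unset Printing Implicit Defensive.

Import Order.TTheory GRing.Theory Num.Theory.
Import numFieldNormedType.Exports.

Local Open Scope classical_set_scope.
Local Open Scope ring_scope.

#[short(type="completeMetricType")]
HB.structure Definition CompleteMetric (R : numDomainType) :=
  {T of CompletePseudoMetric R T & Metric R T}.

Definition separable (X : topologicalType) :=
  exists2 D : set X, countable D & dense D.

Notation borel X := (g_sigma_algebraType (@open X)).

Section good_convex.
Local Open Scope ereal_scope.
Local Open Scope convex_scope.
Context {R : realType}.

Definition good_functional (Y : topologicalType) (I : Y -> \bar R) :=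
  [/\ forall y, 0 <= I y,
      forall M : R, (0 < M)%R -> compact [set y | I y <= M%:E] &
      exists y, I y != +oo].

(* In \bar R, 0 * +oo = 0. *)
Definition convex_functional (E : convType R) (I : E -> \bar R) :=
  forall (t : {i01 R}) (a b : E),
    I (a <| t |> b) <= t%:num%:E * I a + (1 - t%:num)%:E * I b.

End good_convex.

Section lebesgue_decomposition.
Local Open Scope ereal_scope.
Context d (T : measurableType d) (R : realType).

Definition mutually_singular (nu mu : set T -> \bar R) :=
  exists N, [/\ measurable N, mu N = 0 & nu (~` N) = 0].

Definition is_lebesgue_decomposition (nu mu nua nus : set T -> \bar R) :=
  [/\ forall A, measurable A -> nu A = nua A + nus A,
      nua `<< mu & mutually_singular nus mu].

Lemma lebesgue_decomposition (nu : {finite_measure set T -> \bar R})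
    (mu : {measure set T -> \bar R}) :
  exists p : {finite_measure set T -> \bar R} * {finite_measure set T -> \bar R},
    is_lebesgue_decomposition nu mu p.1 p.2.
Proof.
pose S := [set nu N | N in [set N | measurable N /\ mu N = 0]].
have S_fin : ereal_sup S \is a fin_num.
  rewrite ge0_fin_numE; last first.
    by apply: ereal_sup_ubound; exists set0 => //; split => //; rewrite measure0.
  apply: (@le_lt_trans _ _ (nu setT)).
    apply: ge_ereal_sup => _ [N [mN _] <-].
    by rewrite le_measure// inE.
  by rewrite -ge0_fin_numE// fin_num_measure.
have exN n : exists N, [/\ measurable N, mu N = 0 &
    ereal_sup S - n.+1%:R^-1%:E < nu N].
  have [_ [N [mN N0] <-] ltN] := @ub_ereal_sup_adherent _ S n.+1%:R^-1
    ltac:(by []) S_fin.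
  by exists N.
have /(_ _)/cid-/all_sig[N /all_and3[mN N0 ltN]] := exN.
pose N_ := \bigcup_n N n.
have mN_ : measurable N_ by exact: bigcup_measurable.
have N_0 : mu N_ = 0.
  apply/eqP; rewrite -measure_le0.
  apply: (le_trans (measure_sigma_subadditive _ mN mN_ _)) => //.
  by rewrite eseries0.
have N_max : ereal_sup S <= nu N_.
  apply/lee_addgt0Pr => e e0.
  have [n ne] : exists n, (n.+1%:R^-1 < e)%R.
    by have /ltr_add_invr[n] := e0; rewrite add0r; exists n.
  rewrite -leeBlDr//; apply: (@le_trans _ _ (nu (N n))).
    apply: le_trans (ltW (ltN n)).
    by rewrite leeB// lee_fin ltW.
  rewrite le_measure ?inE//; exact: bigcup_sup.
have mC := measurableC mN_.
have fin D : measurable D -> nu D < +oo.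
  by move=> mD; rewrite -ge0_fin_numE// fin_num_measure.
exists ((mfrestr mC (fin _ mC) : {finite_measure set T -> \bar R}),
        (mfrestr mN_ (fin _ mN_) : {finite_measure set T -> \bar R})).
split=> [A mA|/=|/=].
- rewrite /= /mfrestr /mrestr -measureU; first last.
  + by rewrite setIACA setICl setI0.
  + exact: measurableI.
  + exact: measurableI.
  by rewrite -setIUr setUC setUv setIT.
- apply/null_content_dominatesP => A mA muA0.
  rewrite /mfrestr /mrestr; apply/eqP; rewrite -measure_le0 leNgt.
  apply/negP => nuA0.
  have mAN : measurable (A `&` ~` N_) by exact: measurableI.
  suff : nu N_ + nu (A `&` ~` N_) <= nu N_.
    by apply/negP; rewrite -ltNge lteDl// fin_num_measure.
  apply: le_trans N_max; apply: ereal_sup_ubound.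
  exists (N_ `|` (A `&` ~` N_)).
    split; first exact: measurableU.
    apply/eqP; rewrite -measure_le0.
    apply: (le_trans (measureU2 _ _ _)) => //.
    by rewrite [X in X + _]N_0 add0e -muA0 le_measure// inE.
  by rewrite measureU// setICA setICr setI0.
- by exists N_; split => //; rewrite /mfrestr /mrestr setICl measure0.
Qed.

Definition abs_part (nu : {finite_measure set T -> \bar R})
    (mu : {measure set T -> \bar R}) : {finite_measure set T -> \bar R} :=
  (sval (cid (lebesgue_decomposition nu mu))).1.

Definition sing_part (nu : {finite_measure set T -> \bar R})
    (mu : {measure set T -> \bar R}) : {finite_measure set T -> \bar R} :=
  (sval (cid (lebesgue_decomposition nu mu))).2.

Lemma abs_sing_partP (nu : {finite_measure set T -> \bar R})
    (mu : {measure set T -> \bar R}) :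
  is_lebesgue_decomposition nu mu (abs_part nu mu) (sing_part nu mu).
Proof. by rewrite /abs_part /sing_part; case: cid. Qed.

End lebesgue_decomposition.

Section density_measure.
Local Open Scope ereal_scope.
Context d (T : measurableType d) (R : realType).
Variables (mu : {measure set T -> \bar R}) (f : T -> \bar R).

Definition density_measure & (forall x, 0 <= f x)
  & measurable_fun [set: T] f := fun A : set T => \int[mu]_(x in A) f x.

Hypotheses (f0 : forall x, 0 <= f x) (mf : measurable_fun [set: T] f).

Local Notation fmu := (density_measure f0 mf).

Let fmu0 : fmu set0 = 0.
Proof. exact: integral_set0. Qed.

Let fmu_ge0 A : 0 <= fmu A.
Proof. by apply: integral_ge0 => x _; exact: f0. Qed.

Let fmu_sigma_additive : semi_sigma_additive fmu.
Proof. exact: semi_sigma_additive_nng_induced. Qed.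

HB.instance Definition _ := isMeasure.Build _ _ _ fmu
  fmu0 fmu_ge0 fmu_sigma_additive.

End density_measure.

Section relative_entropy.
Local Open Scope ereal_scope.
Context d (T : measurableType d) (R : realType).

(* [ln 0 = 0], so that [entropy_fun 0 = 1]. *)
Definition entropy_fun (r : R) : R := (r * (ln r - 1) + 1)%R.

Definition relative_entropy (nu : {finite_measure set T -> \bar R})
    (mu : {sigma_finite_measure set T -> \bar R}) : \bar R :=
  if `[< nu `<< mu >] then
    \int[mu]_x (entropy_fun
      (fine (Radon_Nikodym (charge_of_finite_measure nu) mu x)))%:E
  else +oo.

End relative_entropy.

Section radon.
Local Open Scope ereal_scope.
Context {R : realType} {X : completeMetricType R}.

Definition radon (nu : set (borel X) -> \bar R) :=
  (forall K : set X, compact K -> nu K < +oo) /\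
  (forall A : set (borel X), measurable A ->
    nu A = ereal_sup [set nu K | K in [set K : set X | compact K /\ K `<=` A]]).

End radon.

(* A library measure is a function on all sets, constrained on measurable ones;
   [M1_junk] makes equality in [M1 X] coincide with equality of measures. *)
Record M1 {R : realType} (X : completeMetricType R) := MkM1 {
  M1_measure :> subprobability (borel X) R ;
  M1_radon : radon M1_measure ;
  M1_junk : forall A : set (borel X), ~ measurable A -> M1_measure A = 0%E }.

Section M1_theory.
Local Open Scope ereal_scope.
Context {R : realType} {X : completeMetricType R}.

HB.instance Definition _ := gen_eqMixin (M1 X).
HB.instance Definition _ := gen_choiceMixin (M1 X).

Lemma eq_M1 (nu0 nu1 : M1 X) :
  (forall A : set (borel X), measurable A -> nu0 A = nu1 A) -> nu0 = nu1.
Proof.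
move=> h; have {h} : (nu0 : set (borel X) -> \bar R) = nu1.
  apply/funext => A; have [/h//|mA] := pselect (measurable A).
  by rewrite !M1_junk.
case: nu0 nu1 => [m0 r0 j0] [m1 r1 j1] /= m01.
have {}m01 : m0 = m1.
  case: m0 m1 m01 {r0 j0 r1 j1} => [f0 c0] [f1 c1] /= f01; subst f1.
  case: c0 c1 => [[a0 b0] [c0] [d0] [e0] [g0] [h0]]
    [[a1 b1] [c1] [d1] [e1] [g1] [h1]].
  by rewrite (Prop_irrelevance a0 a1) (Prop_irrelevance b0 b1)
    (Prop_irrelevance c0 c1) (Prop_irrelevance d0 d1) (Prop_irrelevance e0 e1)
    (Prop_irrelevance g0 g1) (Prop_irrelevance h0 h1).
by subst m1; rewrite (Prop_irrelevance r0 r1) (Prop_irrelevance j0 j1).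
Qed.

Lemma compact_borel (K : set X) : compact K -> measurable (K : set (borel X)).
Proof.
move=> cK; rewrite -[K]setCK; apply: measurableC; apply: sub_sigma_algebra.
exact/closed_openC/(compact_closed (@metric_hausdorff R X)).
Qed.

Section conv.
Variables (t : {i01 R}) (nu0 nu1 : M1 X).

Let t0 : (0 <= t%:num)%R. Proof. by []. Qed.
Let s0 : (0 <= 1 - t%:num)%R. Proof. by rewrite subr_ge0. Qed.

Definition M1_conv_fun (A : set (borel X)) : \bar R :=
  t%:num%:E * nu0 A + (1 - t%:num)%:E * nu1 A.

Let conv0 : M1_conv_fun set0 = 0.
Proof. by rewrite /M1_conv_fun !measure0 !mule0 adde0. Qed.

Let conv_ge0 A : 0 <= M1_conv_fun A.
Proof. by rewrite adde_ge0// mule_ge0// lee_fin. Qed.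

Let conv_sigma_additive : semi_sigma_additive M1_conv_fun.
Proof.
move=> F mF tF mUF.
have -> : M1_conv_fun (\bigcup_n F n) =
    measure_add (mscale (NngNum t0) nu0) (mscale (NngNum s0) nu1)
      (\bigcup_n F n).
  by rewrite measure_addE.
rewrite (_ : (fun n => _) = (fun n => \sum_(0 <= i < n)
    measure_add (mscale (NngNum t0) nu0) (mscale (NngNum s0) nu1) (F i))).
  exact: measure_semi_sigma_additive.
by apply/funext => n; apply: eq_bigr => i _; rewrite measure_addE.
Qed.

HB.instance Definition _ := isMeasure.Build _ _ _ M1_conv_fun
  conv0 conv_ge0 conv_sigma_additive.

Let conv_le1 : M1_conv_fun setT <= 1.
Proof.
rewrite /M1_conv_fun -[leRHS](_ : t%:num%:E * 1 + (1 - t%:num)%:E * 1 = 1).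
  by apply: leeD; apply: lee_wpmul2l; rewrite ?lee_fin// sprobability_setT.
by rewrite !mule1 -EFinD addrC subrK.
Qed.

HB.instance Definition _ :=
  Measure_isSubProbability.Build _ _ _ M1_conv_fun conv_le1.

Lemma M1_conv_radon : radon M1_conv_fun.
Proof.
split=> [K cK|A mA].
  apply: (@le_lt_trans _ _ 1); last exact: ltry.
  apply: le_trans conv_le1.
  by apply: le_measure; rewrite ?inE//; exact: compact_borel.
have le_compact (nu : M1 X) (K L : set X) : compact K -> compact L ->
    K `<=` L -> nu K <= nu L.
  by move=> cK cL KL; apply: le_measure; rewrite ?inE//; exact: compact_borel.
apply/eqP; rewrite eq_le; apply/andP; split; last first.
  apply: ge_ereal_sup => _ [K [cK KA] <-].
  by apply: le_measure; rewrite ?inE//; exact: compact_borel.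
apply/lee_addgt0Pr => e e0.
have adh (nu : M1 X) : exists K : set X,
    [/\ compact K, K `<=` A & nu A - e%:E <= nu K].
  have [_ nuA] := M1_radon nu.
  have fin : ereal_sup [set nu K | K in [set K : set X | compact K /\ K `<=` A]]
      \is a fin_num.
    by rewrite -(nuA _ mA); exact: fin_num_measure.
  have [_ [K [cK KA] <-] /ltW ltK] := ub_ereal_sup_adherent e0 fin.
  by exists K; split => //; move: ltK; rewrite -(nuA _ mA).
have [K0 [cK0 K0A le0]] := adh nu0.
have [K1 [cK1 K1A le1]] := adh nu1.
have cK : compact (K0 `|` K1) by exact: compactU.
apply: (@le_trans _ _ (M1_conv_fun (K0 `|` K1) + e%:E)); last first.
  rewrite leeD2r//; apply: ereal_sup_ubound; exists (K0 `|` K1) => //.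
  by split=> // x [/K0A|/K1A].
have -> : e%:E = t%:num%:E * e%:E + (1 - t%:num)%:E * e%:E.
  by rewrite -!EFinM -EFinD -mulrDl addrC subrK mul1r.
rewrite /M1_conv_fun addeACA -!muleDr//; last 2 first.
  by rewrite fin_num_adde_defl.
  by rewrite fin_num_adde_defl.
apply: leeD; apply: lee_wpmul2l; rewrite ?lee_fin// -leeBlDr//.
  by apply: le_trans le0 _; apply: le_compact => // x ?; left.
by apply: le_trans le1 _; apply: le_compact => // x ?; right.
Qed.

Lemma M1_conv_junk (A : set (borel X)) : ~ measurable A -> M1_conv_fun A = 0.
Proof. by move=> mA; rewrite /M1_conv_fun !M1_junk// !mule0 adde0. Qed.

Definition M1_conv : M1 X := MkM1 M1_conv_radon M1_conv_junk.

End conv.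

Let M1_conv1 (nu0 nu1 : M1 X) : M1_conv (1%R%:i01 : {i01 R}) nu0 nu1 = nu0.
Proof.
by apply: eq_M1 => A mA; rewrite /= /M1_conv_fun/= subrr mul0e adde0 mul1e.
Qed.

Let M1_convmm t nu : M1_conv t nu nu = nu.
Proof.
apply: eq_M1 => A mA; rewrite /= /M1_conv_fun/=.
by rewrite -ge0_muleDl ?lee_fin ?subr_ge0// -EFinD addrC subrK mul1e.
Qed.

Let M1_convC t nu0 nu1 :
  M1_conv t nu0 nu1 = M1_conv (1 - t%:inum)%R%:i01 nu1 nu0.
Proof.
by apply: eq_M1 => A mA; rewrite /= /M1_conv_fun/= subKr addeC.
Qed.

Let M1_convA : convex_quasi_associative M1_conv.
Proof.
move=> p q r s a b c prs spq; apply: eq_M1 => A mA.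
rewrite /= /M1_conv_fun /= /M1_conv_fun.
rewrite -(fineK (fin_num_measure a A mA)) -(fineK (fin_num_measure b A mA)).
rewrite -(fineK (fin_num_measure c A mA)).
rewrite -!EFinM -!EFinD; congr EFin.
have spq' : (1 - s%:num = (1 - p%:num) * (1 - q%:num))%R := spq.
have pqsr := ConvexQuasiAssoc.pq_sr prs spq'.
by rewrite !mulrDr !mulrA pqsr -spq' prs (mulrC r%:num) addrA.
Qed.

HB.instance Definition _ := isConvexSpace.Build R (M1 X)
  M1_conv1 M1_convmm M1_convC M1_convA.

End M1_theory.

Section vague_topology.
Context {R : realType} (X : completeMetricType R).

Definition Cc :=
  {f : X -> R | continuous f /\ compact (closure [set x | f x != 0])}.

Definition vague : Type := sup_topology (fun f : Cc =>
  Topological.class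
    (initial_topology (fun nu : M1 X => \int[nu]_x (sval f x)))).

HB.instance Definition _ := Topological.on vague.
HB.instance Definition _ := Topological.copy (M1 X) vague.

End vague_topology.

Section rate_functional.
Local Open Scope ereal_scope.
Context {R : realType} {X : completeMetricType R}.
Variables (mubar : probability (borel X) R) (tau : borel X -> \bar R).

Definition exp_rate (A : set X) : \bar R :=
  ereal_sup [set c%:E | c in [set c : R | (0 <= c)%R /\
    \int[mubar]_(y in A) expeR (c%:E * tau y) < +oo]].

Definition xi (x : X) : \bar R :=
  ereal_sup [set exp_rate (ball x delta) | delta in [set delta : R |
    (0 < delta)%R]].

Definition xi_infty : \bar R :=
  ereal_sup [set exp_rate (~` K) | K in [set K : set X | compact K]].

Hypotheses (tau_ge0 : forall x, 0 <= tau x)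
  (mtau : measurable_fun [set: borel X] tau).

Lemma inv_tau_ge0 x : 0 <= (tau x)^-1.
Proof. by rewrite inve_ge0. Qed.

Lemma measurable_inv_tau :
  measurable_fun [set: borel X] (fun x => (tau x)^-1).
Proof.
apply: (measurability _ (ErealGenCInfty.measurableE R)) => //.
move=> _ [_ [r ->] <-].
have [r_le0|r_gt0] := leP r 0%R.
  rewrite (_ : _ @^-1` _ = setT); first exact: measurableI.
  apply/seteqP; split=> // x _ /=.
  by rewrite in_itv/= andbT (le_trans _ (inv_tau_ge0 x))// lee_fin.
rewrite (_ : _ @^-1` _ = [set x | tau x <= r%:E^-1]).
  exact: emeasurable_fun_infty_c.
apply/seteqP; split=> x /=; rewrite in_itv/= andbT inve_pge// inE ?lee_fin//;
  exact: ltW.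
Qed.

(* Outside of the case [0 < \int[nua]_x (tau x)^-1 < +oo], [mnormalize] returns
   its default argument [mubar], which [rate] does not depend on. *)
Definition nubar (nua : {measure set (borel X) -> \bar R}) :
    probability (borel X) R :=
  mnormalize (density_measure nua inv_tau_ge0 measurable_inv_tau) mubar.

(* [x^-1] is [+oo] at 0 and 0 at [+oo]. *)
Definition rate (nu : M1 X) : \bar R :=
  let nua := abs_part nu mubar in
  let nus := sing_part nu mubar in
  let m := \int[nua]_x (tau x)^-1 in
  if m < +oo then
    m * relative_entropy (nubar nua) mubar + \int[nus]_x xi x
    + (1 - nu [set: X]) * xi_infty
  else +oo.

End rate_functional.

(* Main.v *)
(* On M_1(X) the functional I' equals the dual functional
     J(nu) = sup { nu(f) + c : f in C_c(X), c real, mubar(e^(tau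
       (f + c))) <= 1 },
   a supremum of vaguely continuous affine functionals, hence convex and lower
   semicontinuous; since M_1(X) is vaguely compact, its sublevels are compact.

   J <= I': if psi = f + c is admissible then nu_a(psi) is bounded by the
   entropy term (Gibbs' variational inequality), psi <= xi by continuity of psi,
   and c <= xi^oo because psi = c outside of a compact set.

   I' <= J: test functions are built independently on the absolutely continuous
   part (Donsker-Varadhan: psi close to ln(d nubar_a / d mubar) / tau), on a
   mubar-null set carrying nu_s (psi < xi), and at infinity (c < xi^oo).
   Simple functions on disjoint compact sets suffice. They are approximated by
   continuous functions, with dominated convergence in the exponential
   constraint: for psi <= a on a compact set contained in {xi > a}, e^(a tau) is
   integrable near that set. The hypothesis xi = oo almost everywhere is what
   makes this possible for the absolutely continuous part.

   Compactness of M_1(X): the limit of the measures along an ultrafilter is a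
   finitely additive set function; its values on compact sets form a content,
   whose Caratheodory extension is the vague limit.

   J is finite somewhere because tau psi <= e^(tau psi) bounds nu(psi) when
   nu is proportional to tau restricted to {tau <= n}. *)
Require Import Defs.
From HB Require Import structures.
From mathcomp Require Import all_boot all_order all_algebra.
From mathcomp Require Import finmap interval_inference.
From mathcomp Require Import all_classical all_reals all_analysis measurable_realfun.
From mathcomp Require Import lra.

Set Implicit Arguments.
Unset Strict Implicit.
Unset Printing Implicit Defensive.

Import Order.TTheory GRing.Theory Num.Theory.
Import numFieldNormedType.Exports.

Local Open Scope classical_set_scope.
Local Open Scope ring_scope.

(** * Distance to a set, compact exhaustions and Borel regularity *)

(** The Lebesgue decomposition is not vaguely continuous: absolutely continuous measures can
    concentrate into singular ones and mass can leave every compact set. Lower semicontinuity is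
    therefore invisible term by term, and the three terms have to be recognized as a single
    supremum. The dual constraint comes from writing nu_a = m tau nubar_a with m = nu_a(1/tau): then
    nu_a(psi) = m nubar_a(tau psi), and m H(nubar_a | mubar) bounds this for all m at once as soon
    as log mubar(e^(tau psi)) <= 0. In the converse direction the constraint is kept strict, so that
    cutting a test function to a compact set and then smoothing it costs less than the slack.
    Positive parts need an integrable majorant of the exponential, whereas subtracting a nonnegative
    function only decreases it; the two parts are therefore approximated separately. The term c (1 -
    nu(X)) arises because functions equal to c far away can tend to 0 pointwise. *)

Section set_distance.
Context {R : realType} {X : completeMetricType R}.
Implicit Types (A K U : set X) (x y : X).

(* The truncation at 1 makes the infimum meaningful when [A] is empty. *)
Definition set_dist A x : R := inf (1 |` [set mdist x a | a in A]).

Let set_dist_lb A x : has_lbound (1 |` [set mdist x a | a in A]).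
Proof. by exists 0 => _ [->//|[a _ <-]]; exact: mdist_ge0. Qed.

Let set_dist_neq0 A x : 1 |` [set mdist x a | a in A] !=set0.
Proof. by exists 1; left. Qed.

Lemma set_dist_ge0 A x : 0 <= set_dist A x.
Proof. by apply: lb_le_inf => // _ [->//|[a _ <-]]; exact: mdist_ge0. Qed.

Lemma set_dist_le1 A x : set_dist A x <= 1.
Proof. by apply: ge_inf => //; left. Qed.

Lemma set_dist_le A x a : A a -> set_dist A x <= mdist x a.
Proof. by move=> Aa; apply: ge_inf => //; right; exists a. Qed.

Lemma set_dist_triangle A x y : set_dist A x <= mdist x y + set_dist A y.
Proof.
rewrite -lerBlDl; apply: lb_le_inf => // _ [->|[a Aa <-]].
  by rewrite lerBlDl (le_trans (set_dist_le1 A x))// lerDr mdist_ge0.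
by rewrite lerBlDl (le_trans (set_dist_le x Aa))// metric_triangle.
Qed.

(** Beyond 1 the truncated infimum says nothing about the points of [A], which may be empty; hence
    the bound on [e]. *)
Lemma set_dist_lt A x e : e <= 1 -> set_dist A x < e ->
  exists2 a, A a & mdist x a < e.
Proof.
move=> e1 xe; have e0 : 0 < e - set_dist A x by rewrite subr_gt0.
have [|z []] := inf_adherent e0 (E := 1 |` [set mdist x a | a in A]).
- by split.
- by move=> ->; rewrite [_ + _]addrC subrK ltNge e1.
- by case=> a Aa <-; rewrite [_ + _]addrC subrK; exists a.
Qed.

Lemma set_dist_eq0 A x : A x -> set_dist A x = 0.
Proof.
move=> Ax; apply/eqP; rewrite eq_le set_dist_ge0 andbT.
by rewrite -(mdistxx x) set_dist_le.
Qed.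

Lemma set_dist_continuous A : continuous (set_dist A).
Proof.
move=> x; apply/cvgrPdist_le => e e0; near=> y.
have xy : mdist x y < e.
  near: y; suff : nbhs x [set y | mdist x y < e] by [].
  by rewrite -ballEmdist; exact: nbhsx_ballx.
rewrite ler_distlC lerBlDr; apply/andP; split.
  by rewrite (le_trans (set_dist_triangle A x y))// addrC lerD2l ltW.
by rewrite addrC (le_trans (set_dist_triangle A y x))// lerD2r metric_sym ltW.
Unshelve. all: by end_near. Qed.

Lemma set_dist_gt0 A x : closed A -> ~ A x -> 0 < set_dist A x.
Proof.
move=> cA nAx; rewrite lt_neqAle set_dist_ge0 andbT; apply/eqP => x0.
have : nbhs x (~` A) by apply: open_nbhs_nbhs; split=> //; exact: closed_openC.
move/nbhs_ballP => [e /= e0]; rewrite ballEmdist => xA.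
have [||a Aa xa] := @set_dist_lt A x (Num.min e 1).
- by rewrite ge_min lexx orbT.
- by rewrite -x0 lt_min e0 ltr01.
- by apply: (xA a) => //=; rewrite (lt_le_trans xa)// ge_min lexx.
Qed.

Lemma closed_set_dist_ge A e : closed [set x | e <= set_dist A x].
Proof.
apply: (@closed_comp _ _ (set_dist A) [set z | e <= z]); last exact: closed_ge.
by move=> x _; exact: set_dist_continuous.
Qed.

(** A Lebesgue number argument: near-covering compactness makes the radius of a ball inside [U]
    uniform over [K]. *)
Lemma compact_set_dist K U : compact K -> open U -> K `<=` U ->
  exists e, [/\ 0 < e, e <= 1 & forall x, set_dist K x < e -> U x].
Proof.
move=> /compact_near_coveringP cK oU KU.
have : \forall e \near 0^'+, K `<=` [set x | forall y, mdist x y < e -> U y].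
  apply: (cK _ _ (fun e => [set x | forall y, mdist x y < e -> U y])) => x Kx.
  have /nbhs_ballP[e /= e0] : nbhs x U by apply: open_nbhs_nbhs; split => //;
    exact: KU.
  rewrite ballEmdist => xU.
  exists (ball x (e / 2), [set d | d <= e / 2]) => /=.
    split; first by apply: nbhsx_ballx; rewrite divr_gt0.
    by apply: nbhs_right_le; rewrite divr_gt0.
  move=> [z d]/= [+ de] y zy; rewrite ballEmdist/= => xz.
  apply: xU => /=; rewrite (le_lt_trans (metric_triangle _ z _))//.
  by rewrite [ltRHS]splitr ltrD// (lt_le_trans zy).
move=> /filterI /(_ (nbhs_right_gt 0)) /filterI /(_ (nbhs_right_le ltr01)).
move=> /filter_ex[e [[Ke e0] e1]]; exists e; split => // x.
by move=> /(set_dist_lt e1)[a Ka xa]; apply: (Ke a Ka); rewrite metric_sym.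
Qed.

End set_distance.

Lemma metric_compact_closed {R : realType} {X : completeMetricType R}
  (K : set X) : compact K -> closed K.
Proof. exact: (compact_closed (@metric_hausdorff R X)). Qed.

Section compact_exhaustion.
Context {R : realType} {X : completeMetricType R}.
Hypotheses (separableX : separable X) (lcX : locally_compact [set: X]).

Let compact_nbhs (x : X) : exists U, nbhs x U /\ compact U.
Proof.
have /= [] := lcX (x := x) I; move=> U; rewrite withinE/= => -[V xV VU] [cU _].
exists U; split => //; apply: filterS xV => y Vy.
have : (V `&` setT) y by split.
by rewrite -VU => -[].
Qed.

Lemma compact_open_nbhs (K : set X) : compact K ->
  exists V, [/\ open V, K `<=` V & compact (closure V)].
Proof.
have /choice[U /all_and2[nU cU]] := compact_nbhs.
move=> cK.
have : cover_compact K by rewrite -compact_cover.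
move=> /(_ X setT (fun x => (U x)°)); case; first by move=> x _;
  exact: open_interior.
  by move=> x Kx; exists x => //; exact: nU.
move=> D _ KD; exists (cover [set` D] (fun x => (U x)°)); split => //.
  by apply: bigcup_open => x _; exact: open_interior.
have cB : compact (\big[setU/set0]_(x <- D) U x).
  by apply: bigsetU_compact => x _; exact: cU.
apply: (subclosed_compact _ cB); first exact: closed_closure.
rewrite [X in _ `<=` X](closure_id _).1; last exact: metric_compact_closed cB.
apply: closure_subset => y [x /= xD Uy].
rewrite -bigcup_fset; exists x => //; exact: interior_subset Uy.
Qed.

(** Balls around a countable dense set form a countable family; those whose closure is not compact
    are replaced by the empty set, and local compactness leaves enough of the others. *)
Lemma compact_exhaustion : exists C : nat -> set X,
  [/\ forall n, compact (C n), {homo C : n m / (n <= m)%N >-> n `<=` m} &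
      \bigcup_n C n = setT].
Proof.
have [D cD dD] := separableX.
have [f Df] : exists f : nat -> X, D `<=` range f.
  by have /pcard_surjP[f fD] := cD; exists f => x /fD.
pose B i j := closure (ball (f i) j.+1%:R^-1).
pose E i j := if `[< compact (B i j) >] then B i j else set0.
have cE i j : compact (E i j).
  by rewrite /E; case: asboolP => // _; exact: compact0.
exists (fun n => \bigcup_(i < n) \bigcup_(j < n) E i j); split.
- move=> n; rewrite bigcup_mkord; apply: bigsetU_compact => i _.
  by rewrite bigcup_mkord; apply: bigsetU_compact => j _.
- move=> n m nm x [i /= im [j /= jm Ex]].
  by exists i => /=; [exact: leq_trans nm|exists j => //=; exact: leq_trans nm].
- apply/seteqP; split => // x _.
  have [U [/nbhs_ballP[e /= e0 xU] cU]] := compact_nbhs x.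
  (* With radius below [e / 2], a ball that contains [x] stays inside [ball x e], hence inside the
     compact [U]. *)
  have [j je] : exists j : nat, j.+1%:R^-1 < e / 2.
    have /ltr_add_invr[j] : 0 < e / 2 by rewrite divr_gt0.
    by rewrite add0r; exists j.
  have jgt0 : 0 < j.+1%:R^-1 :> R by rewrite invr_gt0.
  have xO : (ball x j.+1%:R^-1)° !=set0 by exists x; apply: nbhsx_ballx.
  have [y [/interior_subset xy /Df[i _ fiy]]] :=
    dD _ xO (@open_interior _ (ball x j.+1%:R^-1)).
  rewrite -{}fiy in xy.
  have cB : compact (B i j).
    apply: (subclosed_compact _ cU); first exact: closed_closure.
    rewrite [X in _ `<=` X](closure_id _).1; last first.
      exact: metric_compact_closed cU.
    apply: closure_subset => z /(ball_triangle xy) xz; apply: xU.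
    by apply: le_ball xz; rewrite (splitr e) lerD// ltW.
  exists (maxn i j).+1 => //; exists i => /=; first by rewrite ltnS leq_maxl.
  exists j => /=; first by rewrite ltnS leq_maxr.
  rewrite /E asboolT//; apply: subset_closure; exact/ball_sym.
Qed.

End compact_exhaustion.

Section borel_sets.
Context {R : realType} {X : completeMetricType R}.

Lemma borel_open (U : set X) : open U -> measurable (U : set (borel X)).
Proof. exact: sub_sigma_algebra. Qed.

Lemma borel_closed (F : set X) : closed F -> measurable (F : set (borel X)).
Proof.
move=> cF; rewrite -[F]setCK; apply: measurableC; apply: borel_open.
exact: closed_openC.
Qed.

Lemma borel_continuous (f : X -> R) :
  continuous f -> measurable_fun [set: borel X] (f : borel X -> R).
Proof.
move=> /continuousP cf.
apply: (measurability _ (RGenOpens.measurableE R)).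
move=> _ [_ [a [b ->]] <-].
by rewrite setTI; apply: borel_open; apply: cf; exact: interval_open.
Qed.

End borel_sets.

Lemma nonincreasing_measure_lt d (T : measurableType d) (R : realType)
    (mu : {finite_measure set T -> \bar R}) (D : nat -> set T) (e : \bar R) :
  (forall n, measurable (D n)) -> {homo D : n m / (n <= m)%N >-> m `<=` n} ->
  (mu (\bigcap_n D n) < e)%E -> exists n, (mu (D n) < e)%E.
Proof.
move=> mD hD De.
have D0 : (mu (D 0%N) < +oo)%E by rewrite -ge0_fin_numE// fin_num_measure.
have cD : (mu \o D) n @[n --> \oo] --> mu (\bigcap_n D n).
  apply: nonincreasing_cvg_mu => //; first exact: bigcap_measurable.
  by move=> n m nm; apply/subsetPset; exact: hD.
have : nbhs (mu (\bigcap_n D n)) [set z | (z < e)%E].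
  by apply: open_nbhs_nbhs; split => //; exact: open_ereal_lt_ereal.
by move=> /cD [n _ nD]; exists n; apply: nD => /=.
Qed.

Section borel_regularity.
Context {R : realType} {X : completeMetricType R}.
Variable mu : {finite_measure set (borel X) -> \bar R}.
Local Open Scope ereal_scope.

Let regular (A : set X) := forall e : R, (0 < e)%R ->
  exists F U : set X, [/\ closed F, open U, F `<=` A, A `<=` U &
                          mu (U `\` F) < e%:E].

(** Points at distance at least [1/(n+1)] from the complement form closed sets that increase to
    [U]. *)
Let regular_open U : open U -> regular U.
Proof.
move=> oU e e0; pose F n := [set x : X | (n.+1%:R^-1 <= set_dist (~` U) x)%R].
have cF n : closed (F n) by exact: closed_set_dist_ge.
have FU n : F n `<=` U.
  move=> x nx; apply: contrapT => Ux; move: nx.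
  by rewrite /F/= set_dist_eq0// leNgt invr_gt0 ltr0n.
have [|||n Un] := @nonincreasing_measure_lt _ _ _ mu (fun n => U `\` F n) e%:E.
- by move=> n; apply: measurableD; [exact: borel_open|exact: borel_closed].
- move=> n m nm x [Ux nFx]; split => // Fnx; apply: nFx.
  by apply: le_trans Fnx; rewrite lef_pV2 ?posrE// ler_nat ltnS.
- rewrite (_ : \bigcap_n _ = set0) ?measure0 ?lte_fin//.
  apply/seteqP; split => // x xUF.
  have [Ux _] := xUF 0%N I.
  have : (0 < set_dist (~` U) x)%R.
    by apply: set_dist_gt0; [exact: open_closedC|exact].
  move=> /ltr_add_invr[n]; rewrite add0r => nx.
  by have [_] := xUF n I; apply; exact: ltW.
- by exists (F n), U; split.
Qed.

Let regularC A : regular A -> regular (~` A).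
Proof.
move=> rA e e0; have [F [U [cF oU FA AU ltU]]] := rA e e0.
exists (~` U), (~` F); split.
- exact: open_closedC.
- exact: closed_openC.
- exact: subsetC.
- exact: subsetC.
- by rewrite setDE setCK setIC -setDE.
Qed.

Let regular_bigcup (A : nat -> set X) :
  (forall n, regular (A n)) -> regular (\bigcup_n A n).
Proof.
move=> rA e e0.
have e20 : (0 < e / 2)%R by rewrite divr_gt0.
have ek k : (0 < e / 2 / (2 ^ k.+1)%:R)%R by rewrite divr_gt0// ltr0n expn_gt0.
have /choice[F /choice[U]] := fun k => rA k _ (ek k).
move=> /all_and5[cF oU FA AU ltU].
pose V := \bigcup_n U n; pose C n := \bigcup_(k < n) F k.
have mV : measurable (V : set (borel X)).
  by apply: bigcup_measurable => k _; exact: borel_open.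
have mF k : measurable (F k : set (borel X)) by exact: borel_closed.
have mUF k : measurable (U k `\` F k : set (borel X)).
  by apply: measurableD => //; exact: borel_open.
have cC n : closed (C n) by apply: closed_bigcup => //; exact: finite_II.
have VF : mu (V `\` \bigcup_k F k) < e%:E.
  apply: (@le_lt_trans _ _ (e / 2)%:E); last first.
    by rewrite lte_fin ltr_pdivrMr// ltr_pMr// ltr1n.
  apply: le_trans (epsilon_trick0 xpredT (ltW e20)).
  have mVF : measurable (V `\` \bigcup_k F k : set (borel X)).
    by apply: measurableD => //; exact: bigcup_measurable.
  apply: (le_trans (measure_sigma_subadditive mu mUF mVF _)).
    by move=> x [[k _ Ux] nFx]; exists k => //; split => // Fx; apply: nFx;
      exists k.
  by apply: lee_nneseries => // k _; exact/ltW/ltU.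
(* The union of all the [F k] need not be closed; continuity from above replaces it by a finite
   union. *)
have [|||n Vn] := @nonincreasing_measure_lt _ _ _ mu (fun n => V `\` C n) e%:E.
- by move=> n; apply: measurableD => //; exact: borel_closed.
- move=> n m nm x [Vx nCx]; split => // -[k /= kn Fx]; apply: nCx.
  by exists k => //=; exact: leq_trans kn nm.
- apply: le_lt_trans VF; apply: le_measure; rewrite ?inE.
  + by apply: bigcap_measurable => // n _; apply: measurableD => //;
      exact: borel_closed.
  + by apply: measurableD => //; exact: bigcup_measurable.
  + move=> x xVC; split; first by have [] := xVC 0%N I.
    by move=> [k _ Fx]; have [_] := xVC k.+1 I; apply; exists k => //=.
- exists (C n), V; split => //.
  + by apply: bigcup_open => k _; exact: oU.
  + by move=> x [k _ Fx]; exists k => //; exact: FA.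
  + by move=> x [k _ Ax]; exists k => //; exact: AU.
Qed.

(** Being Borel means belonging to every sigma-algebra that contains the open sets, and the regular
    sets form one. The two-sided form of [regular] makes complements immediate, by exchanging [F]
    and [U]. *)
Lemma closed_open_regularity (A : set (borel X)) (e : R) :
  measurable A -> (0 < e)%R ->
  exists F U : set X, [/\ closed F, open U, F `<=` A, A `<=` U &
                          mu (U `\` F) < e%:E].
Proof.
move=> mA e0; suff : regular A by exact.
apply: mA; split; last by move=> U; exact: regular_open.
split.
- by apply: regular_open; exact: open0.
- by move=> B rB; rewrite setTD; exact: regularC.
- exact: regular_bigcup.
Qed.

Hypotheses (separableX : separable X) (lcX : locally_compact [set: X]).

Lemma compact_inner_regularity (A : set (borel X)) (e : R) :
  measurable A -> (0 < e)%R ->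
  exists K : set X, [/\ compact K, K `<=` A & mu (A `\` K) < e%:E].
Proof.
move=> mA e0; have [F [U [cF oU FA AU ltU]]] := closed_open_regularity mA e0.
have [C [cC hC UC]] := compact_exhaustion separableX lcX.
have mC n : measurable (C n : set (borel X)) by exact: compact_borel.
have mF : measurable (F : set (borel X)) by exact: borel_closed.
have mAFC n : measurable (A `\` (F `&` C n)).
  by apply: measurableD => //; exact: measurableI.
have [|||n An] := @nonincreasing_measure_lt _ _ _ mu (fun n => A `\`
  (F `&` C n)) e%:E.
- by [].
- by move=> n m nm x [Ax nFC]; split => // -[Fx Cx]; apply: nFC; split => //;
    exact: hC Cx.
- apply: le_lt_trans ltU; apply: le_measure; rewrite ?inE.
  + exact: bigcap_measurable.
  + by apply: measurableD => //; exact: borel_open.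
  + move=> x xA; have [Ax _] := xA 0%N I; split; first exact: AU.
    move=> Fx; have : (\bigcup_n C n) x by rewrite UC.
    by move=> [n _ Cx]; have [_] := xA n I; exact.
- exists (F `&` C n); split => //; last by move=> x [/FA].
  rewrite setIC; exact: compact_closedI.
Qed.

End borel_regularity.

(** * Vague compactness of the subprobability measures *)

Lemma ultra_cvg_compact (T : Type) (Y : topologicalType) (U : set_system T)
    (g : T -> Y) (K : set Y) :
  UltraFilter U -> compact K -> (forall t, K (g t)) -> exists l :
    Y, g @ U --> l.
Proof.
move=> UU cK gK.
have [l [_ cl]] : K `&` cluster (g @ U) !=set0.
  apply: cK; suff : U (g @^-1` K) by [].
  rewrite (_ : _ @^-1` _ = setT); first exact: filterT.
  by apply/seteqP; split => // t _; exact: gK.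
exists l => A lA; have [//|UA] := in_ultra_setVsetC (g @^-1` A) UU.
by have [z []] := cl (~` A) A UA lA.
Qed.

(** * From a content on compact sets to a Borel measure *)

Section compact_content.
Local Open Scope ereal_scope.
Context {R : realType} {X : completeMetricType R}.
Variable ell : set X -> R.
Hypotheses (ell_le1 : forall K, compact K -> (ell K <= 1)%R)
  (ell0 : ell set0 = 0%R)
  (ellU_le : forall K L, compact K -> compact L ->
    (ell (K `|` L) <= ell K + ell L)%R)
  (ellU : forall K L, compact K -> compact L -> K `&` L = set0 ->
    ell (K `|` L) = (ell K + ell L)%R).

(** The classical passage from a content to an outer measure, inner on open sets and then outer on
    all sets. *)
Definition open_content (G : set X) : \bar R :=
  ereal_sup [set (ell K)%:E | K in [set K | compact K /\ K `<=` G]].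

Definition content_outer (E : set X) : \bar R :=
  ereal_inf [set open_content G | G in [set G | open G /\ E `<=` G]].

Let open_content_ub G K : compact K -> K `<=` G -> (ell K)%:E <= open_content G.
Proof. by move=> cK KG; apply: ereal_sup_ubound; exists K. Qed.

Let open_content_ge0 G : 0 <= open_content G.
Proof. by rewrite -[0]/(0%:E) -ell0; apply: open_content_ub => //;
  exact: compact0. Qed.

Let open_content_le1 G : open_content G <= 1.
Proof. by apply: ge_ereal_sup => _ [K [cK _] <-]; rewrite lee_fin ell_le1. Qed.

Let le_open_content G H : G `<=` H -> open_content G <= open_content H.
Proof.
move=> GH; apply: ge_ereal_sup => _ [K [cK KG] <-].
by apply: open_content_ub => //; exact: subset_trans GH.
Qed.

(** [K] is divided according to which complement is farther away: a point at least as far from the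
    complement of [G] as from that of [H] has to be in [G], and symmetrically. *)
Lemma compact_split (K G H : set X) : compact K -> open G -> open H ->
  K `<=` G `|` H -> exists L M, [/\ compact L, compact M, L `<=` G, M `<=` H &
    K = L `|` M].
Proof.
move=> cK oG oH KGH.
pose d x := (set_dist (~` G) x - set_dist (~` H) x)%R.
have cd : continuous d.
  by move=> x; apply: cvgB; exact: set_dist_continuous.
have [nGH nHG] : (forall x, ~ G x -> H x -> d x < 0)%R /\
                 (forall x, ~ H x -> G x -> 0 < d x)%R.
  split=> x nAx Bx; rewrite /d (set_dist_eq0 nAx) ?sub0r ?oppr_lt0 ?subr0.
    by apply: set_dist_gt0; [exact: open_closedC|exact].
  by apply: set_dist_gt0; [exact: open_closedC|exact].
exists (K `&` [set x | 0 <= d x]%R), (K `&` [set x | d x <= 0]%R); split.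
- apply: compact_closedI => //.
  by apply: (@closed_comp _ _ d [set z | 0 <= z]%R) => [x _|];
    [exact: cd|exact: closed_ge].
- apply: compact_closedI => //.
  by apply: (@closed_comp _ _ d [set z | z <= 0]%R) => [x _|];
    [exact: cd|exact: closed_le].
- move=> x [Kx /= dx]; apply: contrapT => nGx.
  have [//|Hx] := KGH _ Kx.
  by have := nGH _ nGx Hx; rewrite ltNge dx.
- move=> x [Kx /= dx]; apply: contrapT => nHx.
  have [Gx|//] := KGH _ Kx.
  by have := nHG _ nHx Gx; rewrite ltNge dx.
- rewrite -setIUr (_ : _ `|` _ = setT) ?setIT//.
  apply/seteqP; split => // x _ /=.
  by case/orP: (le_total 0%R (d x)) => ?; [left|right].
Qed.

Let ell_le_sum (G : nat -> set X) N K : (forall n, open (G n)) -> compact K ->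
  K `<=` \bigcup_(n < N) G n -> (ell K)%:E <= \sum_(0 <= n < N) open_content
    (G n).
Proof.
move=> oG; elim: N K => [|N ih] K cK KG.
  rewrite big_nil; suff -> : K = set0 by rewrite ell0.
  by apply/seteqP; split => // x /KG[n /=]; rewrite ltn0.
have KGG : K `<=` (\bigcup_(n < N) G n) `|` G N.
  move=> x /KG[n /=]; rewrite ltnS leq_eqVlt => /orP[/eqP->|nN] Gx;
    first by right.
  by left; exists n.
have oU : open (\bigcup_(n < N) G n) by apply: bigcup_open => n _; exact: oG.
have [L [M [cL cM LG MG ->]]] := compact_split cK oU (oG N) KGG.
rewrite big_nat_recr//=; apply: (@le_trans _ _ (ell L + ell M)%:E).
  by rewrite lee_fin ellU_le.
by rewrite EFinD leeD// ?ih ?open_content_ub.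
Qed.

Let open_content_bigcup (G : nat -> set X) : (forall n, open (G n)) ->
  open_content (\bigcup_n G n) <= \sum_(n <oo) open_content (G n).
Proof.
move=> oG; apply: ge_ereal_sup => _ [K [cK KG] <-].
have : \forall N \near \oo, K `<=` \bigcup_(n < N) G n.
  move/compact_near_coveringP : (cK).
  move=> /(_ _ \oo (fun N => \bigcup_(n < N) G n)); apply => x /KG[n _ Gx].
  exists (G n, [set N | (n < N)%N]); first split => /=.
  - exact: open_nbhs_nbhs.
  - by exists n.+1.
  - by move=> [y N] [/= Gy nN]; exists n.
move=> [N _ /(_ N (leqnn N)) KN]; apply: le_trans (ell_le_sum oG cK KN) _.
by apply: nneseries_lim_ge => k _.
Qed.

Let content_outer0 : content_outer set0 = 0.
Proof.
apply/eqP; rewrite eq_le; apply/andP; split; last first.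
  by apply: le_ereal_inf_tmp => _ [G _ <-].
apply: ereal_inf_lbound; exists set0; first by split => //; exact: open0.
apply/eqP; rewrite eq_le open_content_ge0 andbT.
apply: ge_ereal_sup => _ [K [_ K0] <-].
by rewrite (_ : K = set0) ?ell0//; apply/seteqP; split.
Qed.

Let content_outer_ge0 E : 0 <= content_outer E.
Proof. by apply: le_ereal_inf_tmp => _ [G _ <-]. Qed.

Let le_content_outer : {homo content_outer : A B / A `<=` B >-> A <= B}.
Proof.
move=> A B AB; apply: le_ereal_inf_tmp => _ [G [oG BG] <-].
by apply: ereal_inf_lbound; exists G => //; split => //; exact: subset_trans BG.
Qed.

Let content_outer_open G : open G -> content_outer G = open_content G.
Proof.
move=> oG; apply/eqP; rewrite eq_le; apply/andP; split.
  by apply: ereal_inf_lbound; exists G => //; split.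
by apply: le_ereal_inf_tmp => _ [H [_ GH] <-]; exact: le_open_content.
Qed.

Let content_outer_sigma_subadditive : sigma_subadditive content_outer.
Proof.
move=> F; apply/lee_addgt0Pr => e e0.
apply: le_trans (epsilon_trick xpredT _ (ltW e0)); last by move=> n.
have /choice[G /all_and3[oG FG Ge]] : forall n, exists G,
    [/\ open G, F n `<=` G &
        open_content G <= content_outer (F n) + (e / (2 ^ n.+1)%:R)%:E].
  move=> n; have en : (0 < e / (2 ^ n.+1)%:R)%R.
    by rewrite divr_gt0// ltr0n expn_gt0.
  have fin : content_outer (F n) \is a fin_num.
    rewrite ge0_fin_numE// (@le_lt_trans _ _ 1) ?ltry//.
    rewrite (le_trans (le_content_outer (@subsetT _ (F n))))//.
    by rewrite content_outer_open//; exact: openT.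
  have [_ [G [oG FG] <-] /ltW ltG] := lb_ereal_inf_adherent en fin.
  by exists G.
apply: (@le_trans _ _ (open_content (\bigcup_n G n))).
  apply: ereal_inf_lbound; exists (\bigcup_n G n) => //; split.
    by apply: bigcup_open => n _; exact: oG.
  by move=> x [n _ Fx]; exists n => //; exact: FG.
apply: (le_trans (open_content_bigcup oG)).
by apply: lee_nneseries.
Qed.

HB.instance Definition _ := isOuterMeasure.Build R X content_outer
  content_outer0 content_outer_ge0 le_content_outer
  content_outer_sigma_subadditive.

(** Inside an open [V] containing [E], a compact [K] is chosen in [G] and then a compact [L] off
    [K]. They are disjoint, so additivity of [ell] bounds the sum by the content of [V]. Removing
    [K] instead of [G] keeps the second set open. *)
Let open_caratheodory G : open G -> content_outer.-caratheodory G.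
Proof.
move=> oG; apply: le_caratheodory_measurable => E.
apply: le_ereal_inf_tmp => _ [V [oV EV] <-].
have fin A : content_outer A \is a fin_num.
  rewrite ge0_fin_numE// (@le_lt_trans _ _ 1) ?ltry//.
  rewrite (le_trans (le_content_outer (@subsetT _ A)))//.
  by rewrite content_outer_open//; exact: openT.
rewrite -leeBrDr//.
apply: (@le_trans _ _ (open_content (V `&` G))).
  rewrite -content_outer_open; last exact: openI.
  by apply: le_content_outer; exact: setSI.
apply: ge_ereal_sup => _ [K [cK KVG] <-].
rewrite leeBrDr// -leeBrDl//.
have oVK : open (V `&` ~` K).
  by apply: openI => //; apply: closed_openC; exact: metric_compact_closed.
apply: (@le_trans _ _ (open_content (V `&` ~` K))).
  rewrite -content_outer_open//; apply: le_content_outer => x [Ex nGx].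
  by split; [exact: EV|move=> /KVG[]].
apply: ge_ereal_sup => _ [L [cL LVK] <-].
rewrite leeBrDl// -EFinD -ellU//; last first.
  by apply/seteqP; split => // x [Kx /LVK[]].
apply: open_content_ub; first exact: compactU.
by move=> x [/KVG[]|/LVK[]].
Qed.

Let borel_caratheodory (A : set (borel X)) :
  measurable A -> content_outer.-caratheodory A.
Proof.
move=> mA; apply: mA; split; last by move=> U; exact: open_caratheodory.
split.
- exact: caratheodory_measurable_set0.
- by move=> B cB; rewrite setTD; exact: caratheodory_measurable_setC.
- by move=> F cF; exact: caratheodory_measurable_bigcup.
Qed.

Definition content_measure (A : set (borel X)) : \bar R := content_outer A.

Let content_measure_ge0 A : 0 <= content_measure A.
Proof. exact: content_outer_ge0. Qed.

Let content_measure_sigma_additive : semi_sigma_additive content_measure.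
Proof.
move=> F mF tF _.
apply: (@caratheodory_measure_sigma_additive _ _ content_outer) => // [n|].
  exact: borel_caratheodory.
by apply: caratheodory_measurable_bigcup => n; exact: borel_caratheodory.
Qed.

HB.instance Definition _ := isMeasure.Build _ _ _ content_measure
  content_outer0 content_measure_ge0 content_measure_sigma_additive.

Let content_measure_le1 : content_measure setT <= 1.
Proof. by rewrite /content_measure content_outer_open//; exact: openT. Qed.

HB.instance Definition _ :=
  Measure_isSubProbability.Build _ _ _ content_measure content_measure_le1.

(** Only an inequality can hold on compact sets: point masses at points converging to x, all
    different from x, give {x} the limit content 0 and the limit measure 1. *)
Lemma content_extension : exists mu : subprobability (borel X) R,
  (forall K, compact K -> (ell K)%:E <= mu K) /\
  (forall G, open G -> mu G = open_content G).
Proof.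
exists content_measure; split => [K cK|G]; last exact: content_outer_open.
by apply: le_ereal_inf_tmp => _ [G [_ KG] <-]; exact: open_content_ub.
Qed.

End compact_content.

Lemma bounded_integrable d (T : measurableType d) (R : realType)
    (mu : {finite_measure set T -> \bar R}) (f : T -> R) (M : R) :
  measurable_fun setT f -> (forall x, `|f x| <= M) ->
  mu.-integrable setT (EFin \o f).
Proof.
move=> mf fM; apply: measurable_bounded_integrable => //.
  by rewrite -ge0_fin_numE// fin_num_measure.
exists M; split; first by rewrite num_real.
by move=> y My x _ /=; rewrite (le_trans (fM x))// ltW.
Qed.

Lemma finite_range_bounded (T : Type) (R : realType) (f : T -> R) :
  finite_set (range f) -> exists B, forall x, `|f x| <= B.
Proof.
move=> /finite_seqP[s fs]; exists (\sum_(r <- s) `|r|) => x.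
have fxs : f x \in s.
  suff : [set` s] (f x) by [].
  by rewrite -fs; exists x.
by rewrite (big_rem (f x))//= lerDl sumr_ge0.
Qed.

(** * Integrals and measures of superlevel sets *)

Section layer_cake.
Context {R : realType}.
Implicit Types (d y : R) (N : nat).

(** The sum is [d] times the number of levels [d], [2 d], ..., [N d] not exceeding [y]; removing the
    first level amounts to replacing [y] by [y - d]. *)
Lemma layer_sum_le d y N : 0 <= d -> 0 <= y ->
  \sum_(k < N) d * (k.+1%:R * d <= y)%R%:R <= y.
Proof.
move=> d0; elim: N y => [|N ih] y y0; first by rewrite big_ord0.
rewrite big_ord_recl mul1r; have [dy|yd] := leP d y.
  rewrite mulr1 -lerBrDl; apply: le_trans (ih (y - d) _);
    last by rewrite subr_ge0.
  apply: ler_sum => k _; rewrite lift0.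
  by rewrite [_.+2%:R]mulrSr mulrDl mul1r lerBrDr.
rewrite mulr0 add0r big1// => k _; rewrite lift0.
suff /negbTE-> : ~~ (k.+2%:R * d <= y) by rewrite mulr0.
rewrite -ltNge (lt_le_trans yd)//.
by rewrite -{1}[d]mul1r ler_wpM2r// ler1n.
Qed.

Lemma le_layer_sum d y N : 0 <= d -> y <= N%:R * d ->
  y <= d + \sum_(k < N) d * (k.+1%:R * d < y)%R%:R.
Proof.
move=> d0; elim: N y => [|N ih] y yN.
  by rewrite big_ord0 addr0 (le_trans yN)// mul0r.
rewrite big_ord_recl mul1r; have [yd|dy] := leP y d.
  rewrite (le_trans yd)// lerDl addr_ge0 ?mulr_ge0// sumr_ge0// => k _.
  by rewrite mulr_ge0.
rewrite mulr1 -lerBlDl; apply: le_trans (ih (y - d) _) _.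
  by rewrite lerBlDr -{2}[d]mul1r -mulrDl -mulrSr.
rewrite lerD2l; apply: ler_sum => k _; rewrite lift0.
by rewrite [_.+2%:R]mulrSr mulrDl mul1r ltrBrDr.
Qed.

Context disp (T : measurableType disp) (mu : {finite_measure set T -> \bar R}).

Lemma step_integral (A : nat -> set T) d N : (forall k, measurable (A k)) ->
  mu.-integrable setT (EFin \o (fun x => \sum_(k < N) d * \1_(A k) x)) /\
  \int[mu]_x (\sum_(k < N) d * \1_(A k) x) = \sum_(k < N) d * fine (mu (A k)).
Proof.
move=> mA.
have iA k : mu.-integrable setT (EFin \o (\1_(A k) : T -> R)).
  apply: (@bounded_integrable _ _ _ _ _ 1) => // x.
  by rewrite ger0_norm// indicE; case: (_ \in _).
have idA k : mu.-integrable setT (EFin \o (fun x => d * \1_(A k) x)).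
  rewrite (_ : _ \o _ = (fun x => d%:E * (EFin \o (\1_(A k) : T -> R)) x)%E)//.
  exact: integrableZl.
elim: N => [|N [ihi ihE]].
  under eq_fun do rewrite big_ord0.
  rewrite big_ord0 /comp; split; first exact: integrable0.
  by rewrite Rintegral_cst// mul0r.
have -> : (fun x => \sum_(k < N.+1) d * \1_(A k) x) =
          (fun x => \sum_(k < N) d * \1_(A k) x + d * \1_(A N) x) :> (T -> R).
  by apply/funext => x; rewrite big_ord_recr.
split.
  rewrite (_ : _ \o _ = ((EFin \o (fun x => (\sum_(k < N) d * \1_(A k) x)%R)) \+
                        (EFin \o (fun x => (d * \1_(A N) x)%R)))%E)//.
  exact: integrableD.
rewrite RintegralD// ihE big_ord_recr/=; congr (_ + _).
rewrite RintegralZl//; congr (_ * _).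
by rewrite /Rintegral integral_indic// setIT.
Qed.

(** Levels are non-strict below and strict above: for continuous [f] these are closed and open sets,
    the two classes on which limits of measures are controlled. *)
Lemma layer_cake_bounds (f : T -> R) d N : measurable_fun setT f ->
    0 <= d -> (forall x, 0 <= f x <= N%:R * d) ->
  \sum_(k < N) d * fine (mu [set x | k.+1%:R * d <= f x]) <= \int[mu]_x f x /\
  \int[mu]_x f x <= d * fine (mu setT) +
    \sum_(k < N) d * fine (mu [set x | k.+1%:R * d < f x]).
Proof.
move=> mf dge0 f0N.
have if_ : mu.-integrable setT (EFin \o f).
  apply: (@bounded_integrable _ _ _ _ _ (N%:R * d)) => // x.
  by have /andP[f0 fN] := f0N x; rewrite ger0_norm.
have mge k : measurable [set x | k.+1%:R * d <= f x].
  rewrite -[X in measurable X]setTI.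
  by apply: (measurable_fun_ler (f := cst (k.+1%:R * d))).
have mgt k : measurable [set x | k.+1%:R * d < f x].
  rewrite -[X in measurable X]setTI.
  by apply: (measurable_fun_ltr (f := cst (k.+1%:R * d))).
have [ige Ege] := step_integral d N mge.
have [igt Egt] := step_integral d N mgt.
rewrite -Ege -Egt; split.
  apply: le_Rintegral => // x _; have /andP[f0 _] := f0N x.
  apply: le_trans (layer_sum_le N dge0 f0); apply: ler_sum => k _.
  rewrite ler_wpM2l// indicE; case: (boolP (_ \in _)) => //.
  by rewrite inE/= => ->.
rewrite -Rintegral_cst// -RintegralD//;
  last exact: finite_measure_integrable_cst.
apply: le_Rintegral => //.
  rewrite (_ : _ \o _ = ((EFin \o cst d) \+
    (EFin \o (fun x => (\sum_(k < N) d * \1_[set x | k.+1%:R * d < f x] x)%R)))%E)//.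
  by apply: integrableD => //; exact: finite_measure_integrable_cst.
move=> x _; have /andP[_ fN] := f0N x.
apply: le_trans (le_layer_sum dge0 fN) _; rewrite lerD2l.
apply: ler_sum => k _; rewrite ler_wpM2l// indicE.
case: (boolP (_ < _)) => // kf.
by rewrite mem_set.
Qed.

End layer_cake.

Section M1_compact.
Context {R : realType} {X : completeMetricType R}.

Lemma Cc_bounded (f : Cc X) : exists M, forall x, `|sval f x| <= M.
Proof.
case: f => f [/= cf csf]; set S := closure _ in csf.
have /compact_bounded[M [_ MS]] : compact (f @` S).
  by apply: continuous_compact => //; exact: continuous_subspaceT.
exists (Num.max 0 (M + 1)) => x; rewrite le_max.
have [fx0|fx0] := eqVneq (f x) 0; first by rewrite fx0 normr0 lexx.
apply/orP; right; apply: (MS (M + 1)); first by rewrite ltrDl.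
by exists x => //; exact: subset_closure.
Qed.

Lemma Cc_measurable (f : Cc X) :
  measurable_fun [set: borel X] (sval f : borel X -> R).
Proof. by have [cf _] := svalP f; exact: borel_continuous. Qed.

Lemma Cc_integrable (mu : {finite_measure set (borel X) -> \bar R}) (f : Cc X) :
  mu.-integrable setT (EFin \o sval f).
Proof.
have [M fM] := Cc_bounded f; apply: (@bounded_integrable _ _ _ _ _ M) => //.
exact: Cc_measurable.
Qed.

Section compact_support_operations.
Implicit Types f g : X -> R.

Lemma compact_supportS f g :
  (forall x, f x = 0 -> g x = 0) -> compact (closure [set x | f x != 0]) ->
  compact (closure [set x | g x != 0]).
Proof.
move=> fg cf; apply: (subclosed_compact _ cf); first exact: closed_closure.
by apply: closure_subset => x /=; apply: contra_neq => /fg.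
Qed.

Lemma continuous_maxr f g : continuous f -> continuous g ->
  continuous (fun x => Num.max (f x) (g x)).
Proof. by move=> cf cg x; exact: (@continuous_max R X f g x (cf x) (cg x)). Qed.

End compact_support_operations.

Section M1_of_subprobability.
Local Open Scope ereal_scope.
Variable P : subprobability (borel X) R.

Definition clean_measure (A : set (borel X)) : \bar R :=
  if `[< measurable A >] then P A else 0.

Let clean_measureE A : measurable A -> clean_measure A = P A.
Proof. by move=> mA; rewrite /clean_measure asboolT. Qed.

Let clean_measure0 : clean_measure set0 = 0.
Proof. by rewrite clean_measureE. Qed.

Let clean_measure_ge0 A : 0 <= clean_measure A.
Proof. by rewrite /clean_measure; case: ifP. Qed.

Let clean_measure_sigma_additive : semi_sigma_additive clean_measure.
Proof.
move=> F mF tF mUF; rewrite clean_measureE//.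
rewrite (_ : (fun n => _) = (fun n => \sum_(0 <= i < n) P (F i))).
  exact: measure_semi_sigma_additive.
by apply/funext => n; apply: eq_bigr => i _; rewrite clean_measureE.
Qed.

HB.instance Definition _ := isMeasure.Build _ _ _ clean_measure
  clean_measure0 clean_measure_ge0 clean_measure_sigma_additive.

Let clean_measure_le1 : clean_measure setT <= 1.
Proof. by rewrite clean_measureE// sprobability_setT. Qed.

HB.instance Definition _ :=
  Measure_isSubProbability.Build _ _ _ clean_measure clean_measure_le1.

Hypotheses (separableX : separable X) (lcX : locally_compact [set: X]).

(** Inner regularity is automatic on a separable locally compact metric space; only the values on
    nonmeasurable sets have to be normalized. *)
Lemma M1_of_subprobability :
  exists nu : M1 X, forall A, measurable A -> nu A = P A.
Proof.
have rP : radon clean_measure.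
  split=> [K cK|A mA].
    apply: (@le_lt_trans _ _ 1); last exact: ltry.
    apply: le_trans clean_measure_le1.
    by apply: le_measure; rewrite ?inE//; exact: compact_borel.
  apply/eqP; rewrite eq_le; apply/andP; split; last first.
    apply: ge_ereal_sup => _ [K [cK KA] <-].
    by apply: le_measure; rewrite ?inE//; exact: compact_borel.
  apply/lee_addgt0Pr => e e0.
  have [K [cK KA AK]] :=
    compact_inner_regularity clean_measure separableX lcX mA e0.
  apply: (@le_trans _ _ (clean_measure K + e%:E)); last first.
    by rewrite leeD2r//; apply: ereal_sup_ubound; exists K.
  have mK := compact_borel cK.
  rewrite -(setDUK KA) measureU//=; last 2 first.
  - exact: measurableD.
  - by rewrite setIC setDKI.
  by rewrite leeD2l// ltW.
have jP A : ~ measurable A -> clean_measure A = 0.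
  by move=> mA; rewrite /clean_measure asboolF.
by exists (MkM1 rP jP).
Qed.

End M1_of_subprobability.
End M1_compact.

(** * Vague limits along ultrafilters *)

Section vague_compact.
Context {R : realType} {X : completeMetricType R}.
Hypotheses (separableX : separable X) (lcX : locally_compact [set: X]).

Lemma vague_cvgP (F : set_system (M1 X)) (nu : M1 X) : Filter F ->
  (forall f : Cc X, (fun mu : M1 X =>
    \int[mu]_x sval f x) @ F --> \int[nu]_x sval f x) ->
  F --> nu.
Proof.
move=> FF Fnu.
apply/(@cvg_sup (M1 X) (Cc X) (fun f => Topological.class
    (initial_topology (fun nu : M1 X => \int[nu]_x (sval f x))))) => f A.
rewrite nbhsE => -[_ [[C oC <-] Cnu] CA].
apply: filterS CA _; apply: Fnu.
by apply: open_nbhs_nbhs; split.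
Qed.

Lemma vague_continuous (f : Cc X) :
  continuous (fun nu : M1 X => \int[nu]_x sval f x).
Proof.
move=> nu A Anu.
have : (nbhs nu : set_system (M1 X)) --> nu by exact: cvg_id.
move/(@cvg_sup (M1 X) (Cc X) (fun f => Topological.class
    (initial_topology (fun nu : M1 X => \int[nu]_x (sval f x))))) => /(_ f).
apply; exact: (@initial_continuous _ _ (fun nu : M1 X =>
  \int[nu]_x sval f x) nu A).
Qed.

Section ultrafilter_limit.
Variables (U : set_system (M1 X)).
Hypothesis UU : UltraFilter U.

Lemma M1_bound (nu : M1 X) A : 0 <= fine (nu A) <= 1.
Proof.
have [mA|mA] := pselect (measurable A); last by rewrite M1_junk//= lexx ler01.
rewrite fine_ge0//= -lee_fin fineK ?fin_num_measure//.
apply: le_trans (sprobability_setT (s := nu)).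
by apply: le_measure; rewrite ?inE.
Qed.

Let limit_exists A : exists l : R, (fun nu : M1 X => fine (nu A)) @ U --> l.
Proof.
apply: (ultra_cvg_compact UU (@segment_compact R 0 1)) => nu.
by rewrite /= in_itv/= M1_bound.
Qed.

Definition limit_content (A : set X) : R := sval (cid (limit_exists A)).

Lemma limit_contentP A :
  (fun nu : M1 X => fine (nu A)) @ U --> limit_content A.
Proof. by rewrite /limit_content; case: cid. Qed.

Let limit_content_mono A B : measurable (A : set (borel X)) ->
  measurable (B : set (borel X)) -> A `<=` B ->
  limit_content A <= limit_content B.
Proof.
move=> mA mB AB; apply: (ler_cvg_to (@limit_contentP A) (@limit_contentP B)).
apply: nearW => nu; rewrite -lee_fin !fineK ?fin_num_measure//.
by apply: le_measure; rewrite ?inE.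
Qed.

Let limit_contentU A B : measurable (A : set (borel X)) ->
  measurable (B : set (borel X)) -> A `&` B = set0 ->
  limit_content (A `|` B) = limit_content A + limit_content B.
Proof.
move=> mA mB AB0.
apply: (@cvg_unique _ (@Rhausdorff R) _ _ _ _ (@limit_contentP (A `|` B))).
rewrite (_ : (fun nu : M1 X => _) = (fun nu => fine (nu A) + fine (nu B))).
  by apply: cvgD; exact: limit_contentP.
by apply/funext => nu; rewrite measureU// fineD// fin_num_measure.
Qed.

(** Countable additivity is lost in the limit and mass may escape, so that [mu] can be lighter than
    the limit of the total masses. What remains are the two one-sided bounds of portmanteau type. *)
Lemma limit_measure : exists mu : M1 X,
  (forall K, compact K -> limit_content K <= fine (mu K)) /\
  (forall G, open G -> fine (mu G) <= limit_content G).
Proof.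
have mc (K : set X) : compact K -> measurable (K : set (borel X)).
  exact: compact_borel.
have [||||P [PK PG]] := @content_extension R X limit_content.
- move=> K _; apply: (cvgr_to_le (@limit_contentP K)); apply: nearW => nu.
  by have /andP[] := M1_bound nu K.
- apply: (@cvg_unique _ (@Rhausdorff R) _ _ _ _ (@limit_contentP set0)).
  rewrite (_ : (fun nu : M1 X => _) = cst 0); first exact: cvg_cst.
  by apply/funext => nu; rewrite measure0.
- move=> K L cK cL.
  have KDL : limit_content (K `|` L) = limit_content K + limit_content
    (L `\` K).
    rewrite -limit_contentU; first by rewrite setUDr setDv setD0.
    + exact: mc.
    + by apply: measurableD; exact: mc.
    + by rewrite setIC setDKI.
  rewrite KDL lerD2l; apply: limit_content_mono; last exact: subDsetl.
  + by apply: measurableD; exact: mc.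
  + exact: mc.
- by move=> K L cK cL; apply: limit_contentU; exact: mc.
have [mu muP] := M1_of_subprobability P separableX lcX.
exists mu; split => [K cK|G oG].
  rewrite -lee_fin fineK; last by apply: fin_num_measure; exact: mc.
  by rewrite muP; [exact: PK|exact: mc].
rewrite -lee_fin fineK; last by apply: fin_num_measure; exact: borel_open.
rewrite muP; last exact: borel_open.
rewrite PG//; apply: ge_ereal_sup => _ [K [cK KG] <-].
by rewrite lee_fin; apply: limit_content_mono; [exact: mc|exact: borel_open|].
Qed.

(** The available bounds on [mu] go in opposite directions on compact and on open level sets, but
    for every [nu] the two level sums differ by at most one layer [d], which closes the gap. *)
Lemma cvg_limit_measure (mu : M1 X) (f : X -> R) :
  (forall K, compact K -> limit_content K <= fine (mu K)) ->
  (forall G, open G -> fine (mu G) <= limit_content G) ->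
  continuous f -> compact (closure [set x | f x != 0]) ->
    (forall x, 0 <= f x) ->
  (fun nu : M1 X => \int[nu]_x f x) @ U --> \int[mu]_x f x.
Proof.
move=> muK muG cf csf f0; apply/cvgrPdist_le => e e0.
have [M fM] := Cc_bounded (exist _ f (conj cf csf)).
(* One [d] pays for the layer approximation and one for the convergence of the level sums; the third
   is slack. *)
pose d := e / 3; have d0 : 0 < d by rewrite divr_gt0.
have [N MN] : exists N : nat, M <= N%:R * d.
  have /archi_boundP : 0 <= `|M| / d by rewrite divr_ge0// ltW.
  set N := Num.bound _ => MN; exists N.
  by rewrite -ler_pdivrMr// (le_trans _
    (ltW MN))// ler_wpM2r ?invr_ge0 ?(ltW d0) ?ler_norm.
have f0N x : 0 <= f x <= N%:R * d.
  by rewrite f0 (le_trans _ MN)// (le_trans _ (fM x))//= ler_norm.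
have mf : measurable_fun [set: borel X] f by exact: borel_continuous.
pose Fge k := [set x | k.+1%:R * d <= f x];
  pose Fgt k := [set x | k.+1%:R * d < f x].
(* Levels start at [d] and not at [0], which keeps the closed superlevel sets inside the compact
   support. *)
have cFge k : compact (Fge k).
  apply: (subclosed_compact _ csf).
    apply: (@closed_comp _ _ f [set z | k.+1%:R * d <= z]);
      last exact: closed_ge.
    by move=> x _; exact: cf.
  move=> x kfx; apply: subset_closure => /=; rewrite gt_eqF//.
  by rewrite (lt_le_trans _ kfx)// mulr_gt0.
have oFgt k : open (Fgt k).
  have /continuousP := cf => /(_ [set z | k.+1%:R * d < z]); apply.
  exact: open_gt.
pose Sge := \sum_(k < N) d * limit_content (Fge k).
pose Sgt := \sum_(k < N) d * limit_content (Fgt k).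
have cvg_sumS (F : nat -> set X) :
    (fun nu : M1 X => \sum_(k < N) d * fine (nu (F k))) @ U -->
    \sum_(k < N) d * limit_content (F k).
  elim: (N) => [|n ih].
    by under eq_fun do rewrite big_ord0; rewrite big_ord0; exact: cvg_cst.
  under eq_fun do rewrite big_ord_recr; rewrite big_ord_recr.
  by apply: cvgD => //; apply: cvgMr; exact: limit_contentP.
have /cvgrPdist_le /(_ _ d0) nge := cvg_sumS Fge.
have /cvgrPdist_le /(_ _ d0) ngt := cvg_sumS Fgt.
have T1 (nu : M1 X) : d * fine (nu setT) <= d.
  by have /andP[_ nu1] := M1_bound nu setT; rewrite -[leRHS]mulr1 ler_pM2l.
have lege (nu : M1 X) :
    \sum_(k < N) d * fine (nu (Fgt k)) <= \sum_(k < N) d * fine (nu (Fge k)).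
  apply: ler_sum => k _; rewrite ler_pM2l//.
  have mgt : measurable (Fgt k : set (borel X)) by exact: borel_open.
  have mge : measurable (Fge k : set (borel X)) by exact: compact_borel.
  rewrite -lee_fin !fineK ?fin_num_measure//; apply: le_measure; rewrite ?inE//.
  by move=> x /ltW.
near=> nu.
have [lnu unu] := layer_cake_bounds nu mf (ltW d0) f0N.
have [lmu umu] := layer_cake_bounds mu mf (ltW d0) f0N.
have /ler_normlP[_ nuge] : `|Sge - \sum_(k < N) d * fine (nu (Fge k))| <= d.
  by near: nu; exact: nge.
have /ler_normlP[nugt' nugt] : `|Sgt - \sum_(k < N) d * fine (nu (Fgt k))| <= d.
  by near: nu; exact: ngt.
have /ler_normlP[nuge' _] : `|Sge - \sum_(k < N) d * fine (nu (Fge k))| <= d.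
  by near: nu; exact: nge.
have Smuge : Sge <= \sum_(k < N) d * fine (mu (Fge k)).
  by apply: ler_sum => k _; rewrite ler_pM2l// muK.
have Smugt : \sum_(k < N) d * fine (mu (Fgt k)) <= Sgt.
  by apply: ler_sum => k _; rewrite ler_pM2l// muG.
have e3 : e = d + d + d by rewrite /d; lra.
have := T1 nu; have := T1 mu; have := lege nu; have := lege mu.
rewrite ler_norml;
  clear - lnu unu lmu umu nuge nugt nuge' nugt' Smuge Smugt e3 d0.
rewrite e3.
move: lnu unu lmu umu nuge nugt nuge' nugt' Smuge Smugt.
rewrite -/(Fge _) -/(Fgt _).
by lra.
Unshelve. all: by end_near. Qed.

End ultrafilter_limit.

Lemma compact_M1 : compact [set: M1 X].
Proof.
rewrite compact_ultra => U UU _.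
have [mu [muK muG]] := limit_measure UU.
exists mu; split => //; apply: vague_cvgP => f.
have [cf csf] := svalP f.
(* The comparison by level sets is made for nonnegative functions, hence the two parts. *)
pose fp x := Num.max (sval f x) 0; pose fn x := Num.max (- sval f x) 0.
have csp : compact (closure [set x | fp x != 0]).
  by apply: compact_supportS csf => x fx; rewrite /fp fx maxxx.
have csn : compact (closure [set x | fn x != 0]).
  by apply: compact_supportS csf => x fx; rewrite /fn fx oppr0 maxxx.
have cfp : continuous fp.
  by apply: continuous_maxr => // x; exact: cvg_cst.
have cfn : continuous fn.
  apply: continuous_maxr => x; last exact: cvg_cst.
  by apply: cvgN; exact: cf.
have E (nu : M1 X) :
    \int[nu]_x sval f x = \int[nu]_x fp x - \int[nu]_x fn x.
  rewrite -RintegralB//.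
  - apply: eq_Rintegral => x _; rewrite /fp /fn.
    by case: (leP (sval f x) 0) => fx0; case: leP => fx1; lra.
  - exact: (Cc_integrable nu (exist _ _ (conj cfp csp))).
  - exact: (Cc_integrable nu (exist _ _ (conj cfn csn))).
rewrite E (_ : (fun nu : M1 X => _) =
    (fun nu => \int[nu]_x fp x - \int[nu]_x fn x)); last exact/funext.
by apply: cvgB; apply: cvg_limit_measure => // x; rewrite le_max lexx orbT.
Qed.

End vague_compact.

(** * The dual functional and its approximating test functions *)

Lemma measurable_expeR (R : realType) :
  measurable_fun [set: \bar R] (@expeR R).
Proof.
apply: (measurability _ (ErealGenCInfty.measurableE R)).
move=> _ [_ [r ->] <-]; rewrite setTI.
have [r0|r0] := leP r 0.
  rewrite (_ : _ @^-1` _ = setT); first exact: measurableT.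
  apply/seteqP; split => // x _ /=.
  by rewrite in_itv/= andbT (le_trans _ (expeR_ge0 x))// lee_fin.
rewrite (_ : _ @^-1` _ = [set x | (ln r)%:E <= x]%E).
  rewrite -[X in measurable X]setTI; exact: emeasurable_fun_c_infty.
apply/seteqP; split => x /=; rewrite in_itv/= andbT -(lee_expeR (ln r)%:E)/=;
  by rewrite lnK.
Qed.

(** * Continuous approximations of indicators *)

Section bump.
Context {R : realType} {X : completeMetricType R}.
Hypotheses (separableX : separable X) (lcX : locally_compact [set: X]).

(** Slopes [(n+1) / e] are at least [1 / e], so every bump lives in the [e]-neighbourhood of [K],
    which lies in [U] and in a relatively compact [V]; growing slopes force the limit [\1_K]. *)
Lemma bump_functions (K U : set X) : compact K -> open U -> K `<=` U ->
  exists b : nat -> X -> R,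
  [/\ forall n, continuous (b n) /\ compact (closure [set x | b n x != 0]),
      forall n x, 0 <= b n x <= 1,
      forall n x, K x -> b n x = 1,
      forall n x, b n x != 0 -> U x &
      forall x, b n x @[n --> \oo] --> (\1_K x : R)].
Proof.
move=> cK oU KU.
have [V [oV KV cV]] := compact_open_nbhs lcX cK.
have [|e [e0 e1 eUV]] := compact_set_dist cK (openI oU oV).
  by move=> x Kx; split; [exact: KU|exact: KV].
pose b n x := Num.max 0 (1 - n.+1%:R / e * set_dist K x).
have bUV n x : b n x != 0 -> (U `&` V) x.
  move=> bx; apply: eUV; rewrite ltNge; apply: contra_neqN bx => ex.
  apply/max_idPl; rewrite subr_le0 mulrAC -(ler_pM2r e0) mulfVK ?gt_eqF// mul1r.
  by rewrite (le_trans ex)// ler_peMl ?set_dist_ge0// ler1n.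
exists b; split => //.
- move=> n; split.
    apply: continuous_maxr; first by move=> x; exact: cvg_cst.
    move=> x; apply: cvgB; first exact: cvg_cst.
    by apply: cvgMr; exact: set_dist_continuous.
  apply: (subclosed_compact _ cV); first exact: closed_closure.
  by apply: closure_subset => x /bUV[].
- move=> n x; rewrite le_max lexx ge_max ler01 gerBl mulr_ge0 ?set_dist_ge0//.
  by rewrite divr_ge0// ltW.
- by move=> n x Kx; rewrite /b set_dist_eq0// mulr0 subr0; apply/max_idPr.
- by move=> n x /bUV[].
- move=> x; have [Kx|nKx] := pselect (K x).
    apply: cvg_near_cst; apply: nearW => n.
    by rewrite /b indicE mem_set// set_dist_eq0// mulr0 subr0; apply/max_idPr.
  apply: cvg_near_cst; rewrite indicE memNset//.
  have dx : 0 < set_dist K x by apply: set_dist_gt0 => //;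
    exact: metric_compact_closed.
  near=> n; apply/max_idPl;
    rewrite subr_le0 mulrAC -(ler_pM2r e0) mulfVK ?gt_eqF//.
  rewrite mul1r -ler_pdivrMr// ltW// (@lt_trans _ _ n%:R) ?ltr_nat//.
  by near: n; exact: nbhs_infty_gtr.
Unshelve. all: by end_near. Qed.

Lemma cutoff_functions (K : set X) : compact K ->
  exists b : nat -> X -> R,
  [/\ forall n, continuous (b n) /\ compact (closure [set x | b n x != 0]),
      forall n x, 0 <= b n x <= 1,
      forall n x, K x -> b n x = 1 &
      forall x, b n x @[n --> \oo] --> (1 : R)].
Proof.
move=> cK; have [C [cC hC UC]] := compact_exhaustion separableX lcX.
have /choice[b bP] : forall n, exists b : X -> R,
    [/\ continuous b /\ compact (closure [set x | b x != 0]),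
        forall x, 0 <= b x <= 1 & forall x, (K `|` C n) x -> b x = 1].
  move=> n; have [|b [bc b01 b1 _ _]] := bump_functions (compactU cK
    (cC n)) openT.
    by [].
  by exists (b 0%N); split; [exact: bc|exact: b01|exact: b1].
exists b; split => [n|n x|n x Kx|x].
- by have [] := bP n.
- by have [_ + _] := bP n; apply.
- by have [_ _] := bP n; apply; left.
- have [m _ Cmx] : (\bigcup_n C n) x by rewrite UC.
  apply: cvg_near_cst; exists m => // n /= mn.
  by have [_ _] := bP n; apply; right; exact: hC Cmx.
Qed.

End bump.

Section dual_functional.
Local Open Scope ereal_scope.
Context {R : realType} {X : completeMetricType R}.
Variables (mu : probability (borel X) R) (tau : borel X -> \bar R).

Definition admissible : set (Cc X * R) :=
  [set p | \int[mu]_x expeR ((sval p.1 x + p.2)%:E * tau x) <= 1].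

Definition dual_rate (nu : M1 X) : \bar R :=
  ereal_sup [set (\int[nu]_x sval p.1 x + p.2)%R%:E | p in admissible].

Hypotheses (separableX : separable X) (lcX : locally_compact [set: X])
  (tau_ge0 : forall x, 0 <= tau x)
  (mtau : measurable_fun [set: borel X] tau).

Let mu_lty : mu setT < +oo.
Proof. by rewrite probability_setT ltry. Qed.

Lemma measurable_exp_tau (f : borel X -> R) : measurable_fun setT f ->
  measurable_fun setT (fun x => expeR ((f x)%:E * tau x)).
Proof.
move=> mf; apply: measurableT_comp; first exact: measurable_expeR.
by apply: emeasurable_funM => //; exact/measurable_EFinP.
Qed.

(* [h] approximates [psi] by continuous functions equal to [c] outside of a
   compact set. *)
Definition approximant (h : nat -> X -> R) (psi : X -> R) (c : R) :=
  [/\ forall n, continuous (h n),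
      forall n, compact (closure [set x | (h n x - c != 0)%R]),
      exists M, forall n x, (0 <= h n x <= M)%R &
      forall x, h n x @[n --> \oo] --> psi x].

(** The majorant, uniform in [n], that dominated convergence requires in the exponential
    constraint. *)
Definition exp_dominated (h : nat -> X -> R) :=
  exists G : borel X -> \bar R,
  [/\ measurable_fun setT G, \int[mu]_x G x < +oo &
      forall n x, expeR ((h n x)%:E * tau x) <= G x].

Lemma approximant0 : approximant (fun _ => cst 0%R) (cst 0%R) 0.
Proof.
split => [n x|n||x]; [exact: cvg_cst| |by exists 0%R => n x; rewrite /= lexx|].
- rewrite (_ : [set _ | _] = set0) ?closure0; first exact: compact0.
  by apply/seteqP; split => // x /=; rewrite subr0 eqxx.
- exact: cvg_cst.
Qed.

Lemma approximant_max h psi c h' psi' c' :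
  approximant h psi c -> approximant h' psi' c' ->
  approximant (fun n x => Num.max (h n x) (h' n x))
    (fun x => Num.max (psi x) (psi' x)) (Num.max c c').
Proof.
move=> [ch sh [M hM] hpsi] [ch' sh' [M' hM'] hpsi'].
split => [n|n||x].
- exact: continuous_maxr.
- apply: (subclosed_compact _ (compactU (sh n) (sh' n))).
    exact: closed_closure.
  rewrite -closureU; apply: closure_subset => x /=.
  apply: contraPP => /not_orP[/negP + /negP].
  rewrite !negbK !subr_eq0 => /eqP-> /eqP->; apply/negP.
  by rewrite negbK.
- exists (Num.max M M') => n x; have /andP[h0 hx] := hM n x.
  have /andP[_ hx'] := hM' n x.
  by rewrite le_max h0/= ge_max !le_max hx hx' orbT.
- have := @continuous_max R (R * R)%type (fun z => z.1) (fun z => z.2)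
    (psi x, psi' x).
  move=> /(_ cvg_fst cvg_snd) cmax.
  exact: (cvg_comp _ _ (cvg_pair (hpsi x) (hpsi' x)) cmax).
Qed.

Lemma exp_dominated0 : exp_dominated (fun _ => cst 0%R).
Proof.
exists (cst 1); split => // [|n x]; last by rewrite mul0e expeR0.
by rewrite integral_cst// mul1e; exact: mu_lty.
Qed.

(** Pieces are glued by maxima because the exponential of a maximum is at most the sum of the
    exponentials; gluing by sums would require integrable products. *)
Lemma exp_dominated_max h h' : exp_dominated h -> exp_dominated h' ->
  exp_dominated (fun n x => Num.max (h n x) (h' n x)).
Proof.
move=> [G [mG iG hG]] [G' [mG' iG' hG']].
have G0 x : 0 <= G x by exact: le_trans (expeR_ge0 _) (hG 0%N x).
have G'0 x : 0 <= G' x by exact: le_trans (expeR_ge0 _) (hG' 0%N x).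
exists (G \+ G'); split => [||n x].
- exact: emeasurable_funD.
- by rewrite ge0_integralD// lte_add_pinfty.
- have [hh'|hh'] := leP (h n x) (h' n x).
    by rewrite (le_trans (hG' n x))// leeDr.
  by rewrite (le_trans (hG n x))// leeDl.
Qed.

(** The exponential is 1 where the bump vanishes and at most [expeR (a * tau)] on [U]. Domination is
    a separate implication, so that the lemma also serves, with [U] the whole space, for negative
    parts, which need none. *)
Lemma approximant_compact K U (a : R) : compact K -> open U -> K `<=` U ->
  (0 <= a)%R -> exists h, approximant h (fun x => (a * \1_K x)%R) 0 /\
    (\int[mu]_(x in U) expeR (a%:E * tau x) < +oo -> exp_dominated h).
Proof.
move=> cK oU KU a0;
  have [b [bc b01 b1 bU b_cvg]] := bump_functions lcX cK oU KU.
have mU : measurable (U : set (borel X)) by exact: borel_open.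
have meU : measurable_fun (U : set (borel X)) (fun x => expeR (a%:E * tau x)).
  by apply: measurable_funTS; exact: (@measurable_exp_tau (cst a)).
have mrU : measurable_fun setT ((fun x : borel X => expeR (a%:E * tau x)) \_
  (U : set (borel X))).
  exact/(measurable_restrictT _ mU).
exists (fun n x => a * b n x)%R; split.
- split => [n x|n||x].
  + by apply: cvgMr; have [cb _] := bc n; exact: cb.
  + have [_] := bc n; apply: compact_supportS => x bx.
    by rewrite bx mulr0 subr0.
  + exists a => n x; have /andP[bx0 bx1] := b01 n x.
    by rewrite mulr_ge0//= ler_piMr.
  + by apply: cvgMr; exact: b_cvg.
- move=> iU;
    exists (fun x => 1 + ((fun x : borel X => expeR (a%:E * tau x)) \_ (U : set
      (borel X))) x); split.
  + exact: emeasurable_funD.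
  + rewrite ge0_integralD//; last first.
      by move=> x _; apply: erestrict_ge0 => y _; exact: expeR_ge0.
    rewrite integral_cst// mul1e lte_add_pinfty//.
    by rewrite -integral_mkcond.
  + move=> n x; rewrite patchE; have /andP[bx0 bx1] := b01 n x.
    have [bx|/bU Ux] := eqVneq (b n x) 0%R.
      rewrite bx mulr0 mul0e expeR0 leeDl//; case: ifP => // _.
      exact: expeR_ge0.
    rewrite mem_set// (@le_trans _ _ (expeR (a%:E * tau x)))//.
      by rewrite lee_expeR lee_wpmul2r// lee_fin ler_piMr.
    by rewrite leeDr.
Qed.

(** These functions equal [c] outside of a compact set and yet tend to 0 pointwise, which rewards
    mass missing from [nu]. They vanish on [K], so only integrability off [K] matters. *)
Lemma approximant_infty K (c : R) : compact K -> (0 <= c)%R ->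
  exists h, approximant h (cst 0%R) c /\
    (\int[mu]_(x in ~` K) expeR (c%:E * tau x) < +oo -> exp_dominated h).
Proof.
move=> cK c0; have [b [bc b01 b1 b_cvg]] := cutoff_functions separableX lcX cK.
have mU : measurable (~` K : set (borel X)).
  by apply: measurableC; exact: compact_borel.
have meU : measurable_fun (~` K : set (borel X)) (fun x => expeR
  (c%:E * tau x)).
  by apply: measurable_funTS; exact: (@measurable_exp_tau (cst c)).
have mrU : measurable_fun setT ((fun x : borel X => expeR (c%:E * tau x)) \_
  ((~` K) : set (borel X))).
  exact/(measurable_restrictT _ mU).
exists (fun n x => c * (1 - b n x))%R; split.
- split => [n x|n||x].
  + apply: cvgMr; apply: cvgB; first exact: cvg_cst.
    by have [cb _] := bc n; exact: cb.
  + have [_] := bc n; apply: compact_supportS => x bx.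
    by rewrite bx subr0 mulr1 subrr.
  + exists c => n x; have /andP[bx0 bx1] := b01 n x.
    by rewrite mulr_ge0 ?subr_ge0//= ler_piMr// gerBl.
  + rewrite [X in _ --> X](_ : _ = c * (1 - 1))%R; last by rewrite subrr mulr0.
    by apply: cvgMr; apply: cvgB; [exact: cvg_cst|exact: b_cvg].
- move=> iU;
    exists (fun x => 1 + ((fun x : borel X => expeR (c%:E * tau x)) \_
      ((~` K) : set (borel X))) x); split.
  + exact: emeasurable_funD.
  + rewrite ge0_integralD//; last first.
      by move=> x _; apply: erestrict_ge0 => y _; exact: expeR_ge0.
    rewrite integral_cst// mul1e lte_add_pinfty//.
    by rewrite -integral_mkcond.
  + move=> n x; rewrite patchE; have /andP[bx0 bx1] := b01 n x.
    have [Kx|Kx] := pselect (K x).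
      rewrite b1// subrr mulr0 mul0e expeR0 leeDl//; case: ifP => // _.
      exact: expeR_ge0.
    rewrite mem_set// (@le_trans _ _ (expeR (c%:E * tau x)))//.
      by rewrite lee_expeR lee_wpmul2r// lee_fin ler_piMr// gerBl.
    by rewrite leeDr.
Qed.

End dual_functional.

(** * Lower bounds on the dual functional by limits of test functions *)

Section dual_lower_bound.
Local Open Scope ereal_scope.
Context {R : realType} {X : completeMetricType R}.
Variables (mu : probability (borel X) R) (tau : borel X -> \bar R).
Hypotheses (tau_ge0 : forall x, 0 <= tau x)
  (mtau : measurable_fun [set: borel X] tau)
  (tau_neqy : mu [set x | tau x = +oo] = 0).

Lemma approximant_measurable h psi (c : R) : @approximant R X h psi c ->
  measurable_fun setT (psi : borel X -> R).
Proof.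
move=> [ch _ _ hpsi].
apply: (@measurable_fun_cvg _ _ _ _ (fun n => h n : borel X -> R)) => [n|x _].
  exact: borel_continuous.
exact: hpsi.
Qed.

Lemma approximant_bounded h psi (c : R) : @approximant R X h psi c ->
  exists M : R, (forall n x, 0 <= h n x <= M)%R /\
    (forall x, 0 <= psi x <= M)%R.
Proof.
move=> [_ _ [M hM] hpsi]; exists M; split => // x; apply/andP; split.
  by apply: (cvgr_to_ge (hpsi x)); apply: nearW => n; have /andP[] := hM n x.
by apply: (cvgr_to_le (hpsi x)); apply: nearW => n; have /andP[] := hM n x.
Qed.

Lemma cvg_ge_bound (u : nat -> R) (l : R) (y : \bar R) :
  u n @[n --> \oo] --> l -> (\forall n \near \oo, (u n)%:E <= y) -> l%:E <= y.
Proof.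
case: y => [y| |] ul uy; rewrite ?leey//.
  by rewrite lee_fin; apply: (cvgr_to_le ul); apply: filterS uy => n;
    rewrite lee_fin.
by have [n] := filter_ex uy.
Qed.

Lemma ae_tau_fin : {ae mu, forall x, tau x \is a fin_num}.
Proof.
exists [set x | tau x = +oo]; split => //.
  by rewrite -[X in measurable X]setTI;
    exact: (mtau measurableT (emeasurable_set1 +oo)).
move=> x /= tx; apply: contrapT => txy; apply: tx.
by rewrite ge0_fin_numE// lt_neqAle leey andbT; apply/eqP.
Qed.

(** The pairs [(h n - h' n - c, c)] are tested. As [h'] is nonnegative, the majorant for [h] also
    serves for the difference, and the strict inequality in the limit makes the pairs admissible for
    large [n]. *)
Lemma dual_rate_ge h h' psi psi' (c : R) (nu : M1 X) :
  approximant h psi c -> exp_dominated mu tau h -> approximant h' psi' 0 ->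
  \int[mu]_x expeR ((psi x - psi' x)%:E * tau x) < 1 ->
  (\int[nu]_x (psi x - psi' x) + c * (1 - fine (nu setT)))%R%:E <=
    dual_rate mu tau nu.
Proof.
move=> ah [G [mG iG hG]] ah' int1.
have G0 x : 0 <= G x by exact: le_trans (expeR_ge0 _) (hG 0%N x).
have [M [hM psiM]] := approximant_bounded ah.
have [M' [hM' psiM']] := approximant_bounded ah'.
have mpsi := approximant_measurable ah.
have mpsi' := approximant_measurable ah'.
have [ch sh _ h_cvg] := ah; have [ch' sh' _ h'_cvg] := ah'.
pose f n x := (h n x - h' n x - c)%R.
have Ccf n : continuous (f n) /\ compact (closure [set x | f n x != 0%R]).
  split.
    by move=> x; apply: cvgB; [apply: cvgB;
      [exact: ch|exact: ch']|exact: cvg_cst].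
  apply: (subclosed_compact _ (compactU (sh n) (sh' n)));
    first exact: closed_closure.
  rewrite -closureU; apply: closure_subset => x /=.
  apply: contraPP => /not_orP[/negP + /negP].
  rewrite !negbK !subr_eq0 => /eqP hc /eqP hc'; apply/negP.
  by rewrite negbK /f hc hc' subr0.
have mh n : measurable_fun setT (fun x : borel X => (h n x - h' n x)%R).
  by apply: measurable_funB; exact: borel_continuous.
have mpp : measurable_fun setT (fun x : borel X => (psi x - psi' x)%R).
  exact: measurable_funB.
have exp_cvg : \int[mu]_x expeR ((h n x - h' n x)%:E * tau x) @[n --> \oo] -->
               \int[mu]_x expeR ((psi x - psi' x)%:E * tau x).
  have [] := @dominated_convergence _ _ _ mu setT measurableT
    (fun n x => expeR ((h n x - h' n x)%:E * tau x))
    (fun x => expeR ((psi x - psi' x)%:E * tau x)) G.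
  - by move=> n; exact: measurable_exp_tau.
  - exact: measurable_exp_tau.
  - apply: filterS ae_tau_fin => x + _.
    move=> /fineK <-.
    under eq_fun do rewrite -EFinM; rewrite -EFinM.
    apply: cvg_EFin; first by apply: nearW.
    suff : expR ((h n x - h' n x) * fine (tau x))%R @[n --> \oo] -->
           expR ((psi x - psi' x) * fine (tau x))%R by [].
    apply: continuous_cvg; first exact: continuous_expR.
    by apply: cvgMl; apply: cvgB; [exact: h_cvg|exact: h'_cvg].
  - apply/integrableP; split => //; under eq_integral do rewrite gee0_abs//;
      exact: iG.
  - apply: aeW => x n _; rewrite gee0_abs ?expeR_ge0//.
    apply: le_trans (hG n x); rewrite lee_expeR lee_wpmul2r// lee_fin gerBl.
    by have /andP[] := hM' n x.
  - by [].
have near_adm : \forall n \near \oo,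
    \int[mu]_x expeR ((h n x - h' n x)%:E * tau x) <= 1.
  have lt1 : nbhs (\int[mu]_x expeR
    ((psi x - psi' x)%:E * tau x)) [set z | z < 1].
    by apply: open_nbhs_nbhs; split => //; exact: open_ereal_lt_ereal.
  have near1 : \forall n \near \oo,
    \int[mu]_x expeR ((h n x - h' n x)%:E * tau x) < 1 := exp_cvg _ lt1.
  by apply: filterS near1 => n /ltW.
have int_cvg : \int[nu]_x (h n x - h' n x - c)%:E @[n --> \oo] -->
               \int[nu]_x (psi x - psi' x - c)%:E.
  have [] := @dominated_convergence _ _ _ nu setT measurableT
    (fun n x => (h n x - h' n x - c)%:E) (fun x => (psi x - psi' x - c)%:E)
    (cst (M + M' + `|c|)%:E).
  - by move=> n; apply/measurable_EFinP; exact: measurable_funB.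
  - by apply/measurable_EFinP; exact: measurable_funB.
  - apply: aeW => x _; apply: cvg_EFin; first exact: nearW.
    apply: cvgB; last exact: cvg_cst.
    by apply: cvgB; [exact: h_cvg|exact: h'_cvg].
  - exact: finite_measure_integrable_cst.
  - apply: aeW => x n _; rewrite lee_fin (le_trans (ler_normB _ _))// lerD2r.
    rewrite (le_trans (ler_normB _ _))//.
    have /andP[? ?] := hM n x; have /andP[? ?] := hM' n x.
    by rewrite !ger0_norm// lerD.
  - by [].
have ipp : nu.-integrable setT (fun x => (psi x - psi' x)%:E).
  apply: (@bounded_integrable _ _ _ _ _ (M + M')%R) => // x.
  rewrite (le_trans (ler_normB _ _))//.
  have /andP[? ?] := psiM x; have /andP[? ?] := psiM' x.
  by rewrite !ger0_norm// lerD.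
have Rcvg : (\int[nu]_x f n x + c)%R @[n --> \oo] -->
            (\int[nu]_x (psi x - psi' x) + c * (1 - fine (nu setT)))%R.
  rewrite [X in _ --> X](_ : _ = (\int[nu]_x (psi x - psi' x - c) + c)%R);
    last first.
    rewrite [in RHS]RintegralB//; last exact: finite_measure_integrable_cst.
    by rewrite Rintegral_cst// mulrBr mulr1 addrA addrAC.
  apply: cvgD; last exact: cvg_cst.
  apply: fine_cvg; rewrite fineK; first exact: int_cvg.
  apply: integrable_fin_num => //.
  rewrite (_ : (fun x => _) = (fun x => (psi x - psi' x)%:E - c%:E))//.
  by apply: integrableB => //; exact: finite_measure_integrable_cst.
apply: (cvg_ge_bound Rcvg); apply: filterS near_adm => n adm.
apply: ereal_sup_ubound; exists (exist _ (f n) (Ccf n), c) => //=.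
rewrite /admissible/=; under eq_integral do rewrite subrK.
exact: adm.
Qed.

End dual_lower_bound.

Lemma metric_ball_open {R : realType} {X : completeMetricType R} (x : X) (d :
  R) :
  open (ball x d).
Proof.
rewrite openE => y; rewrite ballEmdist /= => xy.
have yd : nbhs y (ball y (d - mdist x y)) by apply: nbhsx_ballx;
  rewrite subr_gt0.
suff : nbhs y [set z | mdist x z < d] by [].
apply: filterS yd => z; rewrite ballEmdist/= ltrBrDl => yz.
by rewrite (le_lt_trans (metric_triangle _ y _)).
Qed.

Section simple_lower_bound.
Local Open Scope ereal_scope.
Context {R : realType} {X : completeMetricType R}.
Variables (mu : probability (borel X) R) (tau : borel X -> \bar R).
Hypotheses (separableX : separable X) (lcX : locally_compact [set: X])
  (tau_ge0 : forall x, 0 <= tau x)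
  (mtau : measurable_fun [set: borel X] tau)
  (tau_neqy : mu [set x | tau x = +oo] = 0).

Lemma ge0_integral_setU_le d (T : measurableType d) (m :
  {measure set T -> \bar R})
    (A B : set T) (f : T -> \bar R) : measurable A -> measurable B ->
    measurable_fun setT f -> (forall x, 0 <= f x) ->
  \int[m]_(x in A `|` B) f x <= \int[m]_(x in A) f x + \int[m]_(x in B) f x.
Proof.
move=> mA mB mf f0; rewrite -[B in A `|` B](setDUK (@subIsetr _ A B)).
rewrite setUA setUIr setUid [X in X `|` _](_ : _ = A); last first.
  by apply/seteqP; split => x; [case|move=> Ax; split => //; left].
rewrite ge0_integral_setU//.
- rewrite leeD2l//; apply: ge0_subset_integral => //.
  + by apply: measurableD => //; exact: measurableI.
  + exact: measurable_funTS.
- by apply: measurableD => //; exact: measurableI.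
- exact: measurable_funTS.
- by apply/disj_setPS => x [Ax [Bx nABx]]; exact: nABx.
Qed.

#[local] Hint Resolve expeR_ge0 : core.

Let measurable_exp (c : R) :
  measurable_fun setT (fun x => expeR (c%:E * tau x)).
Proof. exact: (@measurable_exp_tau _ _ _ mtau (cst c)). Qed.

(** Each point of [K] has a ball on which some [e^(c tau)] with [c > a] is integrable; finitely many
    such balls cover [K]. *)
Lemma xi_nbhs (a : R) (K : set X) : compact K ->
  (forall x, K x -> a%:E < xi mu tau x) ->
  exists U : set X, [/\ open U, K `<=` U &
    \int[mu]_(x in U) expeR (a%:E * tau x) < +oo].
Proof.
move=> cK aK.
have /choice[V VP] : forall x, exists V : set X, K x -> [/\ open V, V x &
    \int[mu]_(x in V) expeR (a%:E * tau x) < +oo].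
  move=> x; have [Kx|] := pselect (K x); last by exists set0.
  have [_ [d /= d0 <-]] := ereal_sup_gt (aK x Kx).
  move=> /ereal_sup_gt[_ [c [c0 ic] <-]] ac.
  exists (ball x d) => _; split; [exact: metric_ball_open|exact: ballxx|].
  have mB : measurable (ball x d : set (borel X)).
    by apply: borel_open; exact: metric_ball_open.
  apply: le_lt_trans ic; apply: ge0_le_integral => //.
  - exact: measurable_funTS.
  - exact: measurable_funTS.
  - by move=> y _; rewrite lee_expeR lee_wpmul2r// ltW.
have : cover_compact K by rewrite -compact_cover.
move=> /(_ X K V); case; first by move=> x /VP[].
  by move=> x Kx; exists x => //; have [] := VP x Kx.
move=> D DK KD; exists (\big[setU/set0]_(x <- D) V x).
have DKx x : x \in enum_fset D -> K x.
  by move=> xD; have := DK x xD; rewrite inE.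
split.
- rewrite -bigcup_fset; apply: bigcup_open => x /= xD.
  by have [] := VP x (DKx x xD).
- by rewrite -bigcup_fset.
- elim: (enum_fset D) (DKx) => [|x s ih] sK.
    by rewrite big_nil integral_set0.
  rewrite big_cons; have Kx : K x by apply: sK; rewrite mem_head.
  have [oV _ iV] := VP x Kx.
  have {}ih := ih (fun y ys => sK y (mem_behead (s := x :: s) ys)).
  have mV : measurable (V x : set (borel X)) by exact: borel_open.
  have ms : measurable (\big[setU/set0]_(y <- s) V y : set (borel X)).
    apply: borel_open; rewrite -bigcup_seq; apply: bigcup_open => y /= ys.
    by have [] := VP y (sK y (mem_behead (s := x :: s) ys)).
  apply: (le_lt_trans (ge0_integral_setU_le mu mV ms (measurable_exp a) _)) =>
    //.
  exact: lte_add_pinfty.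
Qed.

Variable nu : M1 X.

Lemma compact_inner_regularity2 (A : set (borel X)) (e : R) :
  measurable A -> (0 < e)%R ->
  exists K : set X, [/\ compact K, K `<=` A, mu (A `\` K) < e%:E &
    nu (A `\` K) < e%:E].
Proof.
move=> mA e0.
have [K [cK KA muK]] := compact_inner_regularity mu separableX lcX mA e0.
have [L [cL LA nuL]] := compact_inner_regularity nu separableX lcX mA e0.
exists (K `|` L); split; first exact: compactU.
- by move=> x [/KA|/LA].
- apply: le_lt_trans muK; apply: le_measure; rewrite ?inE.
  + by apply: measurableD => //; apply: compact_borel; exact: compactU.
  + by apply: measurableD => //; exact: compact_borel.
  + by apply: setDS => x; left.
- apply: le_lt_trans nuL; apply: le_measure; rewrite ?inE.
  + by apply: measurableD => //; apply: compact_borel; exact: compactU.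
  + by apply: measurableD => //; exact: compact_borel.
  + by apply: setDS => x; right.
Qed.

Section approximation.
Variables (phi : borel X -> R) (S : set (borel X)).
Hypotheses (mphi : measurable_fun setT phi) (mS : measurable S)
  (phiS : forall x, S x -> (phi x <= 0)%R \/ (phi x)%:E < xi mu tau x).

(** Induction on the values of [phi]: each level set in [S] is replaced by a compact subset that is
    nearly full for both [mu] and [nu], and the approximants of the levels are glued by maxima. *)
Lemma simple_approximant (s : seq R) (e : R) : (0 < e)%R ->
  exists C : set X, [/\ compact C, C `<=` S `&` [set x | phi x \in s],
    mu ((S `&` [set x | phi x \in s]) `\` C) < e%:E,
    nu ((S `&` [set x | phi x \in s]) `\` C) < e%:E &
    (exists h, approximant h (fun x => Num.max 0 (phi x) * \1_C x)%R 0 /\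
      exp_dominated mu tau h) /\
    (exists h', approximant h' (fun x => Num.max 0 (- phi x) * \1_C x)%R 0)].
Proof.
elim: s e => [|a s ih] e e0.
  exists set0; rewrite (_ : _ `&` _ = set0); last first.
    by apply/seteqP; split => // x [].
  rewrite set0D !measure0 lte_fin e0; split => //; first exact: compact0.
  have E0 (f : X -> R) : (fun x => f x * \1_set0 x)%R = cst 0%R.
    by apply/funext => x; rewrite indicE in_set0 mulr0.
  rewrite (E0 (fun x => Num.max 0 (phi x))%R) (E0 (fun x => Num.max 0
    (- phi x))%R).
  split; last by exists (fun _ => cst 0%R); exact: approximant0.
  by exists (fun _ => cst 0%R); split;
    [exact: approximant0|exact: exp_dominated0].
have e20 : (0 < e / 2)%R by rewrite divr_gt0.
have mSr r : measurable (S `&` [set x | phi x = r]).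
  apply: measurableI => //; rewrite -[X in measurable X]setTI.
  by rewrite (_ : [set x | _] = phi @^-1` [set r])//; exact: mphi.
have mpre (t : seq R) : measurable (S `&` [set x | phi x \in t]).
  elim: t => [|r t iht].
    by rewrite (_ : _ `&` _ = set0)//; apply/seteqP; split => // x [].
  rewrite (_ : _ `&` _ = (S `&` [set x | phi x = r]) `|`
                         (S `&` [set x | phi x \in t]));
                           first exact: measurableU.
  rewrite -setIUr; congr (_ `&` _); apply/seteqP; split => x /=.
    by rewrite in_cons => /orP[/eqP|]; [left|right].
  by rewrite in_cons => -[->|->]; rewrite ?eqxx ?orbT.
have [C [cC CS muC nuC [[h [ah dh]] [h' ah']]]] := ih _ e20.
have [K [cK KS muK nuK]] := compact_inner_regularity2 (mSr a) e20.
have split_le (m : {measure set (borel X) -> \bar R}) :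
    m ((S `&` [set x | phi x \in s]) `\` C) < (e / 2)%:E ->
    m ((S `&` [set x | phi x = a]) `\` K) < (e / 2)%:E ->
    m ((S `&` [set x | phi x \in a :: s]) `\` (C `|` K)) < e%:E.
  move=> mC mK.
  apply: (@le_lt_trans _ _ (m (((S `&` [set x | phi x \in s]) `\` C) `|`
                              ((S `&` [set x | phi x = a]) `\` K)))).
    apply: le_measure; rewrite ?inE.
    - by apply: measurableD => //; apply: compact_borel; exact: compactU.
    - apply: measurableU; apply: measurableD => //; exact: compact_borel.
    - move=> x [[Sx /=]]; rewrite in_cons => /orP[/eqP xa|xs] nCK.
        by right; split => // Kx; apply: nCK; right.
      by left; split => // Cx; apply: nCK; left.
  apply: le_lt_trans (measureU2 _ _ _) _.
  - by apply: measurableD => //; exact: compact_borel.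
  - by apply: measurableD => //; exact: compact_borel.
  - by rewrite (splitr e) EFinD lteD.
(* [C] and [K] can meet when the value [a] is repeated in [s]; both terms then equal [b], so the
   maximum is still correct. *)
have maxE (f : borel X -> R) b : (forall x, K x -> f x = b) -> (0 <= b)%R ->
    (forall x, 0 <= f x)%R ->
    (fun x => f x * \1_(C `|` K) x)%R =
    (fun x => Num.max (f x * \1_C x) (b * \1_K x))%R.
  move=> fb b0 f0; apply/funext => x; rewrite !indicE in_setU.
  case: (boolP (x \in C)) => xC; case: (boolP (x \in K)) => xK /=;
    rewrite ?mulr1 ?mulr0.
  - by rewrite fb ?maxxx//; exact: set_mem.
  - by apply/esym/max_idPl.
  - by rewrite fb ?(max_idPr _)//; exact: set_mem.
  - by rewrite maxxx.
exists (C `|` K); split.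
- exact: compactU.
- move=> x [/CS[Sx /= xs]|/KS[Sx /= ->]]; split => //=.
    by rewrite in_cons xs orbT.
  by rewrite mem_head.
- exact: split_le.
- exact: split_le.
- have ge0max (r : R) : (0 <= Num.max 0 r)%R by rewrite le_max lexx.
  split; last first.
    rewrite (maxE _ (Num.max 0 (- a))%R) => [||//|//]; last first.
      by move=> x /KS[_ ->].
    have [g [ag _]] := approximant_compact mu lcX tau_ge0 mtau cK openT
      (@subsetT _ K) (ge0max (- a)%R).
    exists (fun n x => Num.max (h' n x) (g n x)).
    by have := approximant_max ah' ag; rewrite maxxx.
  rewrite (maxE _ (Num.max 0 a)%R) => [||//|//]; last by move=> x /KS[_ ->].
  (* A nonpositive value has zero positive part, and the whole space will do; a positive one is
     below [xi] on [K] by [phiS]. *)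
  have [U [oU KU iU]] : exists U : set X, [/\ open U, K `<=` U &
      \int[mu]_(x in U) expeR ((Num.max 0 a)%R%:E * tau x) < +oo].
    have [a0|a0] := leP a 0%R.
      exists setT; split => //; first exact: openT.
      rewrite (eq_integral (cst 1)); last by move=> x _; rewrite mul0e expeR0.
      rewrite integral_cst// mul1e.
      have muT : mu setT < +oo by rewrite probability_setT ltry.
      exact: muT.
    apply: xi_nbhs => // x /KS[Sx /= xa].
    by have [] := phiS Sx; rewrite xa// leNgt a0.
  have [g [ag dg]] := approximant_compact mu lcX tau_ge0 mtau cK oU KU
    (ge0max a).
  exists (fun n x => Num.max (h n x) (g n x)); split.
    by have := approximant_max ah ag; rewrite maxxx.
  by apply: exp_dominated_max => //; exact: dg.
Qed.

(** [phi] is cut to a compact [C] inside [S]. Where it is replaced by 0 the exponential becomes 1,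
    so the constraint grows by at most [mu (~] C)[, and the integral against]nu[drops by at most]B *
    nu (~[C)]. *)
Lemma dual_rate_ge_simple (c : R) (K0 : set X) :
  finite_set (range phi) -> mu (~` S) = 0 -> nu (~` S) = 0 ->
  (0 <= c)%R -> compact K0 ->
  \int[mu]_(x in ~` K0) expeR (c%:E * tau x) < +oo ->
  \int[mu]_x expeR ((phi x)%:E * tau x) < 1 ->
  (\int[nu]_x phi x + c * (1 - fine (nu setT)))%R%:E <= dual_rate mu tau nu.
Proof.
move=> fphi muS nuS c0 cK0 icK0 int1; have /finite_seqP[s phis] := fphi.
have phi_s x : phi x \in s.
  suff : [set` s] (phi x) by [].
  by rewrite -phis; exists x.
have SE : S `&` [set x | phi x \in s] = S.
  by apply/seteqP; split => [x [Sx _]//|x Sx]; split => //=; exact: phi_s.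
have [B phiB] := finite_range_bounded fphi.
have B0 : (0 <= B)%R by rewrite (le_trans _ (phiB point)).
apply/lee_addgt0Pr => e e0.
have mexp : measurable_fun setT (fun x => expeR ((phi x)%:E * tau x)).
  exact: measurable_exp_tau.
have [d [d0 dint dB]] : exists d : R, [/\ (0 < d)%R,
    \int[mu]_x expeR ((phi x)%:E * tau x) + d%:E < 1 & (B * d <= e)%R].
  have i0 : 0 <= \int[mu]_x expeR ((phi x)%:E * tau x) by exact: integral_ge0.
  have ifin : \int[mu]_x expeR ((phi x)%:E * tau x) \is a fin_num.
    by rewrite ge0_fin_numE// (lt_trans int1)// ltry.
  move: int1; rewrite -(fineK ifin); set i := fine _; rewrite lte_fin => i1.
  (* Half of the slack in the constraint; [B + 1] avoids a division by zero. *)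
  exists (Num.min ((1 - i) / 2) (e / (B + 1)))%R; split.
  - by rewrite lt_min !divr_gt0 ?subr_gt0// ltr_wpDl.
  - rewrite -EFinD lte_fin (@le_lt_trans _ _ (i + (1 - i) / 2)%R)//.
      by rewrite lerD2l ge_min lexx.
    by lra.
  - rewrite (@le_trans _ _ (B * (e / (B + 1))))%R//.
      by rewrite ler_wpM2l// ge_min lexx orbT.
    by rewrite mulrCA ger_pMr// ler_pdivrMr ?mul1r ?lerDl// ltr_wpDl.
have [C [cC CS muC nuC [[h [ah dh]] [h' ah']]]] := simple_approximant s d0.
rewrite SE in CS muC nuC.
have mC : measurable (C : set (borel X)) by exact: compact_borel.
have [g [ag dg]] := approximant_infty mu separableX lcX tau_ge0 mtau cK0 c0.
have {}ah := approximant_max ah ag.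
have {}dh := exp_dominated_max dh (dg icK0).
(* The piece at infinity has limit 0, so gluing it leaves the limit function unchanged and only
   turns the constant at infinity from 0 into [c]. *)
have mx0 : (fun x => Num.max (Num.max 0 (phi x) * \1_C x) 0)%R =
           (fun x => Num.max 0 (phi x) * \1_C x)%R.
  by apply/funext => x; apply/max_idPl; rewrite mulr_ge0// le_max lexx.
rewrite mx0 (max_idPr c0) in ah.
have diffE x : (Num.max 0 (phi x) * \1_C x - Num.max 0 (- phi x) * \1_C x =
                phi x * \1_C x)%R.
  rewrite -mulrBl; congr (_ * _)%R.
  by case: (leP (phi x) 0%R) => p0; case: leP => p1; lra.
have compl (m : {measure set (borel X) -> \bar R}) :
    m (~` S) = 0 -> m (S `\` C) < d%:E -> m (~` C) <= d%:E.
  move=> mS0 mSC; apply: (@le_trans _ _ (m ((S `\` C) `|` ~` S))).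
    apply: le_measure; rewrite ?inE.
    - exact: measurableC.
    - by apply: measurableU; [exact: measurableD|exact: measurableC].
    - by move=> x nCx; have [Sx|nSx] := pselect (S x); [left|right].
  apply: le_trans (measureU2 _ _ _) _.
  - exact: measurableD.
  - exact: measurableC.
  - have mS0' : m (~` S) <= 0 by rewrite mS0.
    by rewrite -[leRHS]adde0; apply: leeD => //; exact: ltW.
have lt1 : \int[mu]_x expeR ((Num.max 0 (phi x) * \1_C x -
                              Num.max 0 (- phi x) * \1_C x)%:E * tau x) < 1.
  apply: le_lt_trans dint.
  apply: (@le_trans _ _ (\int[mu]_x (expeR ((phi x)%:E * tau x) +
    (\1_(~` C) x)%:E))).
    apply: ge0_le_integral => //.
    - under eq_fun do rewrite diffE.
      by apply: (measurable_exp_tau mtau); exact: measurable_funM.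
    - by apply: emeasurable_funD => //; apply/measurable_EFinP;
        exact: measurable_indic (measurableC mC).
    - move=> x _; rewrite diffE !indicE in_setC.
      case: (boolP (x \in C)) => xC /=; first by rewrite mulr1 adde0.
      by rewrite mulr0 mul0e expeR0 leeDr// expeR_ge0.
  rewrite ge0_integralD//.
  + rewrite leeD2l// integral_indic//; last exact: measurableC.
    rewrite setIT; exact: compl.
  + by apply/measurable_EFinP; exact: measurable_indic (measurableC mC).
have := dual_rate_ge tau_ge0 mtau tau_neqy nu ah dh ah' lt1.
move=> /(leeD2r e%:E); apply: le_trans.
rewrite -EFinD lee_fin addrAC lerD2r.
have mphiC : measurable_fun setT (fun x : borel X => (phi x * \1_C x)%R).
  by apply: measurable_funM.
have mphiC' : measurable_fun setT (fun x : borel X => (phi x * \1_(~` C) x)%R).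
  by apply: measurable_funM => //; exact: measurable_indic (measurableC mC).
have iphi : nu.-integrable setT (EFin \o phi) by exact: bounded_integrable phiB.
have ind01 (A : set X) x : (0 <= (\1_A x : R) <= 1)%R.
  by rewrite indicE; case: (_ \in _); rewrite ?lexx ?ler01.
have iC : nu.-integrable setT (EFin \o (fun x => phi x * \1_C x)%R).
  apply: (@bounded_integrable _ _ _ _ _ B) => // x;
    have /andP[i0 i1] := ind01 C x.
  by rewrite normrM (ger0_norm i0) (le_trans _ (phiB x))// ler_piMr.
have iC' : nu.-integrable setT (EFin \o (fun x => B * \1_(~` C) x)%R).
  apply: (@bounded_integrable _ _ _ _ _ B) => [|x].
    by apply: measurable_funM => //; exact: measurable_indic (measurableC mC).
  have /andP[i0 i1] := ind01 (~` C) x.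
  by rewrite normrM (ger0_norm i0) (ger0_norm B0) ler_piMr.
have -> : (\int[nu]_x (Num.max 0 (phi x) * \1_C x -
    Num.max 0 (- phi x) * \1_C x) = \int[nu]_x (phi x * \1_C x))%R.
  by apply: eq_Rintegral => x _; rewrite diffE.
apply: (@le_trans _ _ (\int[nu]_x (phi x * \1_C x) +
                       \int[nu]_x (B * \1_(~` C) x))%R).
  rewrite -RintegralD//; apply: le_Rintegral => //.
    rewrite (_ : _ \o _ = ((EFin \o (fun x => phi x * \1_C x)%R) \+
      (EFin \o (fun x => B * \1_(~` C) x)%R)))//.
    exact: integrableD.
  move=> x _; rewrite !indicE in_setC; case: (boolP (x \in C)) => xC /=.
    by rewrite mulr1 mulr0 addr0.
  by rewrite mulr0 mulr1 add0r (le_trans _ (phiB x))// ler_norm.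
rewrite lerD2l RintegralZl//; last first.
  apply: (@bounded_integrable _ _ _ _ _ 1%R) => [|x].
    exact: measurable_indic (measurableC mC).
  by have /andP[i0 i1] := ind01 (~` C) x; rewrite ger0_norm.
rewrite /Rintegral integral_indic//; last exact: measurableC.
rewrite setIT (le_trans _ dB)// ler_wpM2l// -lee_fin fineK.
  exact: compl.
by apply: fin_num_measure; exact: measurableC.
Qed.

End approximation.
End simple_lower_bound.

(** * Duality for the entropy term *)

Section density.
Local Open Scope ereal_scope.
Context d (T : measurableType d) (R : realType).
Import HBNNSimple.

Lemma ge0_integral_density (m m' : {measure set T -> \bar R}) (w : T -> R)
    (F : T -> \bar R) :
  measurable_fun setT w -> (forall x, 0 <= w x)%R ->
  (forall A, measurable A -> m' A = \int[m]_(x in A) (w x)%:E) ->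
  measurable_fun setT F -> (forall x, 0 <= F x) ->
  \int[m']_x F x = \int[m]_x (F x * (w x)%:E).
Proof.
move=> mw w0 m'E mF F0.
have mwE : measurable_fun setT (EFin \o w) by exact/measurable_EFinP.
pose h := nnsfun_approx measurableT mF.
have h_cvg x : (EFin \o h n) x @[n --> \oo] --> F x by exact: cvg_nnsfun_approx.
have h_nd x : {homo (fun n => (EFin \o h n) x) : n k / (n <= k)%N >-> n <= k}.
  by move=> n k nk; rewrite /= lee_fin; exact/lefP/nd_nnsfun_approx.
have mh n : measurable_fun setT (EFin \o h n) by exact/measurable_EFinP.
have hE n : \int[m']_x (h n x)%:E = \int[m]_x ((h n x)%:E * (w x)%:E).
  have -> : \int[m']_x (h n x)%:E = \int[m']_x (\sum_(y \in range (h n))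
      (y * \1_(h n @^-1` [set y]) x)%:E).
    by apply: eq_integral => x _; rewrite fimfunE -fsumEFin.
  have -> : \int[m]_x ((h n x)%:E * (w x)%:E) = \int[m]_x (\sum_(y \in range
    (h n))
      ((y * \1_(h n @^-1` [set y]) x)%:E * (w x)%:E)).
    apply: eq_integral => x _.
    rewrite -ge0_mule_fsuml => [|y]; last exact: nnfun_muleindic_ge0.
    by rewrite fsumEFin // -(fimfunE _ x).
  have mind y : measurable_fun setT (fun x =>
    (y * \1_(h n @^-1` [set y]) x)%:E).
    by apply/measurable_EFinP; exact: measurable_funM.
  rewrite ge0_integral_fsum//; last by move=> y x _; exact: nnfun_muleindic_ge0.
  rewrite ge0_integral_fsum//; last 2 first.
  - by move=> y; exact: emeasurable_funM.
  - by move=> y x _; rewrite mule_ge0 ?lee_fin// -lee_fin nnfun_muleindic_ge0.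
  apply: eq_fsbigr => y; rewrite inE => -[t _ <-].
  set A := h n @^-1` _; have mA : measurable A by rewrite -[A]setTI;
    exact: measurable_funP.
  under eq_integral do rewrite EFinM.
  rewrite ge0_integralZl ?lee_fin//; last exact/measurable_EFinP.
  under [in RHS]eq_integral do rewrite EFinM -muleA.
  rewrite ge0_integralZl ?lee_fin//; last 2 first.
  - by apply: emeasurable_funM => //; exact/measurable_EFinP.
  - by move=> x _; rewrite mule_ge0 ?lee_fin.
  congr (_ * _); rewrite integral_indic// setIT m'E// integral_mkcond.
  by apply: eq_integral => x _; rewrite epatch_indic muleC.
have lim1 : \int[m']_x (h n x)%:E @[n --> \oo] --> \int[m']_x F x.
  rewrite (eq_integral (fun x => limn (fun n => (EFin \o h n) x))); last first.
    by move=> x _; apply/esym/cvg_lim.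
  apply: cvg_monotone_convergence => // [n x _|x _]; last exact: h_nd.
  by rewrite /= lee_fin.
have lim2 : \int[m]_x ((h n x)%:E * (w x)%:E) @[n --> \oo] -->
            \int[m]_x (F x * (w x)%:E).
  rewrite (eq_integral (fun x => limn (fun n => (h n x)%:E * (w x)%:E)));
    last first.
    by move=> x _; apply/esym/cvg_lim => //; apply: cvgeZr => //; exact: h_cvg.
  apply: cvg_monotone_convergence => // [n|n x _|x _ a b ab].
  - by apply: emeasurable_funM; [exact: mh|exact: mwE].
  - by rewrite mule_ge0 ?lee_fin.
  - by rewrite lee_wpmul2r ?lee_fin// -lee_fin; exact: h_nd.
have lim2' : \int[m']_x (h n x)%:E @[n --> \oo] --> \int[m]_x (F x * (w x)%:E).
  by under eq_fun do rewrite hE.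
exact: (cvg_unique _ lim1 lim2').
Qed.

(** Adding [M] makes the integrand nonnegative, so its integral is meaningful even where [psi] is
    infinite, and simple functions increase to it. *)
Lemma simple_function_below (m : {finite_measure set T -> \bar R})
    (psi : T -> \bar R) (M r : R) :
  measurable_fun setT psi -> (forall x, (- M)%:E <= psi x) ->
  (r + M * fine (m setT))%:E < \int[m]_x (psi x + M%:E) ->
  exists phi : T -> R, [/\ measurable_fun setT phi, finite_set (range phi),
    forall x, (phi x)%:E <= psi x & (r < \int[m]_x phi x)%R].
Proof.
move=> mpsi psiM r_lt.
have mF : measurable_fun setT (fun x => psi x + M%:E) by exact:
  emeasurable_funD.
have F0 x : 0 <= psi x + M%:E.
  by rewrite -leeBlDr// sub0e -EFinN.
pose h := nnsfun_approx measurableT mF.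
have h_cvg x : (EFin \o h n) x @[n --> \oo] --> psi x + M%:E.
  by apply: cvg_nnsfun_approx.
have h_nd x : {homo (fun n => (EFin \o h n) x) : n k / (n <= k)%N >-> n <= k}.
  by move=> n k nk; rewrite /= lee_fin; exact/lefP/nd_nnsfun_approx.
have mh n : measurable_fun setT (EFin \o h n) by exact/measurable_EFinP.
have lim1 : \int[m]_x (h n x)%:E @[n --> \oo] --> \int[m]_x (psi x + M%:E).
  rewrite (eq_integral (fun x => limn (fun n => (EFin \o h n) x))); last first.
    by move=> x _; apply/esym/cvg_lim.
  apply: cvg_monotone_convergence => // [n x _|x _]; last exact: h_nd.
  by rewrite /= lee_fin.
have [n rn] : exists n, (r + M * fine (m setT))%:E < \int[m]_x (h n x)%:E.
  have gt1 : nbhs (\int[m]_x (psi x + M%:E)) [set z | (r + M * fine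
    (m setT))%:E < z].
    by apply: open_nbhs_nbhs; split => //; exact: open_ereal_gt_ereal.
  have near1 : \forall n \near \oo,
    (r + M * fine (m setT))%:E < \int[m]_x (h n x)%:E := lim1 _ gt1.
  exact: filter_ex near1.
exists (fun x => h n x - M)%R; split.
- by apply: measurable_funB.
- have := @fimfunP _ _ (h n).
  move/(finite_image (fun y => y - M)%R); apply: sub_finite_set.
  by move=> _ [x _ <-]; exists (h n x) => //; exists x.
- move=> x; rewrite EFinB leeBlDr//.
  by rewrite /h nnsfun_approxE; apply: le_approx => // y _; exact: F0.
- have ih : m.-integrable setT (EFin \o h n).
    have [B hB] := finite_range_bounded (@fimfunP _ _ (h n)).
    exact: bounded_integrable hB.
  rewrite RintegralB//; last exact: finite_measure_integrable_cst.
  rewrite Rintegral_cst// ltrBrDr -lte_fin.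
  rewrite /Rintegral fineK//; exact: integrable_fin_num.
Qed.

End density.

Lemma measurable_entropy_fun (R : realType) :
  measurable_fun setT (@entropy_fun R).
Proof.
apply: measurable_funD => //; apply: measurable_funM => //.
by apply: measurable_funB => //; exact: measurable_ln.
Qed.

Section nubar_density.
Local Open Scope ereal_scope.
Context {R : realType} {X : completeMetricType R}.
Variables (mu : probability (borel X) R) (tau : borel X -> \bar R).
Hypotheses (tau_ge0 : forall x, 0 <= tau x)
  (mtau : measurable_fun [set: borel X] tau)
  (tau_neq0 : mu [set x | tau x = 0] = 0)
  (tau_neqy : mu [set x | tau x = +oo] = 0).
Variable nua : {finite_measure set (borel X) -> \bar R}.
Hypothesis nua_mu : nua `<< mu.

Local Notation m := (\int[nua]_x (tau x)^-1).

Let null (A : set (borel X)) : measurable A -> mu A = 0 -> nua A = 0.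
Proof. by move=> mA; move/null_content_dominatesP : nua_mu => /(_ A mA). Qed.

Let mtau_eq (y : \bar R) : measurable [set x | tau x = y].
Proof. by rewrite -[X in measurable X]setTI;
  exact: (mtau measurableT (emeasurable_set1 y)). Qed.

Lemma ae_tau_pos_fin (k : {measure set (borel X) -> \bar R}) :
  k [set x | tau x = 0] = 0 -> k [set x | tau x = +oo] = 0 ->
  {ae k, forall x, exists2 t, (0 < t)%R & tau x = t%:E}.
Proof.
move=> k0 ky; exists ([set x | tau x = 0] `|` [set x | tau x = +oo]); split.
- exact: measurableU.
- by rewrite measureU0.
- move=> x /= nx; apply: contrapT => /not_orP[t0 ty]; apply: nx.
  have tfin : tau x \is a fin_num.
    by rewrite ge0_fin_numE// lt_neqAle leey andbT; apply/eqP.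
  exists (fine (tau x)); last by rewrite fineK.
  rewrite lt_neqAle fine_ge0// andbT eq_sym; apply/eqP => tx0.
  by apply: t0; rewrite -(fineK tfin) tx0.
Qed.

Lemma ae_nua_tau : {ae nua, forall x, exists2 t, (0 < t)%R & tau x = t%:E}.
Proof. by apply: ae_tau_pos_fin; exact: null. Qed.

(** The last clause says that [nua] has density [m tau g] with respect to [mu]: it converts
    integrals against [nua] into integrals against [mu], in which the entropy is expressed. *)
Lemma nubar_density : 0 < m -> m < +oo ->
  exists (P : probability (borel X) R) (g : borel X -> R),
  [/\ measurable_fun setT g, forall x, (0 <= g x)%R,
      forall A, measurable A -> P A = \int[mu]_(x in A) (g x)%:E,
      P `<< mu /\
      relative_entropy (nubar mu tau_ge0 mtau nua) mu =
        \int[mu]_x (entropy_fun (g x))%:E &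
      forall F : borel X -> \bar R, measurable_fun setT F ->
        (forall x, 0 <= F x) ->
        \int[nua]_x F x = m * \int[mu]_x (F x * tau x * (g x)%:E)].
Proof.
move=> m0 my.
pose P : probability (borel X) R := nubar mu tau_ge0 mtau nua.
have mfin : m \is a fin_num by rewrite ge0_fin_numE// ltW.
have PE A : P A = (\int[nua]_(x in A) (tau x)^-1) * (fine m)^-1%:E.
  rewrite /P /nubar /= /mnormalize /=.
  rewrite [X in if X then _ else _](_ : _ = false)//.
  apply/negP => /orP[/eqP m00|/eqP myy].
    by move: m0; rewrite /density_measure in m00; rewrite m00 ltxx.
  by move: my; rewrite /density_measure in myy; rewrite myy ltxx.
have Pmu : P `<< mu.
  apply/null_content_dominatesP => A mA muA.
  rewrite PE (null_set_integral mA _ (null mA muA)) ?mul0e//.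
  by apply: measurable_funTS; exact: measurable_inv_tau.
pose rn := Radon_Nikodym (charge_of_finite_measure P) mu.
have rnfin x : rn x \is a fin_num by exact: Radon_Nikodym_fin_num.
have mrn : measurable_fun setT rn.
  by apply: measurable_int; exact: Radon_Nikodym_integrable.
(* The Radon-Nikodym derivative is known to be nonnegative only almost everywhere. *)
pose g x := Num.max 0%R (fine (rn x)).
have rn_ge0 : {ae mu, forall x, 0 <= rn x}.
  apply: filterS (ae_eq_Radon_Nikodym_SigmaFinite Pmu measurableT) =>
    x /(_ I) fx; rewrite /rn -fx.
  exact: Radon_Nikodym_SigmaFinite.f_ge0.
have rng : ae_eq mu setT rn (EFin \o g).
  apply: filterS rn_ge0 => x rx _; rewrite /g /= (max_idPr _) ?fineK//.
  exact: fine_ge0.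
have mg : measurable_fun setT g.
  apply: measurable_maxr => //.
  exact: measurableT_comp (fine_measurable measurableT) mrn.
have PgE A : measurable A -> P A = \int[mu]_(x in A) (g x)%:E.
  move=> mA; transitivity (\int[mu]_(x in A) rn x).
    exact: (@Radon_Nikodym_integral _ _ _
      (charge_of_finite_measure P) mu A Pmu mA).
  apply: ae_eq_integral => //; [exact: measurable_funTS| |].
    by apply: measurable_funTS; exact/measurable_EFinP.
  by apply: filterS rng => x + _; exact.
have g0 x : (0 <= g x)%R by rewrite /g le_max lexx.
exists P, g; split => //.
  split => //; rewrite /relative_entropy asboolT//.
  apply: ae_eq_integral => //.
  - apply/measurable_EFinP; apply: measurableT_comp.
      exact: measurable_entropy_fun.
    exact: measurableT_comp (fine_measurable measurableT) mrn.
  - by apply/measurable_EFinP; apply: measurableT_comp;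
      first exact: measurable_entropy_fun.
  - by apply: filterS rng => x /(_ I) /= rx _; rewrite -/P -/rn rx.
move=> F mF F0.
have mFt : measurable_fun setT (fun x => F x * tau x) by exact:
  emeasurable_funM.
have Ft0 x : 0 <= F x * tau x by exact: mule_ge0.
(* The density of [P] with respect to [nua]; it can be inverted because [tau] is positive and finite
   [nua]-almost everywhere. *)
pose w x := (fine (tau x)^-1 * (fine m)^-1)%R.
have mgt0 : (0 < fine m)%R by rewrite fine_gt0// m0.
have w0 x : (0 <= w x)%R.
  by rewrite mulr_ge0 ?invr_ge0 ?(ltW mgt0)// fine_ge0// inve_ge0.
have minv := measurable_inv_tau tau_ge0 mtau.
have mw : measurable_fun setT w.
  by apply: measurable_funM => //;
    exact: measurableT_comp (fine_measurable measurableT) minv.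
rewrite -(@ge0_integral_density _ _ _ mu P _ _ mg g0)//.
have PwE A : measurable A -> P A = \int[nua]_(x in A) (w x)%:E.
  move=> mA; rewrite PE muleC -ge0_integralZl//.
  - apply: ae_eq_integral => //.
    + by apply: emeasurable_funM => //; exact: measurable_funTS.
    + by apply: measurable_funTS; exact/measurable_EFinP.
    + apply: filterS ae_nua_tau => x [t t0 tx] _.
      by rewrite /w tx inver gt_eqF//= -EFinM mulrC.
  - exact: measurable_funTS.
  - by move=> x _; rewrite inve_ge0.
  - by rewrite lee_fin invr_ge0 ltW.
rewrite (@ge0_integral_density _ _ _ nua P _ _ mw w0)//.
rewrite -{1}(fineK mfin) -ge0_integralZl//.
- apply: ae_eq_integral => //.
  + apply: emeasurable_funM => //; apply: emeasurable_funM => //.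
    exact/measurable_EFinP.
  + apply: filterS ae_nua_tau => x [t t0 tx] _.
    rewrite /w tx inver gt_eqF//= -muleA -EFinM mulrA divff ?gt_eqF// mul1r.
    by rewrite muleCA -EFinM divff ?gt_eqF// mule1.
- by apply: emeasurable_funM => //; exact/measurable_EFinP.
- by move=> x _; rewrite mule_ge0 ?lee_fin.
- by rewrite lee_fin ltW.
Qed.

End nubar_density.

(** The inequality [1 + u <= e^u] at [u = y - ln g], multiplied by [g]; it expresses the convex
    duality of [entropy_fun] and [e^y - 1]. *)
Lemma entropy_fun_young (R : realType) (g y : R) : 0 <= g ->
  g * y + 1 <= entropy_fun g + expR y.
Proof.
rewrite le_eqVlt => /orP[/eqP<-|g0].
  by rewrite /entropy_fun !mul0r add0r lerDl expR_ge0.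
have : 1 + (y - ln g) <= expR (y - ln g) by exact: expR_ge1Dx.
rewrite expRD expRN lnK ?posrE// ler_pdivlMr// /entropy_fun.
set e := expR y; set l := ln g; lra.
Qed.

Lemma entropy_fun_ge0 (R : realType) (g : R) : 0 <= entropy_fun g.
Proof.
have [g0|g0] := leP 0 g.
  by have := entropy_fun_young 0 g0; rewrite mulr0 add0r expR0 -lerBlDr subrr.
by rewrite /entropy_fun ln0 ?ltW//; lra.
Qed.

Lemma relative_entropy_ge0 d (T : measurableType d) (R : realType)
    (nu : {finite_measure set T -> \bar R})
    (mu : {sigma_finite_measure set T -> \bar R}) :
  (0 <= relative_entropy nu mu)%E.
Proof.
rewrite /relative_entropy; case: ifP => _; last exact: leey.
by apply: integral_ge0 => x _; rewrite lee_fin entropy_fun_ge0.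
Qed.

(** * Gibbs' variational inequality *)

Section gibbs.
Local Open Scope ereal_scope.
Context {R : realType} {X : completeMetricType R}.
Variables (mu : probability (borel X) R) (tau : borel X -> \bar R).
Hypotheses (tau_ge0 : forall x, 0 <= tau x)
  (mtau : measurable_fun [set: borel X] tau)
  (tau_neq0 : mu [set x | tau x = 0] = 0)
  (tau_neqy : mu [set x | tau x = +oo] = 0).
Variable nua : {finite_measure set (borel X) -> \bar R}.
Hypothesis nua_mu : nua `<< mu.

#[local] Hint Resolve expeR_ge0 : core.

Local Notation m := (\int[nua]_x (tau x)^-1).

Let m_ge0 : 0 <= m.
Proof. by apply: integral_ge0 => x _; rewrite inve_ge0. Qed.

Let nua_fin : nua setT \is a fin_num. Proof. exact: fin_num_measure. Qed.

Let ae_mu_tau := ae_tau_pos_fin tau_ge0 mtau tau_neq0 tau_neqy.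

(** [nua] charges only points where [tau] is finite, and there [1 / tau] is positive. *)
Lemma integral_inv_tau_eq0 : m = 0 -> nua setT = 0.
Proof.
move=> m0.
have inv0 : {ae nua, forall x, (tau x)^-1 = 0}.
  have := (ae_eq_integral_abs nua measurableT
    (measurable_inv_tau tau_ge0 mtau)).1.
  move=> H; have : \int[nua]_x `|(tau x)^-1| = 0.
    by rewrite -[RHS]m0; apply: eq_integral => x _; rewrite gee0_abs// inve_ge0.
  by move=> /H; apply: filterS => x; exact.
have : {ae nua, forall x : borel X, False}.
  apply: filterS2 inv0 (ae_nua_tau tau_ge0 mtau tau_neq0 tau_neqy nua_mu) => x.
  move=> + [t t0 tx]; rewrite tx inver gt_eqF// => -[/eqP].
  by rewrite invr_eq0 gt_eqF.
move=> [A [mA A0 TA]]; apply/eqP; rewrite -measure_le0 -A0.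
by apply: le_measure; rewrite ?inE// => x _; apply: TA => -[].
Qed.

(** Young's inequality at [g] and [psi tau] is integrated; by the constraint, the exponential term
    is absorbed by the 1 on the other side. *)
Lemma gibbs_bound (psi : borel X -> R) (M : R) : m < +oo ->
  measurable_fun setT psi -> (forall x, `|psi x| <= M)%R ->
  \int[mu]_x expeR ((psi x)%:E * tau x) <= 1 ->
  (\int[nua]_x psi x)%R%:E <= m * relative_entropy
    (nubar mu tau_ge0 mtau nua) mu.
Proof.
move=> my mpsi psiM int1.
move: m_ge0; rewrite le_eqVlt => /orP[/eqP m0|m0].
  rewrite -m0 mul0e lee_fin /Rintegral null_set_integral//.
    exact/measurable_EFinP.
  exact: integral_inv_tau_eq0.
have [P [g [mg g0 Pg [_ ->] nuaE]]] :=
  nubar_density tau_ge0 mtau tau_neq0 tau_neqy nua_mu m0 my.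
have M0 : (0 <= M)%R by rewrite (le_trans _ (psiM point)).
have psiM0 x : (0 <= psi x + M)%R.
  by have := psiM x; rewrite ler_norml => /andP[+ _]; rewrite -subr_ge0 opprK.
have mpsiM : measurable_fun setT (fun x => (psi x + M)%:E).
  by apply/measurable_EFinP; exact: measurable_funD.
have mgE : measurable_fun setT (EFin \o g) by exact/measurable_EFinP.
have mh : measurable_fun setT (fun x => (entropy_fun (g x))%:E).
  by apply/measurable_EFinP; apply: measurableT_comp => //;
    exact: measurable_entropy_fun.
have mexp : measurable_fun setT (fun x => expeR ((psi x)%:E * tau x)).
  exact: measurable_exp_tau.
have mMt : measurable_fun setT (fun x => M%:E * tau x * (g x)%:E).
  by apply: emeasurable_funM => //; exact: emeasurable_funM.
have mpMt : measurable_fun setT (fun x => (psi x + M)%:E * tau x * (g x)%:E).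
  by apply: emeasurable_funM => //; exact: emeasurable_funM.
have Mt0 x : 0 <= M%:E * tau x * (g x)%:E by rewrite !mule_ge0 ?lee_fin.
have pMt0 x : 0 <= (psi x + M)%:E * tau x *
  (g x)%:E by rewrite !mule_ge0 ?lee_fin.
have h0 x : 0 <= (entropy_fun (g x))%:E by rewrite lee_fin entropy_fun_ge0.
set H := \int[mu]_x (entropy_fun (g x))%:E.
have H0 : 0 <= H by exact: integral_ge0.
have ME := nuaE (cst M%:E) (measurable_cst _) (fun _ => M0).
have pE := nuaE _ mpsiM psiM0.
(* The term [M tau g] on both sides keeps every integrand nonnegative; up to the factor [m] it is
   the finite number [M * nua setT], cancelled at the end. *)
have key : \int[mu]_x ((psi x + M)%:E * tau x * (g x)%:E) <=
           H + \int[mu]_x (M%:E * tau x * (g x)%:E).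
  have : \int[mu]_x ((psi x + M)%:E * tau x * (g x)%:E + 1) <=
      \int[mu]_x ((entropy_fun (g x))%:E + expeR ((psi x)%:E * tau x) +
                  M%:E * tau x * (g x)%:E).
    apply: ae_ge0_le_integral => //.
    - by move=> x _; rewrite adde_ge0.
    - exact: emeasurable_funD.
    - by move=> x _; rewrite !adde_ge0.
    - by apply: emeasurable_funD => //; exact: emeasurable_funD.
    - apply: filterS ae_mu_tau => x [t t0 ->] _.
      rewrite -!EFinM /= -!EFinD lee_fin.
      by have := entropy_fun_young (psi x * t)%R (g0 x); lra.
  rewrite ge0_integralD//.
  rewrite [X in _ <= X]ge0_integralD//; last 2 first.
  - by move=> x _; rewrite adde_ge0.
  - exact: emeasurable_funD.
  rewrite ge0_integralD//.
  have -> : \int[mu]_x 1 = 1 by rewrite integral_cst// mul1e;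
    exact: probability_setT.
  move=> le1; rewrite -(leeD2rE (x := 1))//.
  apply: (le_trans le1); rewrite addeAC leeD2l//.
rewrite -(leeD2rE (x := (M%:E * nua setT))); last first.
  by rewrite fin_numM.
have -> : (\int[nua]_x psi x)%R%:E + M%:E * nua setT = \int[nua]_x
  (psi x + M)%:E.
  have ipsi := @bounded_integrable _ _ _ nua _ _ mpsi psiM.
  rewrite (eq_integral (fun x => (psi x)%:E + (cst M x)%:E))//.
  rewrite integralD//; last exact: finite_measure_integrable_cst.
  congr (_ + _); last by rewrite -integral_cst.
  by rewrite /Rintegral fineK//; exact: integrable_fin_num.
rewrite pE -integral_cst//= ME -ge0_muleDr//; last exact: integral_ge0.
by rewrite lee_wpmul2l.
Qed.

End gibbs.

Lemma expR1_gt2 (R : realType) : 2 < expR 1 :> R.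
Proof. by have := @expR_gt1Dx R 1 (oner_neq0 _); lra. Qed.

(** * Nearly optimal test functions for the entropy *)

Section donsker_varadhan.
Local Open Scope ereal_scope.
Context {R : realType} {X : completeMetricType R}.
Variables (mu : probability (borel X) R) (tau : borel X -> \bar R).
Hypotheses (tau_ge0 : forall x, 0 <= tau x)
  (mtau : measurable_fun [set: borel X] tau)
  (tau_neq0 : mu [set x | tau x = 0] = 0)
  (tau_neqy : mu [set x | tau x = +oo] = 0).

#[local] Hint Resolve expeR_ge0 : core.

(** Where [tau] is small, a negative test function hardly lowers [expeR (psi * tau)]. These sets
    have small measure since [tau] is positive almost everywhere, and off them the value [-(n+1)]
    brings the exponent below [-1]. *)
Let E n : set (borel X) := [set x | tau x <= n.+1%:R^-1%:E].

Let mE n : measurable (E n).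
Proof. by rewrite -[X in measurable X]setTI;
  exact: emeasurable_fun_infty_c. Qed.

Let E_nincr n k : (n <= k)%N -> E k `<=` E n.
Proof.
move=> nk x /= /le_trans; apply; rewrite lee_fin lef_pV2 ?posrE//.
by rewrite ler_nat ltnS.
Qed.

Let small_E (k : {finite_measure set (borel X) -> \bar R}) (e : R) :
  (0 < e)%R ->
  k [set x | tau x = 0] = 0 -> exists n, k (E n) < e%:E.
Proof.
move=> e0 k0; apply: nonincreasing_measure_lt => //.
rewrite (_ : \bigcap_n E n = [set x | tau x = 0]) ?k0 ?lte_fin//.
apply/seteqP; split => x /=; last by move=> x0 n _;
  rewrite /E/= x0 lee_fin invr_ge0.
move=> xE; apply/eqP; rewrite eq_le tau_ge0 andbT.
apply/lee_addgt0Pr => _/posnumP[d]; rewrite add0e.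
have /ltr_add_invr[n] : (0 < d%:num)%R by [].
rewrite add0r => nd; apply: (le_trans (xE n I)); rewrite lee_fin; exact: ltW.
Qed.

Let expeR_off_E n x : ~ E n x -> expeR ((- n.+1%:R)%:E * tau x) <= (expR
  (-1))%:E.
Proof.
move=> /negP; rewrite -ltNge => nx.
suff : (- n.+1%:R)%:E * tau x <= (-1)%:E by rewrite -(lee_expeR _ (-1)%:E).
case: (tau x) nx => [t| |//].
  rewrite lte_fin => nt; rewrite -EFinM lee_fin mulNr lerN2.
  by rewrite -ler_pdivrMl// mulr1 ltW.
by move=> _; rewrite mulr_infty ltr0_sg ?oppr_lt0// mulN1e leNye.
Qed.

Let mu1 : \int[mu]_x (1 : \bar R) = 1.
Proof. by rewrite integral_cst// mul1e; exact: probability_setT. Qed.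

Let integral_split (A : set (borel X)) (a b : R) : measurable A ->
  (0 <= a)%R -> (0 <= b)%R ->
  \int[mu]_x ((a * \1_A x)%:E + b%:E) = (a * fine (mu A) + b)%:E.
Proof.
move=> mA a0 b0; rewrite EFinD EFinM fineK; last exact: fin_num_measure.
have mind : measurable_fun setT (fun x : borel X => (\1_A x : R)%:E).
  by apply/measurable_EFinP; exact: measurable_indic.
under eq_integral do rewrite EFinM.
rewrite ge0_integralD//; last 2 first.
- by move=> x _; rewrite mule_ge0 ?lee_fin.
- exact: emeasurable_funM.
rewrite ge0_integralZl ?lee_fin// integral_indic// setIT.
by rewrite integral_cst//= probability_setT mule1.
Qed.

Let exp1_half : (expR (-1) < 2^-1 :> R)%R.
Proof. by rewrite expRN ltf_pV2 ?posrE ?expR_gt0// expR1_gt2. Qed.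

Variable nua : {finite_measure set (borel X) -> \bar R}.
Hypothesis nua_mu : nua `<< mu.

Local Notation m := (\int[nua]_x (tau x)^-1).

Let nua_fin : nua setT \is a fin_num. Proof. exact: fin_num_measure. Qed.

Let dual_simple (r : R) := exists phi : borel X -> R,
  [/\ measurable_fun setT phi, finite_set (range phi),
      \int[mu]_x expeR ((phi x)%:E * tau x) < 1 & (r < \int[nua]_x phi x)%R].

Let dual_simple_below (psi : borel X -> \bar R) (M r : R) :
  measurable_fun setT psi -> (forall x, (- M)%:E <= psi x) ->
  (r + M * fine (nua setT))%:E < \int[nua]_x (psi x + M%:E) ->
  \int[mu]_x expeR (psi x * tau x) < 1 -> dual_simple r.
Proof.
move=> mpsi psiM r_lt int1.
have [phi [mphi fphi phile r_phi]] := simple_function_below mpsi psiM r_lt.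
exists phi; split => //; apply: le_lt_trans int1; apply: ge0_le_integral => //.
- exact: measurable_exp_tau.
- apply: measurableT_comp; first exact: measurable_expeR.
  exact: emeasurable_funM.
- by move=> x _; rewrite lee_expeR lee_wpmul2r.
Qed.

(** The function [1 / tau] near [tau = 0] has infinite integral against [nua] at a bounded
    exponential cost; the value [-N] elsewhere restores the constraint. *)
Let dual_infinite (r : R) : m = +oo -> dual_simple r.
Proof.
move=> my.
(* The exponential integral is at most [e * mu (E n) + 1 / e], and this choice makes both terms less
   than [1 / 2]. *)
have e0 : (0 < (2 * expR 1)^-1 :> R)%R by rewrite invr_gt0 mulr_gt0 ?expR_gt0.
have [n muE] := small_E e0 tau_neq0.
pose N : R := n.+1%:R.
have N0 : (0 < N)%R by rewrite ltr0n.
pose psi x := (tau x)^-1 * (\1_(E n) x)%:E + (- N * \1_(~` E n) x)%:E.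
have minv := measurable_inv_tau tau_ge0 mtau.
have inv0 x : 0 <= (tau x)^-1 by rewrite inve_ge0.
have psi_in x : E n x -> psi x = (tau x)^-1.
  by move=> Ex; rewrite /psi !indicE in_setC mem_set//= mule1 mulr0 adde0.
have psi_out x : ~ E n x -> psi x = (- N)%:E.
  by move=> Ex; rewrite /psi !indicE in_setC memNset//= mule0 mulr1 add0e.
have psiN x : (- N)%:E <= psi x.
  have [/psi_in->|/psi_out->//] := pselect (E n x).
  by rewrite (le_trans _ (inv0 x))// lee_fin oppr_le0 ltW.
have mpsi : measurable_fun setT psi.
  apply: emeasurable_funD; first apply: emeasurable_funM => //.
    by apply/measurable_EFinP; exact: measurable_indic.
  by apply/measurable_EFinP; apply: measurable_funM => //;
    exact: measurable_indic (measurableC (mE n)).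
have mpsiN : measurable_fun setT (fun x => psi x + N%:E) by exact:
  emeasurable_funD.
have psiN0 x : 0 <= psi x + N%:E by rewrite -leeBlDr// sub0e -EFinN.
apply: (dual_simple_below mpsi psiN).
  rewrite (_ : \int[nua]_x _ = +oo) ?ltry//.
  apply/eqP; rewrite -leye_eq leNgt; apply/negP => lty; move: my; apply/eqP.
  rewrite lt_eqF//.
  (* Off [E n], [1 / tau] is at most [N], which equals [psi + 2 N] there; a finite integral of
     [psi + N] would therefore make [m] finite. *)
  have le1 : m <= \int[nua]_x ((psi x + N%:E) + N%:E).
    apply: ge0_le_integral => //; first exact: emeasurable_funD.
    move=> x _; have [Ex|nEx] := pselect (E n x).
      by rewrite psi_in// -addeA leeDl// -EFinD lee_fin addr_ge0// ltW.
    rewrite psi_out// -!EFinD addNr add0r.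
    move/negP: nEx; rewrite -ltNge.
    case: (tau x) => [t| |//]; last by rewrite invey lee_fin ltW.
    rewrite lte_fin inver => Nt;
      have t0 : (0 < t)%R by rewrite (lt_trans _ Nt)// invr_gt0.
    by rewrite gt_eqF// lee_fin invf_ple ?posrE// ltW.
  apply: (le_lt_trans le1); rewrite ge0_integralD//; last by move=> x _;
    rewrite lee_fin ltW.
  rewrite lte_add_pinfty// integral_cst//.
  by rewrite -ge0_fin_numE ?fin_numM// mule_ge0 ?lee_fin// ltW.
have bound : \int[mu]_x expeR (psi x * tau x) <=
    \int[mu]_x ((expR 1 * \1_(E n) x)%:E + (expR (-1))%:E).
  apply: ge0_le_integral => //.
  - apply: measurableT_comp; first exact: measurable_expeR.
    exact: emeasurable_funM.
  - apply: emeasurable_funD => //; apply/measurable_EFinP.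
    by apply: measurable_funM => //; exact: measurable_indic.
  - move=> x _; have [Ex|nEx] := pselect (E n x).
      rewrite psi_in// indicE mem_set// mulr1.
      rewrite (@le_trans _ _ (expR 1)%:E) ?leeDl ?lee_fin ?expR_ge0//.
      suff : (tau x)^-1 * tau x <= 1%:E by rewrite -(lee_expeR _ 1%:E).
      case: (tau x) (tau_ge0 x) => [t| |//];
        last by rewrite invey mul0e lee_fin.
      rewrite lee_fin inver; case: eqP => [->|/eqP t0] _;
        first by rewrite mule0 lee_fin.
      by rewrite -EFinM mulVf.
    rewrite psi_out// indicE memNset// mulr0 add0e; exact: expeR_off_E.
apply: (le_lt_trans bound); rewrite integral_split ?expR_ge0//.
have muEfin : mu (E n) \is a fin_num by exact: fin_num_measure.
have {}muE : (fine (mu (E n)) < (2 * expR 1)^-1)%R by rewrite -lte_fin fineK.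
rewrite lte_fin; have : (expR 1 * fine (mu (E n)) < 2^-1)%R.
  by rewrite -ltr_pdivlMl ?expR_gt0// -invfM mulrC.
by have := exp1_half; lra.
Qed.

(** Here [nua] vanishes and every test function has integral 0; a sufficiently negative constant
    makes the constraint strict. *)
Let dual_zero (r : R) : (r < 0)%R -> m = 0 -> dual_simple r.
Proof.
move=> r0 m0.
have e0 : (0 < 2^-1 :> R)%R by [].
have [n muE] := small_E e0 tau_neq0.
exists (cst (- n.+1%:R)%R); split => //.
- have bound : \int[mu]_x expeR ((- n.+1%:R)%:E * tau x) <=
    \int[mu]_x ((1 * \1_(E n) x)%:E + (expR (-1))%:E).
    apply: ge0_le_integral => //.
    + exact: (@measurable_exp_tau _ _ _ mtau (cst (- n.+1%:R)%R)).
    + apply: emeasurable_funD => //; apply/measurable_EFinP.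
      by apply: measurable_funM => //; exact: measurable_indic.
    + move=> x _; have [Ex|nEx] := pselect (E n x).
        rewrite indicE mem_set// mulr1.
        rewrite (@le_trans _ _ 1%:E) ?leeDl ?lee_fin ?expR_ge0//.
        rewrite -[leRHS](@expeR0 R) lee_expeR mule_le0_ge0// lee_fin oppr_le0.
      rewrite indicE memNset// mulr0 add0e; exact: expeR_off_E.
  apply: (le_lt_trans bound); rewrite integral_split ?expR_ge0// mul1r.
  have muEfin : mu (E n) \is a fin_num by exact: fin_num_measure.
  have {}muE : (fine (mu (E n)) < 2^-1)%R by rewrite -lte_fin fineK.
  by rewrite lte_fin; have := exp1_half; lra.
- rewrite Rintegral_cst// [X in (_ * X)%R](_ : _ = 0%R) ?mulr0//.
  exact: (congr1 fine (integral_inv_tau_eq0 tau_ge0 mtau tau_neq0 tau_neqy nua_mu m0)).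
Qed.

(** As [nua] has density [m tau g], the function [ln g / tau] formally gives the integral [m * H]
    and the exponential integral 1; a lower bound and strictness in the constraint are what it
    lacks. *)
Let dual_finite (r : R) : 0 < m -> m < +oo ->
  r%:E < m * relative_entropy (nubar mu tau_ge0 mtau nua) mu -> dual_simple r.
Proof.
move=> m0 my r_lt.
have [P [g [mg g0 Pg [P_mu HE] nuaE]]] :=
  nubar_density tau_ge0 mtau tau_neq0 tau_neqy nua_mu m0 my.
rewrite HE in r_lt; set H := \int[mu]_x (entropy_fun (g x))%:E in r_lt.
have mfin : m \is a fin_num by rewrite ge0_fin_numE// ltW.
have fm0 : (0 < fine m)%R by rewrite fine_gt0// m0.
(* Lowering the logarithm by [s] costs at most [m * s], which has to fit in the gap between [r] and
   [m * H]. *)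
have [s [s0 rs_lt]] : exists s, (0 < s)%R /\ (r + fine m * s)%:E < m * H.
  move: r_lt; case: (m * H) => [y| |//].
    rewrite lte_fin => ry; exists ((y - r) / (2 * fine m))%R; split.
      by rewrite divr_gt0 ?subr_gt0// mulr_gt0.
    rewrite lte_fin mulrC invfM mulrA divfK ?gt_eqF//; lra.
  by move=> _; exists 1%R; rewrite ltr01 ltry.
have es1 : (expR (- s) < 1)%R by rewrite expR_lt1 oppr_lt0.
(* The exponential integral will be at most [e^(-s) + mu (E n) + P (E n) + eta]; three errors below
   [d] keep it under 1. *)
pose d := ((1 - expR (- s)) / 4)%R.
have d0 : (0 < d)%R by rewrite divr_gt0 ?subr_gt0.
have P0 : P [set x | tau x = 0] = 0.
  move/null_content_dominatesP : P_mu; apply => //.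
  by rewrite -[X in measurable X]setTI;
    exact: (mtau measurableT (emeasurable_set1 0)).
have [n [muE PE nd]] : exists n, [/\ mu (E n) < d%:E, P (E n) < d%:E &
    (n.+1%:R^-1 < d)%R].
  have [n1 mun1] := small_E d0 tau_neq0.
  have [n2 Pn2] := small_E d0 P0.
  have /ltr_add_invr[n3] := d0; rewrite add0r => n3d.
  have le1 : (n1 <= maxn n1 (maxn n2 n3))%N by rewrite leq_maxl.
  have le2 : (n2 <= maxn n1 (maxn n2 n3))%N by rewrite leq_max leq_maxl orbT.
  have le3 : (n3 <= maxn n1 (maxn n2 n3))%N by rewrite !leq_max leqnn !orbT.
  exists (maxn n1 (maxn n2 n3)); split.
  - by apply: le_lt_trans mun1; apply: le_measure; rewrite ?inE//;
      exact: E_nincr.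
  - by apply: le_lt_trans Pn2; apply: le_measure; rewrite ?inE//;
      exact: E_nincr.
  - by apply: le_lt_trans n3d; rewrite lef_pV2 ?posrE// ler_nat ltnS.
set eta := (n.+1%:R^-1)%R in nd.
have eta0 : (0 < eta)%R by rewrite invr_gt0.
have eta1 : (eta <= 1)%R by rewrite invf_le1// ler1n.
have lneta : (ln eta <= 0)%R by rewrite ln_le0.
(* [ln g] is the optimal test function; truncating it from below makes
   [phi / tau] bounded below, and subtracting [s] where [tau] is bounded away
   from [0] makes the exponential constraint strict. *)
pose phi x := (ln (Num.max (g x) 1) * \1_(E n) x +
  (ln (Num.max (g x) eta) - s) * \1_(~` E n) x)%R.
have phi_in x : E n x -> phi x = ln (Num.max (g x) 1)%R.
  by move=> Ex; rewrite /phi !indicE in_setC mem_set//= mulr1 mulr0 addr0.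
have phi_out x : ~ E n x -> phi x = (ln (Num.max (g x) eta) - s)%R.
  by move=> Ex; rewrite /phi !indicE in_setC memNset//= mulr0 mulr1 add0r.
have mln (b : R) : measurable_fun setT (fun x => ln (Num.max (g x) b)).
  apply: measurableT_comp; first exact: measurable_ln.
  exact: measurable_maxr.
have mphi : measurable_fun setT phi.
  apply: measurable_funD; apply: measurable_funM => //.
    exact: measurable_funB.
  exact: measurable_indic (measurableC (mE n)).
pose psi x := (phi x * fine (tau x)^-1)%R%:E.
have mpsi : measurable_fun setT psi.
  apply/measurable_EFinP; apply: measurable_funM => //.
  exact: measurableT_comp (fine_measurable measurableT)
    (measurable_inv_tau tau_ge0 mtau).
have psi_tau x t : (0 < t)%R -> tau x = t%:E -> psi x * tau x = (phi x)%:E.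
  move=> t0 tx; rewrite /psi tx inver gt_eqF//= -EFinM -mulrA mulVf ?gt_eqF//.
  by rewrite mulr1.
(* Off [E n], [phi] is at least [ln eta - s] and [1 / tau] at most [1 / eta]; on [E n], [phi] is
   nonnegative. *)
pose M := ((s - ln eta) / eta)%R.
have M0 : (0 <= M)%R by rewrite divr_ge0 ?(ltW eta0)// subr_ge0
  (le_trans lneta)// ltW.
have fineinv0 x : (0 <= fine (tau x)^-1)%R by rewrite fine_ge0// inve_ge0.
have psiM x : (- M)%:E <= psi x.
  rewrite /psi lee_fin; have [Ex|nEx] := pselect (E n x).
    rewrite (@le_trans _ _ 0%R) ?oppr_le0// mulr_ge0// phi_in// ln_ge0//.
    by rewrite le_max lexx orbT.
  have le_eta : (fine (tau x)^-1 <= eta^-1)%R.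
    move/negP: (nEx); rewrite -ltNge.
    case: (tau x) => [t| |//]; last by rewrite invey/= invr_ge0 ltW.
    rewrite lte_fin inver => et; have t0 := lt_trans eta0 et.
    by rewrite gt_eqF//= lef_pV2 ?posrE// ltW.
  apply: (@le_trans _ _ ((ln eta - s) * fine (tau x)^-1)%R).
    by rewrite /M -mulNr opprB ler_wnM2l// subr_le0 (le_trans lneta)// ltW.
  rewrite ler_wpM2r// phi_out// lerD2r ler_ln ?posrE ?lt_max ?eta0 ?orbT//.
  by rewrite le_max lexx orbT.
have mgE : measurable_fun setT (EFin \o g) by exact/measurable_EFinP.
have ae_mu_tau := ae_tau_pos_fin tau_ge0 mtau tau_neq0 tau_neqy.
apply: (dual_simple_below mpsi psiM).
  have mpsiM : measurable_fun setT (fun x => psi x + M%:E) by exact: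
    emeasurable_funD.
  have psiM0 x : 0 <= psi x + M%:E by rewrite -leeBlDr// sub0e -EFinN.
  have ME := nuaE (cst M%:E) (measurable_cst _) (fun _ => M0).
  rewrite (nuaE _ mpsiM psiM0).
  set A := \int[mu]_x _; set B := \int[mu]_x _ in ME.
  have mh : measurable_fun setT (fun x => (entropy_fun (g x))%:E).
    by apply/measurable_EFinP; apply: measurableT_comp => //;
      exact: measurable_entropy_fun.
  have mMt : measurable_fun setT (fun x => M%:E * tau x * (g x)%:E).
    by apply: emeasurable_funM => //; exact: emeasurable_funM.
  have mpMt : measurable_fun setT (fun x => (psi x + M%:E) * tau x * (g x)%:E).
    by apply: emeasurable_funM => //; exact: emeasurable_funM.
  have Mt0 x : 0 <= M%:E * tau x * (g x)%:E by rewrite !mule_ge0 ?lee_fin.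
  have pMt0 x : 0 <= (psi x + M%:E) * tau x * (g x)%:E.
    by apply: mule_ge0; [exact: mule_ge0|rewrite lee_fin].
  have h0 x : 0 <= (entropy_fun (g x))%:E by rewrite lee_fin entropy_fun_ge0.
  have H0 : 0 <= H by exact: integral_ge0.
  have A0 : 0 <= A by exact: integral_ge0.
  have B0 : 0 <= B by exact: integral_ge0.
  have intg : \int[mu]_x (g x)%:E = 1 by rewrite -Pg//; exact: probability_setT.
  (* This integrates [g * ln g <= g * (phi + s)], using that [g] has integral 1; [M tau g] on both
     sides again ensures nonnegative integrands. *)
  have key : H + B <= A + s%:E.
    have : \int[mu]_x ((entropy_fun (g x))%:E + (g x)%:E + M%:E * tau x *
      (g x)%:E) <=
        \int[mu]_x ((psi x + M%:E) * tau x * (g x)%:E + s%:E * (g x)%:E + 1).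
      apply: ae_ge0_le_integral => //.
      - by move=> x _; apply: adde_ge0 => //; apply: adde_ge0 => //;
          rewrite lee_fin.
      - by apply: emeasurable_funD => //; exact: emeasurable_funD.
      - move=> x _; apply: adde_ge0 => //; apply: adde_ge0 => //.
        by rewrite mule_ge0 ?lee_fin ?(ltW s0).
      - by apply: emeasurable_funD => //; apply: emeasurable_funD => //;
          exact: emeasurable_funM.
      - apply: filterS ae_mu_tau => x [t t0 tx] _.
        have le_phi : (g x * ln (g x) <= g x * (phi x + s))%R.
          have := g0 x; rewrite le_eqVlt => /orP[/eqP<-|gx0];
            first by rewrite !mul0r.
          rewrite ler_pM2l//; have [Ex|nEx] := pselect (E n x).
            rewrite phi_in// (@le_trans _ _ (ln (Num.max (g x) 1)%R))//.
              by rewrite ler_ln ?posrE ?lt_max ?gx0// le_max lexx.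
            by rewrite lerDl ltW.
          by rewrite phi_out// subrK ler_ln ?posrE ?lt_max ?gx0// le_max lexx.
        rewrite /psi tx inver gt_eqF//=.
        suff : (entropy_fun (g x) + g x + M * t * g x <=
            (phi x / t + M) * t * g x + s * g x + 1)%R by rewrite -lee_fin.
        rewrite /entropy_fun;
          have -> : ((phi x / t + M) * t * g x = g x * phi x + M * t * g x)%R.
          by rewrite (mulrDl _ _ t) mulfVK ?gt_eqF// mulrDl (mulrC (phi x)).
        by move: le_phi; rewrite mulrDr mulrBr mulr1 (mulrC s); lra.
    rewrite ge0_integralD//; last 2 first.
    - by move=> x _; apply: adde_ge0 => //; rewrite lee_fin.
    - exact: emeasurable_funD.
    rewrite ge0_integralD//; last first.
      by move=> x _; rewrite lee_fin.
    rewrite intg ge0_integralD//; last 2 first.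
    - by move=> x _; apply: adde_ge0 => //; rewrite mule_ge0 ?lee_fin ?(ltW s0).
    - by apply: emeasurable_funD => //; exact: emeasurable_funM.
    rewrite ge0_integralD//; last 2 first.
    - by move=> x _; rewrite mule_ge0 ?lee_fin ?(ltW s0).
    - exact: emeasurable_funM.
    rewrite ge0_integralZl ?lee_fin ?(ltW s0)//; last by move=> x _;
      rewrite lee_fin.
    rewrite intg mule1 mu1 -/H -/A -/B => le1.
    by rewrite -(leeD2rE (x := 1))// addeAC.
  have mB : m * B = (M * fine (nua setT))%:E.
    by rewrite EFinM fineK// -ME integral_cst.
  have : m * (H + B) <= m * (A + s%:E) by rewrite lee_wpmul2l// ltW.
  have -> : m * (H + B) = m * H + m * B by exact: ge0_muleDr.
  have -> : m * (A + s%:E) = m * A + m * s%:E.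
    by apply: ge0_muleDr => //; rewrite lee_fin ltW.
  rewrite mB; have -> : m * s%:E = (fine m * s)%:E by rewrite EFinM fineK.
  move=> /(lt_le_trans _) le2.
  rewrite -(lteD2rE (x := (fine m * s)%:E))//; apply: le2.
  by rewrite -EFinD addrAC EFinD lteD2rE.
(* The exponential of [phi] is [max(g, 1)] on [E n] and [e^(-s) max(g, eta)] off it; each maximum is
   bounded by a sum. *)
have bound : \int[mu]_x expeR (psi x * tau x) <=
    \int[mu]_x ((((1 * \1_(E n) x)%:E + (expR (- s) * eta)%:E) +
      ((g x)%:E * (\1_(E n) x)%:E + (expR (- s))%:E * (g x)%:E))).
  have mind : measurable_fun setT (fun x : borel X => (\1_(E n) x : R)%:E).
    by apply/measurable_EFinP; exact: measurable_indic.
  apply: ae_ge0_le_integral => //.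
  - apply: measurableT_comp; first exact: measurable_expeR.
    exact: emeasurable_funM.
  - move=> x _; apply: adde_ge0; apply: adde_ge0;
      rewrite ?mule_ge0 ?lee_fin ?mulr_ge0//;
      by rewrite ?expR_ge0// ltW.
  - apply: emeasurable_funD; apply: emeasurable_funD => //.
    + by apply/measurable_EFinP; apply: measurable_funM => //;
        exact: measurable_indic.
    + exact: emeasurable_funM.
    + exact: emeasurable_funM.
  - apply: filterS ae_mu_tau => x [t t0 tx] _.
    rewrite (psi_tau x t)//.
    suff : (expR (phi x) <= 1 * \1_(E n) x + expR (- s) * eta +
                            (g x * \1_(E n) x + expR (- s) * g x))%R.
      by rewrite -lee_fin => /le_trans; apply; rewrite !EFinD !EFinM.
    have es0 := expR_ge0 (- s).
    have [Ex|nEx] := pselect (E n x).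
      rewrite phi_in// lnK ?posrE ?lt_max ?ltr01 ?orbT// indicE mem_set// !mulr1.
      have ? : (0 <= expR (- s) * eta)%R by rewrite mulr_ge0// ltW.
      have ? : (0 <= expR (- s) * g x)%R by rewrite mulr_ge0.
      by have := g0 x; case: (leP (g x) 1%R); lra.
    rewrite phi_out// indicE memNset// !mulr0 !add0r addrC expRD lnK;
      last first.
      by rewrite posrE lt_max eta0 orbT.
    rewrite -mulrDr ler_wpM2l//.
    by have := g0 x; case: (leP (g x) eta); lra.
apply: (le_lt_trans bound).
have mind : measurable_fun setT (fun x : borel X => (\1_(E n) x : R)%:E).
  by apply/measurable_EFinP; exact: measurable_indic.
rewrite ge0_integralD//; last 4 first.
- by move=> x _; rewrite adde_ge0 ?lee_fin ?mulr_ge0 ?expR_ge0// ltW.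
- apply: emeasurable_funD => //.
  by apply/measurable_EFinP; apply: measurable_funM => //;
    exact: measurable_indic.
- by move=> x _; rewrite adde_ge0 ?mule_ge0 ?lee_fin ?expR_ge0.
- by apply: emeasurable_funD => //; exact: emeasurable_funM.
rewrite integral_split ?mulr_ge0 ?expR_ge0 ?(ltW eta0)//.
rewrite ge0_integralD//; last 4 first.
- by move=> x _; rewrite mule_ge0 ?lee_fin.
- exact: emeasurable_funM.
- by move=> x _; rewrite mule_ge0 ?lee_fin ?expR_ge0.
- exact: emeasurable_funM.
rewrite ge0_integralZl ?lee_fin ?expR_ge0//; last by move=> x _;
  rewrite lee_fin.
rewrite -Pg// (_ : P setT = 1) ?mule1; last exact: probability_setT.
rewrite (_ : \int[mu]_x _ = P (E n)); last first.
  rewrite Pg// [RHS]integral_mkcond; apply: eq_integral => x _.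
  by rewrite epatch_indic.
have muEfin : mu (E n) \is a fin_num by exact: fin_num_measure.
have PEfin : P (E n) \is a fin_num by exact: fin_num_measure.
have {}muE : (fine (mu (E n)) < d)%R by rewrite -lte_fin fineK.
have {}PE : (fine (P (E n)) < d)%R by rewrite -lte_fin fineK.
rewrite -(fineK PEfin) -!EFinD lte_fin mul1r.
have : (expR (- s) * eta <= eta)%R by rewrite ler_piMl// ltW.
by move: muE PE nd; rewrite /d; lra.
Qed.

Lemma entropy_duality (r : R) :
  r%:E < (if m < +oo then m * relative_entropy (nubar mu tau_ge0 mtau nua) mu
          else +oo) ->
  exists phi : borel X -> R,
  [/\ measurable_fun setT phi, finite_set (range phi),
      \int[mu]_x expeR ((phi x)%:E * tau x) < 1 & (r < \int[nua]_x phi x)%R].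
Proof.
case: ifPn => [my|].
  have : 0 <= m by apply: integral_ge0 => x _; rewrite inve_ge0.
  rewrite le_eqVlt => /orP[/eqP m0|m0].
    by rewrite -m0 mul0e lte_fin => r0; apply: dual_zero.
  exact: dual_finite.
by rewrite -leNgt leye_eq => /eqP my _; exact: dual_infinite.
Qed.

End donsker_varadhan.

(** * The dual formula *)

Section integral_combination.
Context d (T : measurableType d) (R : realType).
Variables (m m1 m2 : {finite_measure set T -> \bar R}) (p q : R).
Hypotheses (p0 : 0 <= p) (q0 : 0 <= q)
  (mE : forall A, measurable A -> m A = (p%:E * m1 A + q%:E * m2 A)%E).

Lemma ge0_integral_combination (F : T -> \bar R) :
  measurable_fun setT F -> (forall x, 0 <= F x)%E ->
  (\int[m]_x F x = p%:E * \int[m1]_x F x + q%:E * \int[m2]_x F x)%E.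
Proof.
move=> mF F0.
rewrite (eq_measure_integral (measure_add (mscale (NngNum p0) m1) (mscale
  (NngNum q0) m2))).
  by rewrite ge0_integral_measure_add// !ge0_integral_mscale.
move=> A mA _; apply: (etrans (mE mA)); apply/esym.
exact: (measure_addE (mscale (NngNum p0) m1) (mscale (NngNum q0) m2) A).
Qed.

(** Serves both for the Lebesgue decomposition, with [p = q = 1], and for convex combinations in
    [M1 X]; adding [M] reduces it to nonnegative functions. *)
Lemma Rintegral_combination (f : T -> R) (M : R) :
  measurable_fun setT f -> (forall x, `|f x| <= M) ->
  \int[m]_x f x = p * \int[m1]_x f x + q * \int[m2]_x f x.
Proof.
move=> mf fM.
have fM0 x : (0 <= (f x + M)%:E)%E.
  by rewrite lee_fin -lerBlDr sub0r; have := fM x; rewrite ler_norml => /andP[].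
have mfM : measurable_fun setT (fun x => (f x + M)%:E).
  by apply/measurable_EFinP; exact: measurable_funD.
have shift (k : {finite_measure set T -> \bar R}) :
    k.-integrable setT (EFin \o f) /\
    (\int[k]_x (f x + M)%:E = (\int[k]_x f x + M * fine (k setT))%:E)%E.
  have ik := @bounded_integrable _ _ _ k _ _ mf fM; split => //.
  have iM : k.-integrable setT (EFin \o (cst M : T -> R)).
    exact: finite_measure_integrable_cst.
  rewrite -Rintegral_cst// -RintegralD// /Rintegral fineK//.
  apply: integrable_fin_num => //.
  rewrite (_ : (fun x => _) = ((EFin \o f) \+ (EFin \o cst M))%E)//.
  exact: integrableD.
have := ge0_integral_combination mfM fM0.
rewrite (shift m).2 (shift m1).2 (shift m2).2 -!EFinM -EFinD => -[].
have -> : fine (m setT) = p * fine (m1 setT) + q * fine (m2 setT).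
  by rewrite mE// -(fineK (fin_num_measure m1 _ measurableT))
    -(fineK (fin_num_measure m2 _ measurableT)) -!EFinM -EFinD.
lra.
Qed.

End integral_combination.

Section ereal_approximation.
Local Open Scope ereal_scope.
Context {R : realType}.

Lemma lee_of_lt (x z : \bar R) : (forall r :
  R, r%:E < x -> r%:E <= z) -> x <= z.
Proof.
case: x => [x| |] H; last exact: leNye.
- apply/lee_addgt0Pr => e e0; rewrite -leeBlDr// -EFinB; apply: H.
  by rewrite lte_fin ltrBlDr ltrDl.
- by rewrite leye_eq; apply/eqP/eq_infty => r; apply: H; rewrite ltry.
Qed.

(** The terms of the rate can thus be approached from below independently. When one is infinite, the
    other is frozen at some real below it and the infinite one takes up the rest. *)
Lemma lee_add_of_lt (x y z : \bar R) : -oo < x -> -oo < y ->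
  (forall r s : R, r%:E < x -> s%:E < y -> (r + s)%:E <= z) -> x + y <= z.
Proof.
move=> xNy yNy H.
have below (w : \bar R) : -oo < w -> exists r : R, r%:E < w.
  case: w => [w| |//] _; last by exists 0%R; rewrite ltry.
  by exists (w - 1)%R; rewrite lte_fin ltrBlDr ltrDl.
have [r0 r0x] := below _ xNy; have [s0 s0y] := below _ yNy.
apply: lee_of_lt => t.
move: x y xNy yNy H r0x s0y => [x| |] [y| |]//= _ _ H r0x s0y txy.
- rewrite -EFinD lte_fin in txy.
  pose e := ((x + y - t) / 2)%R;
    have e0 : (0 < e)%R by rewrite divr_gt0// subr_gt0.
  have -> : t = ((x - e) + (y - e))%R by rewrite /e; lra.
  by apply: H; rewrite lte_fin ltrBlDr ltrDl.
- have -> : t = (r0 + (t - r0))%R by lra.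
  by apply: H => //; rewrite ltry.
- have -> : t = ((t - s0) + s0)%R by lra.
  by apply: H => //; rewrite ltry.
- have -> : t = (r0 + (t - r0))%R by lra.
  by apply: H => //; rewrite ltry.
Qed.

End ereal_approximation.

(** * Upper bounds on admissible pairs *)

Section rate_ceilings.
Local Open Scope ereal_scope.
Context {R : realType} {X : completeMetricType R}.
Variables (mu : probability (borel X) R) (tau : borel X -> \bar R).
Hypotheses (tau_ge0 : forall x, 0 <= tau x)
  (mtau : measurable_fun [set: borel X] tau).

#[local] Hint Resolve expeR_ge0 : core.

Lemma exp_rate_ge0 (A : set X) : measurable (A : set (borel X)) ->
  0 <= exp_rate mu tau A.
Proof.
move=> mA; apply: ereal_sup_ubound; exists 0%R => //; split => //.
rewrite (eq_integral (cst 1)); last by move=> x _; rewrite mul0e expeR0.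
by rewrite integral_cst// mul1e -ge0_fin_numE// fin_num_measure.
Qed.

Lemma xi_ge0 x : 0 <= xi mu tau x.
Proof.
have mB : measurable (ball x 1 : set (borel X)).
  by apply: borel_open; exact: metric_ball_open.
apply: le_trans (exp_rate_ge0 mB) _.
by apply: ereal_sup_ubound; exists 1%R => //=.
Qed.

Lemma xi_infty_ge0 : 0 <= xi_infty mu tau.
Proof.
have m0 : measurable (~` set0 : set (borel X)) by exact: measurableC.
apply: le_trans (exp_rate_ge0 m0) _.
by apply: ereal_sup_ubound; exists set0 => //=; exact: compact0.
Qed.

(** [xi] is lower semicontinuous: for [y] in [ball x (d / 2)], the ball of radius [d / 2] around [y]
    lies in [ball x d], so integrability passes from [x] to [y]. *)
Lemma measurable_xi : measurable_fun [set: borel X] (xi mu tau :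
  borel X -> \bar R).
Proof.
apply: (measurability _ (ErealGenOInfty.measurableE R)).
move=> _ [_ [a ->] <-]; rewrite setTI; apply: borel_open.
rewrite openE => x /=; rewrite in_itv/= andbT => ax.
have [_ [d /= d0 <-] ad] := ereal_sup_gt ax.
have d20 : (0 < d / 2)%R by rewrite divr_gt0.
suff : nbhs x [set y | a%:E < xi mu tau y].
  by apply: filterS => y /= ay; rewrite in_itv/= andbT.
have xd : nbhs x (ball x (d / 2)) by exact: nbhsx_ballx.
apply: filterS xd => y xy /=.
apply: (lt_le_trans ad);
  apply: (@le_trans _ _ (exp_rate mu tau (ball y (d / 2)))).
  apply: ge_ereal_sup => _ [c [c0 ic] <-]; apply: ereal_sup_ubound.
  exists c => //; split => //.
  apply: le_lt_trans ic; apply: ge0_subset_integral => //.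
  - by apply: borel_open; exact: metric_ball_open.
  - by apply: borel_open; exact: metric_ball_open.
  - apply: measurable_funTS; exact: (@measurable_exp_tau _ _ _ mtau (cst c)).
  - move=> z yz; rewrite (splitr d); exact: ball_triangle xy yz.
by apply: ereal_sup_ubound; exists (d / 2)%R.
Qed.

Section admissible_bounds.
Variables (f : Cc X) (c : R).
Hypothesis adm : admissible mu tau (f, c).

Let mexp : measurable_fun setT (fun x : borel X => expeR
  ((sval f x + c)%:E * tau x)).
Proof.
by apply: measurable_exp_tau => //; apply: measurable_funD => //;
  exact: Cc_measurable.
Qed.

Let sub_int (A : set X) (a : R) : measurable (A : set (borel X)) ->
  (forall x, A x -> a <= sval f x + c)%R ->
  \int[mu]_(x in A) expeR (a%:E * tau x) < +oo.
Proof.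
move=> mA Aa.
have ma : measurable_fun (A : set (borel X)) (fun x => expeR (a%:E * tau x)).
  by apply: measurable_funTS; exact: (@measurable_exp_tau _ _ _ mtau (cst a)).
apply: (@le_lt_trans _ _ (\int[mu]_(x in A) expeR ((sval f x + c)%:E * tau x))).
  apply: ge0_le_integral => //; first exact: measurable_funTS.
  by move=> x Ax; rewrite lee_expeR lee_wpmul2r// lee_fin Aa.
apply: (@le_lt_trans _ _ 1); last exact: ltry.
by apply: le_trans adm; apply: ge0_subset_integral.
Qed.

(** By continuity, a number [a] below [f x + c] stays below [f + c] on a ball, where [e^(a tau)] is
    then bounded by the admissible exponential. *)
Lemma admissible_le_xi x : (sval f x + c)%:E <= xi mu tau x.
Proof.
apply: lee_of_lt => a; rewrite lte_fin => ax.
have [a0|a0] := leP 0%R a; last by apply: le_trans (xi_ge0 x);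
  rewrite lee_fin ltW.
have [cf _] := svalP f.
have : nbhs x [set y | a < sval f y + c]%R.
  have cfc : continuous (fun y => sval f y + c)%R.
    by move=> y; apply: cvgD; [exact: cf|exact: cvg_cst].
  have gta : nbhs (sval f x + c)%R [set z | a < z]%R.
    by apply: open_nbhs_nbhs; split => //; exact: open_gt.
  exact: (cfc x _ gta).
move=> /nbhs_ballP[d /= d0 xd].
apply: (@le_trans _ _ (exp_rate mu tau (ball x d))); last first.
  by apply: ereal_sup_ubound; exists d.
apply: ereal_sup_ubound; exists a => //; split => //; apply: sub_int.
  by apply: borel_open; exact: metric_ball_open.
by move=> y /xd /= /ltW.
Qed.

Lemma admissible_le_xi_infty : c%:E <= xi_infty mu tau.
Proof.
have [c0|c0] := leP 0%R c; last by apply: le_trans xi_infty_ge0;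
  rewrite lee_fin ltW.
have [_ csf] := svalP f.
apply: (@le_trans _ _ (exp_rate mu tau
  (~` closure [set x | sval f x != 0%R]))); last first.
  by apply: ereal_sup_ubound; exists (closure [set x | sval f x != 0%R]).
apply: ereal_sup_ubound; exists c => //; split => //; apply: sub_int.
  by apply: measurableC; exact: compact_borel.
move=> x nx; rewrite -lerBlDr subrr.
have /eqP -> // : sval f x == 0%R.
by apply: contra_notT nx => fx; exact: subset_closure.
Qed.

End admissible_bounds.

End rate_ceilings.

Section rate_dual_rate.
Local Open Scope ereal_scope.
Context {R : realType} {X : completeMetricType R}.
Hypotheses (separableX : separable X) (lcX : locally_compact [set: X]).
Variables (mu : probability (borel X) R) (tau : borel X -> \bar R).
Hypotheses (tau_ge0 : forall x, 0 <= tau x)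
  (mtau : measurable_fun [set: borel X] tau)
  (tau_neq0 : mu [set x | tau x = 0] = 0)
  (tau_neqy : mu [set x | tau x = +oo] = 0)
  (xi_eqy : mu [set x | xi mu tau x < +oo] = 0).

#[local] Hint Resolve expeR_ge0 : core.

Variable nu : M1 X.

Local Notation nua := (abs_part nu mu).
Local Notation nus := (sing_part nu mu).
Local Notation m := (\int[nua]_x (tau x)^-1).
Local Notation mH := (m * relative_entropy (nubar mu tau_ge0 mtau nua) mu).

Let nu_split A : measurable A -> nu A = nua A + nus A.
Proof. by have [+ _ _] := abs_sing_partP nu mu; apply. Qed.

Let nua_mu : nua `<< mu.
Proof. by have [] := abs_sing_partP nu mu. Qed.

Let nus_mu : mutually_singular nus mu.
Proof. by have [] := abs_sing_partP nu mu. Qed.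

Let Rint_split (f : borel X -> R) (M : R) : measurable_fun setT f ->
  (forall x, `|f x| <= M)%R ->
  (\int[nu]_x f x = \int[nua]_x f x + \int[nus]_x f x)%R.
Proof.
move=> mf fM; rewrite -[X in (X + _)%R]mul1r -[X in (_ + X)%R]mul1r.
apply: Rintegral_combination fM => // A mA.
by rewrite !mul1e; exact: nu_split.
Qed.

Let nu_mass : (0 <= fine (nu setT) <= 1)%R.
Proof. exact: M1_bound. Qed.

Let nu_massE : 1 - nu setT = (1 - fine (nu setT))%:E.
Proof. by rewrite EFinB fineK// fin_num_measure. Qed.

Let mH_ge0 : 0 <= mH.
Proof.
apply: mule_ge0; last exact: relative_entropy_ge0.
by apply: integral_ge0 => x _; rewrite inve_ge0.
Qed.

Let int_xi_ge0 : 0 <= \int[nus]_x xi mu tau x.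
Proof. by apply: integral_ge0 => x _; exact: xi_ge0. Qed.

Let defect_ge0 : 0 <= (1 - nu setT) * xi_infty mu tau.
Proof.
apply: mule_ge0; last exact: xi_infty_ge0.
by rewrite nu_massE lee_fin subr_ge0; case/andP: nu_mass.
Qed.

Lemma rate_ge0 : 0 <= rate mu tau_ge0 mtau nu.
Proof.
by rewrite /rate; case: ifP => _; [apply: adde_ge0 => //;
  exact: adde_ge0|exact: leey].
Qed.

Lemma dual_rate_le_rate : dual_rate mu tau nu <= rate mu tau_ge0 mtau nu.
Proof.
rewrite /rate; case: ifPn => [my|_]; last exact: leey.
apply: ge_ereal_sup => _ [[f c] adm <-] /=.
have [Mf fMf] := Cc_bounded f.
have mf := Cc_measurable f.
pose psi x := (sval f x + c)%R; pose M := (Mf + `|c|)%R.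
have psiM x : (`|psi x| <= M)%R by rewrite (le_trans (ler_normD _ _))// lerD2r.
have mpsi : measurable_fun setT (psi : borel X -> R) by exact: measurable_funD.
have icst (k : {finite_measure set (borel X) -> \bar R}) :
    (\int[k]_x psi x = \int[k]_x sval f x + c * fine (k setT))%R.
  rewrite RintegralD//; last exact: finite_measure_integrable_cst.
    by rewrite Rintegral_cst.
  exact: Cc_integrable.
(* Passing from [f] to [psi = f + c] leaves the constant only on the mass that [nu] lacks; the three
   terms are then bounded one by one. *)
have -> : (\int[nu]_x sval f x + c = \int[nua]_x psi x + \int[nus]_x psi x +
    (1 - fine (nu setT)) * c)%R.
  by rewrite -(Rint_split mpsi psiM) icst; lra.
rewrite 2!EFinD; apply: leeD; first apply: leeD.
- exact: (gibbs_bound tau_ge0 mtau tau_neq0 tau_neqy nua_mu my mpsi psiM adm).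
- have M0 : (0 <= M)%R by rewrite (le_trans _ (psiM point)).
  have mpsip : measurable_fun setT (fun x : borel X => Num.max (psi x) 0%R).
    exact: measurable_maxr.
  have psipM x : (`|Num.max (psi x) 0| <= M)%R.
    by case: (leP (psi x) 0%R) => _; rewrite ?normr0.
  apply: (@le_trans _ _ (\int[nus]_x (Num.max (psi x) 0)%R%:E)).
    rewrite /Rintegral fineK; last first.
      by apply: integrable_fin_num => //;
        exact: (@bounded_integrable _ _ _ nus _ _ mpsi psiM).
    apply: le_integral => //.
    - exact: (@bounded_integrable _ _ _ nus _ _ mpsi psiM).
    - exact: (@bounded_integrable _ _ _ nus _ _ mpsip psipM).
    - by move=> x _; rewrite lee_fin le_max lexx.
  apply: ge0_le_integral => //.
  - by move=> x _; rewrite lee_fin le_max lexx orbT.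
  - exact/measurable_EFinP.
  - exact: measurable_xi.
  - move=> x _; case: (leP (psi x) 0%R) => _; first exact: xi_ge0.
    exact: (admissible_le_xi tau_ge0 mtau adm).
- rewrite nu_massE EFinM lee_wpmul2l//.
    by rewrite lee_fin subr_ge0; case/andP: nu_mass.
  exact: (admissible_le_xi_infty tau_ge0 mtau adm).
Qed.

Let defect_below (t : R) : t%:E < (1 - nu setT) * xi_infty mu tau ->
  exists (c : R) (K : set X), [/\ (0 <= c)%R, compact K,
    \int[mu]_(x in ~` K) expeR (c%:E * tau x) < +oo &
    (t <= c * (1 - fine (nu setT)))%R].
Proof.
rewrite nu_massE; set p := (1 - fine (nu setT))%R => t_lt.
have p0 : (0 <= p)%R by rewrite subr_ge0; case/andP: nu_mass.
(* Without missing mass the defect is 0 even when [xi_infty] is infinite, and [c = 0] suffices. *)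
move: p0; rewrite le_eqVlt => /orP[/eqP p0|p0].
  exists 0%R, set0; split => //; first exact: compact0.
    rewrite (eq_integral (cst 1)); last by move=> x _; rewrite mul0e expeR0.
    by rewrite integral_cst ?mul1e -?ge0_fin_numE ?fin_num_measure//;
      exact: measurableC.
  by move: t_lt; rewrite -p0 mul0e mul0r lte_fin => /ltW.
have : (t / p)%:E < xi_infty mu tau.
  by rewrite EFinM muleC lte_pdivrMl.
move=> /ereal_sup_gt[_ [K /= cK <-]] /ereal_sup_gt[_ [c [c0 ic] <-]].
rewrite lte_fin ltr_pdivrMr// => /ltW tc.
by exists c, K.
Qed.

Let xi_below (s : R) : s%:E < \int[nus]_x xi mu tau x ->
  exists phi : borel X -> R, [/\ measurable_fun setT phi, finite_set
    (range phi),
    forall x, (phi x)%:E < xi mu tau x & (s < \int[nus]_x phi x)%R].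
Proof.
move=> s_lt.
have [|||phi [mphi fphi phile s_phi]] :=
    @simple_function_below _ _ _ nus (xi mu tau : borel X -> \bar R) 0 s.
- exact: measurable_xi.
- by move=> x; rewrite oppr0 xi_ge0.
- by rewrite mul0r addr0; under eq_integral do rewrite adde0.
(* Subtracting [d] makes [phi] strictly smaller than [xi], as the passage to neighbourhoods demands;
   dividing by the mass plus one keeps the loss below the gap, even if [nus] vanishes. *)
pose k := (fine (nus setT) + 1)%R.
have k0 : (0 < k)%R by rewrite ltr_wpDl// fine_ge0.
pose d := ((\int[nus]_x phi x - s) / k)%R.
have d0 : (0 < d)%R by rewrite divr_gt0// subr_gt0.
exists (fun x => phi x - d)%R; split.
- exact: measurable_funB.
- have := finite_image (fun y => y - d)%R fphi; apply: sub_finite_set.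
  by move=> _ [x _ <-]; exists (phi x) => //; exists x.
- by move=> x; apply: lt_le_trans (phile x); rewrite lte_fin ltrBlDr ltrDl.
- have [B phiB] := finite_range_bounded fphi.
  rewrite RintegralB//; last exact: finite_measure_integrable_cst.
    rewrite Rintegral_cst// ltrBrDr -ltrBrDl.
    rewrite -[ltRHS](divfK (lt0r_neq0 k0)) ltr_pM2l//.
    by rewrite /k ltrDl.
  exact: bounded_integrable phiB.
Qed.

Lemma rate_le_dual_rate : rate mu tau_ge0 mtau nu <= dual_rate mu tau nu.
Proof.
(* The case distinction of [rate] is moved into its first term; the other two are nonnegative, so an
   infinite [V] makes the sum infinite. *)
pose V := if m < +oo then mH else +oo.
have V0 : 0 <= V by rewrite /V; case: ifP => _; rewrite ?leey.
have -> : rate mu tau_ge0 mtau nu =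
    V + \int[nus]_x xi mu tau x + (1 - nu setT) * xi_infty mu tau.
  rewrite /rate /V; case: ifP => // _.
  by rewrite !addye// gt_eqF// ?(lt_le_trans (ltNyr 0))// ltNyr.
have Ny (x : \bar R) : 0 <= x -> -oo < x by exact: lt_le_trans (ltNyr 0%R).
apply: lee_add_of_lt; [exact/Ny/adde_ge0|exact: Ny|move=> rs t rs_lt t_lt].
have [c [K [c0 cK icK tc]]] := defect_below t_lt.
apply: (@le_trans _ _ (rs + c * (1 - fine (nu setT)))%:E).
  by rewrite lee_fin lerD2l.
rewrite EFinD; move: rs_lt.
set q := (c * _)%R.
suff main : forall r s : R, r%:E < V -> s%:E < \int[nus]_x xi mu tau x ->
    (r + s + q)%:E <= dual_rate mu tau nu.
  move=> rs_lt; rewrite -leeBrDr//; apply: le_trans (ltW rs_lt) _.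
  apply: lee_add_of_lt; [exact: Ny|exact: Ny|move=> r s rV sxi].
  by rewrite leeBrDr// -EFinD main.
move=> r s rV /xi_below[phis [mphis fphis phis_xi s_phis]].
have [phia [mphia fphia int1 r_phia]] :=
  entropy_duality tau_neq0 tau_neqy nua_mu rV.
have [N [mN muN nusN]] := nus_mu.
(* [N] carries the singular part and is [mu]-negligible, so the two parts are
   tested independently. *)
pose phi x := (phis x * \1_N x + phia x * \1_(~` N) x)%R.
have phi_in x : N x -> phi x = phis x.
  by move=> Nx; rewrite /phi !indicE in_setC mem_set//= mulr1 mulr0 addr0.
have phi_out x : ~ N x -> phi x = phia x.
  by move=> Nx; rewrite /phi !indicE in_setC memNset//= mulr0 mulr1 add0r.
have mphi : measurable_fun setT phi.
  apply: measurable_funD; apply: measurable_funM => //.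
  exact: measurable_indic (measurableC mN).
have fphi : finite_set (range phi).
  have fU : finite_set (range phis `|` range phia) by rewrite finite_setU.
  apply: sub_finite_set fU.
  move=> _ [x _ <-]; have [Nx|nNx] := pselect (N x).
    by left; exists x => //; rewrite phi_in.
  by right; exists x => //; rewrite phi_out.
have nuaN : nua N = 0.
  by move/null_content_dominatesP : nua_mu; apply.
have mxi : measurable [set x : borel X | xi mu tau x = +oo].
  rewrite -[X in measurable X]setTI.
  have mx : measurable_fun [set: borel X] (xi mu tau : borel X -> \bar R).
    exact: measurable_xi.
  exact: (mx measurableT _ (emeasurable_set1 +oo)).
have mxic : measurable [set x : borel X | xi mu tau x < +oo].
  rewrite (_ : [set x | _] = ~` [set x : borel X | xi mu tau x = +oo]).
    exact: measurableC.
  by apply/seteqP; split => x /=; rewrite lt_neqAle leey andbT => /eqP.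
(* [S] has full measure for [mu] because [xi] is infinite almost everywhere, for [nua] by absolute
   continuity and for [nus] through [N]. On [N], [phi] is below [xi] by the choice of [phis];
   elsewhere in [S], because [xi] is infinite. *)
pose S : set (borel X) := N `|` [set x | xi mu tau x = +oo].
have mS : measurable S by exact: measurableU.
have SC : ~` S `<=` [set x : borel X | xi mu tau x < +oo].
  move=> x nS /=; rewrite lt_neqAle leey andbT; apply/eqP => xiy.
  by apply: nS; right.
have null_sub (k : {measure set (borel X) -> \bar R}) (A B : set (borel X)) :
    measurable A -> measurable B -> A `<=` B -> k B = 0 -> k A = 0.
  move=> mA mB AB kB; apply/eqP; rewrite -measure_le0 -kB.
  by apply: le_measure; rewrite ?inE.
have muS : mu (~` S) = 0.
  by apply: (null_sub mu _ _ _ mxic SC) => //; exact: measurableC.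
have nuS : nu (~` S) = 0.
  rewrite nu_split; last exact: measurableC.
  rewrite (null_sub nua _ _ _ mxic SC) ?add0e//; last 2 first.
  - exact: measurableC.
  - by move/null_content_dominatesP : nua_mu; apply.
  apply: (null_sub nus _ (~` N)) => //;
    [exact: measurableC|exact: measurableC|].
  by apply: subsetC => x Nx; left.
have phiS x : S x -> (phi x <= 0)%R \/ (phi x)%:E < xi mu tau x.
  move=> Sx; right; have [Nx|nNx] := pselect (N x).
    by rewrite phi_in//; exact: phis_xi.
  by case: Sx => [//|/= ->]; rewrite ltry.
have int_phi : \int[mu]_x expeR ((phi x)%:E * tau x) < 1.
  rewrite (_ : \int[mu]_x _ = \int[mu]_x expeR ((phia x)%:E * tau x))//.
  apply: ae_eq_integral => //;
    [exact: measurable_exp_tau|exact: measurable_exp_tau|].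
  exists N; split => // x /= nx; apply: contrapT => nNx; apply: nx => _.
  by rewrite phi_out.
have := dual_rate_ge_simple separableX lcX tau_ge0 mtau tau_neqy mphi mS phiS
  fphi muS nuS c0 cK icK int_phi.
apply: le_trans; rewrite lee_fin lerD2r.
have [B phiB] := finite_range_bounded fphi.
rewrite (Rint_split mphi phiB).
have -> : (\int[nua]_x phi x = \int[nua]_x phia x)%R.
  congr fine; apply: ae_eq_integral => //;
    [exact/measurable_EFinP|exact/measurable_EFinP|].
  exists N; split => // x /= nx; apply: contrapT => nNx; apply: nx => _.
  by rewrite phi_out.
have -> : (\int[nus]_x phi x = \int[nus]_x phis x)%R.
  congr fine; apply: ae_eq_integral => //;
    [exact/measurable_EFinP|exact/measurable_EFinP|].
  exists (~` N); split => //; first exact: measurableC.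
  by move=> x /= nx Nx; apply: nx => _; rewrite phi_in.
by rewrite lerD// ltW.
Qed.

Lemma rateE : rate mu tau_ge0 mtau nu = dual_rate mu tau nu.
Proof. by apply/eqP; rewrite eq_le rate_le_dual_rate dual_rate_le_rate. Qed.

End rate_dual_rate.

(** * Convexity, closed sublevels and a point of finiteness *)

Section dual_rate_properties.
Local Open Scope convex_scope.
Local Open Scope ereal_scope.
Context {R : realType} {X : completeMetricType R}.
Variables (mu : probability (borel X) R) (tau : borel X -> \bar R).

Lemma dual_rate_convex : convex_functional (dual_rate (X := X) mu tau).
Proof.
move=> t a b; apply: ge_ereal_sup => _ [[f c] adm <-] /=.
have [M fM] := Cc_bounded f; have mf := Cc_measurable f.
have t0 : (0 <= t%:num)%R by [].
have s0 : (0 <= 1 - t%:num)%R by rewrite subr_ge0.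
have convE : (\int[M1_conv t a b]_x sval f x =
    t%:num * \int[a]_x sval f x + (1 - t%:num) * \int[b]_x sval f x)%R.
  exact: (Rintegral_combination t0 s0 _ mf fM).
have -> : (\int[a <| t |> b]_x sval f x + c =
    t%:num * (\int[a]_x sval f x + c) + (1 - t%:num) *
      (\int[b]_x sval f x + c))%R.
  by rewrite [X in (X + c)%R]convE; lra.
rewrite EFinD !EFinM; apply: leeD; apply: lee_wpmul2l; rewrite ?lee_fin//.
  by apply: ereal_sup_ubound; exists (f, c).
by apply: ereal_sup_ubound; exists (f, c).
Qed.

Lemma dual_rate_closed (M : R) : closed [set nu :
  M1 X | dual_rate mu tau nu <= M%:E].
Proof.
rewrite (_ : [set nu | _] = \bigcap_(p in admissible mu tau)
    [set nu : M1 X | (\int[nu]_x sval p.1 x <= M - p.2)%R]).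
  apply: closed_bigI => p _.
  apply: (@closed_comp _ _ (fun nu : M1 X => \int[nu]_x sval p.1 x)%R
    [set z | z <= M - p.2]%R); last exact: closed_le.
  by move=> nu _; exact: vague_continuous.
apply/seteqP; split=> nu /= nuM.
  move=> p adm /=; rewrite lerBrDr -lee_fin; apply: le_trans nuM.
  by apply: ereal_sup_ubound; exists p.
by apply: ge_ereal_sup => _ [p adm <-]; rewrite lee_fin -lerBrDr; exact: nuM.
Qed.

Hypotheses (separableX : separable X) (lcX : locally_compact [set: X])
  (tau_ge0 : forall x, 0 <= tau x)
  (mtau : measurable_fun [set: borel X] tau)
  (tau_neq0 : mu [set x | tau x = 0] = 0)
  (tau_neqy : mu [set x | tau x = +oo] = 0).

Lemma bounded_tau_charged : exists n : nat, 0 < mu [set x | tau x <= n%:R%:E].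
Proof.
have mge n : measurable [set x | n%:R%:E < tau x].
  by rewrite -[X in measurable X]setTI; exact: emeasurable_fun_o_infty.
have [||n mun] := @nonincreasing_measure_lt _ _ _ mu
    (fun n => [set x | n%:R%:E < tau x]) 1 mge.
- by move=> n k nk x /=; apply: le_lt_trans; rewrite lee_fin ler_nat.
- apply: (@le_lt_trans _ _ (mu [set x | tau x = +oo]));
    last by rewrite tau_neqy lte01.
  apply: le_measure; rewrite ?inE.
  + exact: bigcap_measurable.
  + rewrite -[X in measurable X]setTI;
      exact: (mtau measurableT (emeasurable_set1 +oo)).
  + move=> x xn /=; apply/eqP; rewrite -leye_eq leNgt; apply/negP => xy.
    have xfin : tau x \is a fin_num by rewrite ge0_fin_numE.
    have := xn (Num.bound (fine (tau x))) I; rewrite /= ltNge => /negP; apply.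
    rewrite -[leLHS](fineK xfin) lee_fin ltW//; apply: archi_boundP.
    exact: fine_ge0.
- exists n; rewrite lt_neqAle measure_ge0 andbT eq_sym; apply/eqP => mu0.
  have mun1 : mu [set x | n%:R%:E < tau x] = 1.
    rewrite (_ : [set x | _] = ~` [set x | tau x <= n%:R%:E]).
      rewrite probability_setC ?mu0 ?sube0//.
      by rewrite -[X in measurable X]setTI; exact: emeasurable_fun_infty_c.
    by apply/seteqP; split => x /=; rewrite ltNge => /negP.
  suff : (1 : \bar R) < 1 by rewrite ltxx.
  by rewrite -[X in X < _]mun1; exact: mun.
Qed.

(** Restricting to a sublevel of [tau] makes the normalization [Z] finite; as that sublevel is
    charged and [tau] is positive almost everywhere, [Z] is also positive. The dual functional is
    then at most [1 / Z]. *)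
Lemma dual_rate_finite : exists nu : M1 X, dual_rate mu tau nu < +oo.
Proof.
have [n mun] := bounded_tau_charged.
set A := [set x | tau x <= n%:R%:E] in mun.
have mA : measurable A.
  by rewrite -[A]setTI; exact: emeasurable_fun_infty_c.
pose w x := (fine (tau x) * \1_A x)%R.
have w0 x : (0 <= w x)%R by rewrite mulr_ge0// fine_ge0.
have mw : measurable_fun setT w.
  by apply: measurable_funM => //;
    exact: measurableT_comp (fine_measurable measurableT) mtau.
have wE0 x : 0 <= (w x)%:E by rewrite lee_fin.
have mwE : measurable_fun setT (EFin \o w) by exact/measurable_EFinP.
set Z := \int[mu]_x (w x)%:E.
have wn x : (w x)%:E <= n%:R%:E.
  rewrite lee_fin /w indicE; case: (boolP (x \in A)) => [|_];
    last by rewrite mulr0.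
  rewrite inE /A /= mulr1 => xn; rewrite -lee_fin fineK//.
  by rewrite ge0_fin_numE// (le_lt_trans xn)// ltry.
have Zy : Z < +oo.
  apply: (@le_lt_trans _ _ (\int[mu]_x (cst n%:R%:E x))).
    by apply: ge0_le_integral.
  rewrite integral_cst// -ge0_fin_numE; last by rewrite mule_ge0 ?lee_fin.
  by rewrite fin_numM// fin_num_measure.
have Z0 : 0 < Z.
  rewrite lt_neqAle integral_ge0// andbT eq_sym; apply/eqP => Z0.
  have : {ae mu, forall x, [set: borel X] x -> (w x)%:E = 0}.
    apply/(ae_eq_integral_abs mu measurableT mwE).
    by rewrite -[RHS]Z0; apply: eq_integral => x _;
      rewrite gee0_abs// lee_fin w0.
  move=> w_eq0; have : {ae mu, forall x, (~` A) x}.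
    apply: filterS2 w_eq0 (ae_tau_pos_fin tau_ge0 mtau tau_neq0 tau_neqy).
    move=> x /(_ I) wx [t t0 tx] Ax.
    move: wx; rewrite /w tx indicE mem_set// mulr1 /= => -[t00].
    by rewrite t00 ltxx in t0.
  move=> [B [mB B0 AB]]; move: mun; rewrite lt_neqAle => /andP[/eqP + _]; apply.
  apply/esym/eqP; rewrite -measure_le0 -B0; apply: le_measure; rewrite ?inE//.
  by move=> x Ax; apply: AB => /=; exact.
have Zfin : Z \is a fin_num by rewrite ge0_fin_numE// ltW.
have fZ0 : (0 < fine Z)%R by rewrite fine_gt0// Z0.
pose D := density_measure mu wE0 mwE.
pose P : probability (borel X) R := mnormalize D mu.
have PE B : measurable B -> P B = \int[mu]_(x in B) (w x / fine Z)%:E.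
  move=> mB; rewrite /P /= /mnormalize /=.
  rewrite [X in if X then _ else _](_ : _ = false); last first.
    apply/negP => /orP[/eqP m00|/eqP myy].
      by move: Z0; rewrite /Z; rewrite /density_measure in m00;
        rewrite m00 ltxx.
    by move: Zy; rewrite /Z; rewrite /density_measure in myy; rewrite myy ltxx.
  rewrite /density_measure -/Z muleC -ge0_integralZl//.
  - by apply: eq_integral => x _; rewrite -EFinM mulrC.
  - exact: measurable_funTS.
  - by rewrite lee_fin invr_ge0 ltW.
have [nu nuE] := M1_of_subprobability P separableX lcX.
exists nu; apply: (@le_lt_trans _ _ (fine Z)^-1%:E); last exact: ltry.
apply: ge_ereal_sup => _ [[f c] adm <-] /=.
have [Mf fMf] := Cc_bounded f.
have mf := Cc_measurable f.
pose psi x := (sval f x + c)%R.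
have mpsi : measurable_fun setT (psi : borel X -> R) by exact: measurable_funD.
have psiM x : (`|psi x| <= Mf + `|c|)%R.
  by rewrite (le_trans (ler_normD _ _))// lerD2r.
pose pp x := Num.max (psi x) 0%R.
have mpp : measurable_fun setT (pp : borel X -> R) by exact: measurable_maxr.
have pp0 x : (0 <= pp x)%R by rewrite le_max lexx orbT.
have ppM x : (`|pp x| <= Mf + `|c|)%R.
  have M0 : (0 <= Mf + `|c|)%R by rewrite (le_trans _ (psiM x)).
  by rewrite /pp; case: (leP (psi x) 0%R) => _; rewrite ?normr0.
(* [nu] has total mass 1, so the constant is absorbed into the integrand. *)
have -> : (\int[nu]_x sval f x + c = \int[nu]_x psi x)%R.
  rewrite RintegralD//; last exact: finite_measure_integrable_cst.
    have nuT : nu setT = 1 by rewrite nuE//; exact: probability_setT.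
    rewrite Rintegral_cst// [X in (c * X)%R](_ : _ = 1%R) ?mulr1//.
    exact: (congr1 fine nuT).
  exact: Cc_integrable.
apply: (@le_trans _ _ (\int[nu]_x (pp x)%:E)).
  rewrite /Rintegral fineK; last first.
    by apply: integrable_fin_num => //;
      exact: (@bounded_integrable _ _ _ nu _ _ mpsi psiM).
  apply: le_integral => //.
  - exact: (@bounded_integrable _ _ _ nu _ _ mpsi psiM).
  - exact: (@bounded_integrable _ _ _ nu _ _ mpp ppM).
  - by move=> x _; rewrite lee_fin le_max lexx.
have mwZ : measurable_fun setT (fun x => w x / fine Z)%R by exact:
  measurable_funM.
have wZ0 x : (0 <= w x / fine Z)%R by rewrite divr_ge0// ltW.
have nuwE B : measurable B -> nu B = \int[mu]_(x in B) (w x / fine Z)%:E.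
  by move=> mB; rewrite nuE//; exact: PE.
rewrite (ge0_integral_density mwZ wZ0 nuwE)//; last exact/measurable_EFinP.
have mexp : measurable_fun setT (fun x : borel X => expeR ((psi x)%:E * tau x)).
  exact: measurable_exp_tau.
apply: (@le_trans _ _ (\int[mu]_x ((fine Z)^-1%:E * expeR
  ((psi x)%:E * tau x)))).
  apply: ge0_le_integral => //.
  - by move=> x _; rewrite mule_ge0 ?lee_fin.
  - by apply: emeasurable_funM; exact/measurable_EFinP.
  - exact: emeasurable_funM.
  - move=> x _; rewrite -EFinM mulrA mulrC EFinM lee_wpmul2l//.
      by rewrite lee_fin invr_ge0 ltW.
    rewrite /w indicE; case: (boolP (x \in A)) => [|_];
      last by rewrite !mulr0 expeR_ge0.
    rewrite inE /A /= mulr1 => xn.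
    have xfin : tau x \is a fin_num by rewrite ge0_fin_numE//
      (le_lt_trans xn)// ltry.
    suff : (pp x * fine (tau x) <= expR (psi x * fine (tau x)))%R.
      rewrite -lee_fin => /le_trans; apply.
      by rewrite -[X in _ <= expeR (_ * X)](fineK xfin).
    rewrite /pp; case: (leP (psi x) 0%R) => _; first by rewrite mul0r expR_ge0.
    by apply: le_trans (expR_ge1Dx _); rewrite lerDr.
rewrite ge0_integralZl//.
- rewrite -[leRHS]mule1 lee_wpmul2l// lee_fin invr_ge0 ltW//.
- by move=> x _; exact: expeR_ge0.
- by rewrite lee_fin invr_ge0 ltW.
Qed.

End dual_rate_properties.

Local Open Scope ereal_scope.

Theorem proposition1p5 (R : realType) (X : completeMetricType R)
  (separableX : separable X) (locally_compactX : locally_compact [set: X])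
  (mubar : probability (borel X) R) (tau : borel X -> \bar R)
  (tau_ge0 : forall x, 0 <= tau x)
  (mtau : measurable_fun [set: borel X] tau)
  (tau_neq0 : mubar [set x | tau x = 0] = 0)
  (tau_neqy : mubar [set x | tau x = +oo] = 0)
  (xi_eqy : mubar [set x | xi mubar tau x < +oo] = 0) :
  good_functional (rate mubar tau_ge0 mtau) /\
  convex_functional (rate mubar tau_ge0 mtau).
Proof.
have -> : rate mubar tau_ge0 mtau = dual_rate mubar tau.
  by apply/funext => nu; exact: rateE.
split; last exact: dual_rate_convex.
split => [nu|M _|].
- by rewrite -(rateE separableX locally_compactX tau_ge0 mtau)//; exact: rate_ge0.
- have cM1 := compact_M1 separableX locally_compactX.
  by apply: (subclosed_compact _ cM1); [exact: dual_rate_closed|exact: subsetT].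
- have [nu nuy] := dual_rate_finite separableX locally_compactX tau_ge0 mtau tau_neq0
    tau_neqy.
  by exists nu; rewrite lt_eqF.
Qed.
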